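(* Let $f\in L^1_u(\mathbf R_+)$ and $\Delta=\alpha^{-1}(i\sigma(A)\cap\mathbf R)$. If $\widehat f=0$ on $\Delta$ and $\mathrm{supp}\,\widehat f\cap\Delta$ is residual, then $$\lim_{t\to\infty}\frac{\|T(t)\widehat f(T)\|}{u(t)}=0 .$$
   Context: $X$ is a complex Banach space and $A$ is the generator of a $C_0$-semigroup $\{T(t):t\in\mathbf R_+\}$ of bounded operators on $X$; $\sigma(A)$ is the spectrum of $A$. It is assumed that $\|T(t)\|\le u(t)$ for all $t\in\mathbf R_+=[0,\infty)$, where $u=vw$ and $v,w$ are as follows. For a function $g$: $\Delta_hg(t)=g(t+h)-g(t)$. $w:\mathbf R\to\mathbf R$ is a weight, i.e. a continuous function with $w\ge 1$, $w(s+t)\le w(s)w(t)$, $w(-t)=w(t)$, $\sum_{n\ge1}n^{-2}\log w(nt)<\infty$ for all $s,t$; $w=1$ or $1/w\in C_0(\mathbf R)$; $\Delta_hw/w\in C_0(\mathbf R)$ for every $h$; $\sup_t|\Delta_hw(t)|/w(t)\to0$ as $h\to0$ (a bounded weight is assumed to be $1$); and $w$ has polynomial growth of some order $N\in\mathbf Z_+$: $\lim_{|m|\to\infty}w(mt)/(1+|m|^{N+1})=0$ for all $t\in\mathbf R$ and $\inf_{m\in\mathbf Z}w(mt)/|m|^N>0$ for some $t$. $v:\mathbf R\to[1,\infty)$ is continuous with $v(s+t)\le v(s)v(t)$; $\Delta_hv/v\in C_0(\mathbf R)$ for every $h$; $\sup_t|\Delta_hv(t)|/v(t)\to0$ as $h\to0$;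 $v$ is differentiable on $\mathbf R_+$ and $v'/v\in C_0(\mathbf R_+,\mathbf R)$. $L^1_w(\mathbf R)$ is the space of measurable $f:\mathbf R\to\mathbf C$ with $\int|f|w<\infty$, and $L^1_u(\mathbf R_+)=\{f\in L^1_w(\mathbf R): f=0\text{ on }\mathbf R\setminus\mathbf R_+,\ vf\in L^1_w(\mathbf R)\}$. For $f\in L_u^1(\mathbf R_+)$, $\widehat f(T)=\int_0^\infty T(s)f(s)\,ds$ (strongly convergent Bochner integral). For a character $\gamma\in\widehat{\mathbf R}$, $\widehat f(\gamma)=\int_{\mathbf R}\gamma(-t)f(t)\,dt$; $\alpha:\widehat{\mathbf R}\to\mathbf R$ is the isomorphism $\alpha(\gamma_s)=s$ where $\gamma_s(t)=e^{ist}$. $i\sigma(A)=\{i\lambda:\lambda\in\sigma(A)\}$. A set is perfect if it equals its set of accumulation points, and residual if it is closed and has no non-empty perfect subset. *)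

(* Defs.v *)
From HB Require Import structures.
From mathcomp Require Import all_boot all_order all_algebra.
From mathcomp Require Import complex.
From mathcomp Require Import all_classical all_reals all_analysis.

Set Implicit Arguments.
Unset Strict Implicit.
Unset Printing Implicit Defensive.

Import Order.TTheory GRing.Theory Num.Theory.
Import numFieldNormedType.Exports.

Local Open Scope classical_set_scope.
Local Open Scope ring_scope.
Local Open Scope complex_scope.

(* In R[i] the norm `|z| is itself an element of R[i]; [Nrm] is the
   corresponding real number, for z in any normed module over R[i]. *)
Definition Nrm {R : realType} {X : normedZmodType R[i]} (x : X) : R :=
  complex.Re `|x|.

Definition expi {R : realType} (x : R) : R[i] := cos x +i* sin x.

Section weights.
Context {R : realType}.
Implicit Types g w v : R -> R.

Definition Delta h g : R -> R := fun t => g (t + h) - g t.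

Definition C0 g :=
  [/\ continuous g, g t @[t --> +oo] --> 0 & g t @[t --> -oo] --> 0].

Definition C0_Rplus g :=
  {within `[0, +oo[, continuous g} /\ g t @[t --> +oo] --> 0.

(* sup_t |Delta_h g(t)| / g(t), allowed to be infinite a priori. *)
Definition sup_rel_increment g h : \bar R :=
  ereal_sup [set (`|Delta h g t| / g t)%:E | t in setT].

Record is_weight w : Prop := IsWeight {
  weight_cont : continuous w ;
  weight_ge1 : forall t, 1 <= w t ;
  weight_submul : forall s t, w (s + t) <= w s * w t ;
  weight_even : forall t, w (- t) = w t ;
  weight_nonquasianalytic : forall t,
    cvgn (series (fun n => ln (w (n.+1%:R * t)) / n.+1%:R ^+ 2)) ;
  weight_const_or_C0 :
    w = (fun=> 1) \/ C0 (fun t => (w t)^-1) ;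
  weight_bounded : (exists M, forall t, w t <= M) -> w = (fun=> 1) ;
  weight_increment_C0 : forall h, C0 (fun t => Delta h w t / w t) ;
  weight_increment_cvg0 :
    sup_rel_increment w h @[h --> (0 : R)^'] --> 0%E
}.

(* In the infimum m = 0 is excluded: there w 0 / 0 ^+ N has to be read as
   +oo when N > 0 (whereas it is 0 in MathComp), and is at least 1 when
   N = 0. *)
Definition polynomial_growth w (N : nat) :=
  (forall t e : R, 0 < e -> exists M : nat, forall m : int, (M <= `|m|)%N ->
     `|w (m%:~R * t) / (1 + `|m%:~R| ^+ N.+1)| < e) /\
  (exists t, 0 < inf [set w (m%:~R * t) / `|m%:~R| ^+ N |
                        m in [set m : int | m != 0]]).

(* dv is the derivative of v on R_+; at 0 the derivative is one-sided. *)
Definition is_derivative_Rplus v (dv : R -> R) :=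
  forall t : R, 0 <= t ->
    (v (t + h) - v t) / h @[h --> within [set h : R | 0 <= t + h] (0 : R)^']
      --> dv t.

Record is_v_function v : Prop := IsVFunction {
  v_cont : continuous v ;
  v_ge1 : forall t, 1 <= v t ;
  v_submul : forall s t, v (s + t) <= v s * v t ;
  v_increment_C0 : forall h, C0 (fun t => Delta h v t / v t) ;
  v_increment_cvg0 :
    sup_rel_increment v h @[h --> (0 : R)^'] --> 0%E ;
  v_derivative : exists2 dv, is_derivative_Rplus v dv &
                             C0_Rplus (fun t => dv t / v t)
}.

End weights.

Section function_spaces.
Context {R : realType}.
Notation mu := (@lebesgue_measure R).

Definition L1w (w : R -> R) (f : R -> R[i]) :=
  [/\ measurable_fun setT (fun t => complex.Re (f t)),
      measurable_fun setT (fun t => complex.Im (f t)) &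
      (\int[mu]_(t in setT) (Nrm (f t) * w t)%:E < +oo)%E].

Definition L1u_Rplus (v w : R -> R) (f : R -> R[i]) :=
  [/\ L1w w f, (forall t, t < 0 -> f t = 0) &
      L1w w (fun t => (v t)%:C * f t)].

Definition Cintegral (f : R -> R[i]) : R[i] :=
  (\int[mu]_(t in setT) complex.Re (f t))%R +i*
  (\int[mu]_(t in setT) complex.Im (f t))%R.

End function_spaces.

Section dual_group.
Context {R : realType}.
Notation mu := (@lebesgue_measure R).

(* R[i]^o is R[i] with the topology given by its norm. *)
Definition is_character (gamma : R -> R[i]^o) :=
  [/\ continuous gamma, (forall t, Nrm (gamma t) = 1) &
      forall s t, gamma (s + t) = gamma s * gamma t].

(* The dual group of R, with the topology induced by the compact-open one. *)
Definition dual : topologicalType :=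
  set_type [set gamma : {compact-open, R -> R[i]^o} | is_character gamma].

Definition character (gamma : dual) : R -> R[i] := set_val gamma.

(* The isomorphism alpha sends the character t |-> exp(ist) to s, so this is
   the inverse image of S under alpha. *)
Definition alpha_preimage (S : set R) : set dual :=
  [set gamma | exists2 s, S s & forall t, character gamma t = expi (s * t)].

Definition fourier (f : R -> R[i]) (gamma : dual) : R[i] :=
  Cintegral (fun t => character gamma (- t) * f t).

Definition supp (g : dual -> R[i]) : set dual :=
  closure [set gamma | g gamma != 0].

Definition residual {T : topologicalType} (A : set T) :=
  closed A /\ forall P, P `<=` A -> perfect_set P -> P = set0.

End dual_group.

Section bochner.
Context {R : realType} {X : completeNormedModType R[i]}.
Notation mu := (@lebesgue_measure R).

(* A step function \sum_k \1_(A_k) *: x_k is given by the list of the pairs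
   (A_k, x_k). *)
Definition is_step (D : set R) (s : seq (set R * X)) :=
  forall p, p \in s -> [/\ measurable p.1, p.1 `<=` D & (mu p.1 < +oo)%E].

Definition step_eval (s : seq (set R * X)) (t : R) : X :=
  \sum_(p <- s) (\1_(p.1) t)%:C *: p.2.

Definition step_integral (s : seq (set R * X)) : X :=
  \sum_(p <- s) (fine (mu p.1))%:C *: p.2.

Definition is_bochner_integral (D : set R) (F : R -> X) (I : X) :=
  exists s : nat -> seq (set R * X),
  [/\ (forall n, is_step D (s n)),
      {ae mu, forall t, D t -> step_eval (s n) t @[n --> \oo] --> F t},
      (\int[mu]_(t in D) (Nrm (F t - step_eval (s n) t))%:E)%E
        @[n --> \oo] --> 0%E &
      step_integral (s n) @[n --> \oo] --> I].

Definition bochner_integral (D : set R) (F : R -> X) : X :=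
  xget 0 [set I | is_bochner_integral D F I].

End bochner.

Section semigroups.
Context {R : realType} {X : completeNormedModType R[i]}.

(* The operator norm, +oo if L is unbounded. *)
Definition opnorm (L : X -> X) : \bar R :=
  ereal_sup [set (Nrm (L x))%:E | x in [set x | Nrm x <= 1]].

(* Only the values T t with 0 <= t are meaningful. *)
Record is_C0_semigroup (T : R -> {linear X -> X}) : Prop := IsC0Semigroup {
  semigroup_bounded : forall t, 0 <= t -> (opnorm (T t) < +oo)%E ;
  semigroup0 : forall x, T 0 x = x ;
  semigroupD : forall s t, 0 <= s -> 0 <= t ->
    forall x, T (s + t) x = T s (T t x) ;
  semigroup_cvg0 : forall x, T h x @[h --> (0 : R)^'+] --> x
}.

(* The graph of the generator: (x, y) belongs to it iff x is in the domain
   of A and y = A x. *)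
Definition generator (T : R -> {linear X -> X}) : set (X * X) :=
  [set p | (h^-1)%:C *: (T h p.1 - p.1) @[h --> (0 : R)^'+] --> p.2].

(* lambda is in the resolvent set of the operator with graph A iff
   lambda - A : dom A -> X has an everywhere defined bounded inverse. *)
Definition resolvent_set (A : set (X * X)) : set R[i] :=
  [set lambda | exists Q : {linear X -> X},
     [/\ (opnorm Q < +oo)%E,
         (forall x y, A (x, y) -> Q (lambda *: x - y) = x) &
         forall z, exists2 y, A (Q z, y) & lambda *: Q z - y = z]].

Definition spectrum (A : set (X * X)) : set R[i] := ~` resolvent_set A.

(* i sigma(A) `&` R *)
Definition ispectrum_real (A : set (X * X)) : set R :=
  [set s | [set (0 +i* 1) * lambda | lambda in spectrum A] s%:C].

Definition fhat_op (T : R -> {linear X -> X}) (f : R -> R[i]) : X -> X :=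
  fun x => bochner_integral `[0, +oo[ (fun s => f s *: T s x).

End semigroups.

(* Main.v *)
Require Import Defs.
From HB Require Import structures.
From mathcomp Require Import all_boot all_order all_algebra.
From mathcomp Require Import complex.
From mathcomp Require Import all_classical all_reals all_analysis.
From mathcomp Require Import measurable_realfun ring lra.
Import Order.TTheory GRing.Theory Num.Theory.
Import numFieldNormedType.Exports.

Set Implicit Arguments.
Unset Strict Implicit.
Unset Printing Implicit Defensive.

Local Open Scope classical_set_scope.
Local Open Scope ring_scope.
Local Open Scope complex_scope.

(* If the limit fails, there are tau_n -> oo, x_n in the unit ball and
   functionals l_n such that psi_n(s) = l_n(T(tau_n + s) x_n) / u(tau_n) pairs
   with f to something bounded away from 0; since u(tau + s) / u(tau) -> 1, the
   psi_n are asymptotically bounded on R.  Call a frequency s good for a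
   sequence if its smoothings by the Fejer-type kernels with spectrum near s
   tend to 0 pointwise.  Off the spectrum of A all frequencies are good for
   psi_n, because e^(i sigma s) psi_n(s) is there a second derivative of an
   orbit.  For the equicontinuous sequence of the functions
   r |-> \int f(s) psi_n(s + r) ds, the bad frequencies form a closed set
   contained in supp f^ and in Delta, and f^ = 0 on Delta excludes isolated bad
   points (a point is a set of synthesis).  The bad set is thus perfect, hence
   empty by residuality, and a sequence all of whose frequencies are good tends
   to 0 pointwise. *)

(** * Integrals of complex-valued functions *)

(** The ratios u(tau_n + s) / u(tau_n) tend to 1 for each s but not uniformly in s, so psi_n is
    truncated at a fixed level before the spectral argument; the truncation is undone by dominated
    convergence with a multiple of |f| u as majorant, which is where submultiplicativity of u
    enters. Working with sequences, and with pointwise convergence to 0 in the role of vanishing,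
    avoids extracting a weak-star limit, and dominated convergence makes the notion stable under the
    action of L^1. The psi_n themselves need not be equicontinuous, since x_n varies; smoothing by f
    repairs this, and equicontinuity is what turns convergence of all windows into convergence of
    the sequence. Off the spectrum two resolvents are applied: with one, integration by parts
    against a triangle of width a gives a bound without decay, while a second derivative leaves
    three point values and a factor 1/a. Sign convention: the frequency s stands for the function
    e^(-ist), on which f acts as multiplication by f^(s), and for the point lambda = -is, for which
    i lambda = s. *)

Section norm1.
Context {R : realType}.
Implicit Types z w : R[i].

(* Equivalent to [Nrm], and better suited to integrating componentwise. *)
Definition norm1 z : R := `|complex.Re z| + `|complex.Im z|.

Lemma norm1_ge0 z : 0 <= norm1 z.
Proof. by rewrite addr_ge0. Qed.

Lemma norm1_0 : norm1 0 = 0.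
Proof. by rewrite /norm1 /= normr0 addr0. Qed.

Lemma norm1_eq0 z : norm1 z = 0 -> z = 0.
Proof.
case: z => a b; rewrite /norm1 /= => /eqP.
rewrite paddr_eq0 // !normr_eq0 => /andP[/eqP -> /eqP ->]; reflexivity.
Qed.

Lemma cReD z w : complex.Re (z + w) = complex.Re z + complex.Re w.
Proof. by case: z w => a b [c d]. Qed.

Lemma cImD z w : complex.Im (z + w) = complex.Im z + complex.Im w.
Proof. by case: z w => a b [c d]. Qed.

Lemma cReN z : complex.Re (- z) = - complex.Re z.
Proof. by case: z. Qed.

Lemma cImN z : complex.Im (- z) = - complex.Im z.
Proof. by case: z. Qed.

Lemma cReM z w : complex.Re (z * w) =
  complex.Re z * complex.Re w - complex.Im z * complex.Im w.
Proof. by case: z w => a b [c d]. Qed.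

Lemma cImM z w : complex.Im (z * w) =
  complex.Re z * complex.Im w + complex.Im z * complex.Re w.
Proof. by case: z w => a b [c d]. Qed.

Lemma complexP z w : complex.Re z = complex.Re w ->
  complex.Im z = complex.Im w -> z = w.
Proof. by case: z w => a b [c d] /= -> ->. Qed.

Lemma norm1D z w : norm1 (z + w) <= norm1 z + norm1 w.
Proof.
rewrite /norm1 cReD cImD; have := ler_normD (complex.Re z) (complex.Re w).
have := ler_normD (complex.Im z) (complex.Im w); lra.
Qed.

Lemma norm1N z : norm1 (- z) = norm1 z.
Proof. by rewrite /norm1 cReN cImN !normrN. Qed.

Lemma norm1B z w : norm1 (z - w) <= norm1 z + norm1 w.
Proof. by rewrite -(norm1N w) norm1D. Qed.

Lemma norm1_sub z w : norm1 z <= norm1 w + norm1 (z - w).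
Proof. by have := norm1D w (z - w); rewrite addrC subrK. Qed.

Lemma norm1M z w : norm1 (z * w) <= norm1 z * norm1 w.
Proof.
rewrite /norm1 cReM cImM mulrDl !mulrDr -!normrM.
have := ler_normB (complex.Re z * complex.Re w) (complex.Im z * complex.Im w).
have := ler_normD (complex.Re z * complex.Im w) (complex.Im z * complex.Re w).
lra.
Qed.

Lemma norm1_real (x : R) : norm1 x%:C = `|x|.
Proof. by rewrite /norm1 /= normr0 addr0. Qed.

Lemma norm1_realM (x : R) z : norm1 (x%:C * z) = `|x| * norm1 z.
Proof.
by rewrite /norm1 cReM cImM /= !mul0r subr0 addr0 !normrM mulrDr.
Qed.

Lemma norm1_expi (x : R) : norm1 (expi x) <= 2.
Proof.
rewrite /norm1 /=.
have c : `|cos x| <= 1 by rewrite ler_norml cos_geN1 cos_le1.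
have s : `|sin x| <= 1 by rewrite ler_norml sin_geN1 sin_le1.
lra.
Qed.

Lemma expiD (x y : R) : expi (x + y) = expi x * expi y.
Proof. by apply: complexP; rewrite ?cReM ?cImM /= ?cosD ?sinD; ring. Qed.

Lemma expi0 : expi (0 : R) = 1.
Proof. by rewrite /expi cos0 sin0. Qed.

Lemma NrmE z : Nrm z = Num.sqrt (complex.Re z ^+ 2 + complex.Im z ^+ 2).
Proof. by case: z. Qed.

Lemma Nrm_le_norm1 z : Nrm z <= norm1 z.
Proof.
rewrite NrmE -[leRHS]ger0_norm ?norm1_ge0// -sqrtr_sqr ler_wsqrtr//.
rewrite /norm1 sqrrD !real_normK ?num_real//.
have := mulr_ge0 (normr_ge0 (complex.Re z)) (normr_ge0 (complex.Im z)).
rewrite -mulr_natl; lra.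
Qed.

Lemma Re_le_Nrm z : `|complex.Re z| <= Nrm z.
Proof.
rewrite NrmE -sqrtr_sqr ler_wsqrtr// lerDl sqr_ge0//.
Qed.

Lemma Im_le_Nrm z : `|complex.Im z| <= Nrm z.
Proof.
rewrite NrmE -sqrtr_sqr ler_wsqrtr// lerDr sqr_ge0//.
Qed.

Lemma norm1_le_Nrm z : norm1 z <= 2 * Nrm z.
Proof. have := Re_le_Nrm z; have := Im_le_Nrm z; rewrite /norm1; lra. Qed.

End norm1.

Section measurability.
Context {R : realType} {d : measure_display} {T : measurableType d}.
Implicit Types f g : T -> R[i].

Definition measC f := measurable_fun setT (fun t => complex.Re (f t)) /\
  measurable_fun setT (fun t => complex.Im (f t)).

Lemma measC_cst z : measC (fun=> z).
Proof. by split; exact: measurable_cst. Qed.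

Lemma measCD f g : measC f -> measC g -> measC (fun t => f t + g t).
Proof.
move=> [f1 f2] [g1 g2]; split.
  by under eq_fun do rewrite cReD; exact: measurable_funD.
by under eq_fun do rewrite cImD; exact: measurable_funD.
Qed.

Lemma measCN f : measC f -> measC (fun t => - f t).
Proof.
move=> [f1 f2]; split.
  by under eq_fun do rewrite cReN; exact: measurableT_comp.
by under eq_fun do rewrite cImN; exact: measurableT_comp.
Qed.

Lemma measCB f g : measC f -> measC g -> measC (fun t => f t - g t).
Proof. by move=> ? ?; apply: measCD => //; apply: measCN. Qed.

Lemma measCM f g : measC f -> measC g -> measC (fun t => f t * g t).
Proof.
move=> [f1 f2] [g1 g2]; split.
  by under eq_fun do rewrite cReM; apply: measurable_funB; exact: measurable_funM.
by under eq_fun do rewrite cImM; apply: measurable_funD; exact: measurable_funM.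
Qed.

Lemma measC_real (g : T -> R) : measurable_fun setT g ->
  measC (fun t => (g t)%:C).
Proof. by move=> mg; split => //=; exact: measurable_cst. Qed.

Lemma measurable_norm1 f : measC f -> measurable_fun setT (fun t => norm1 (f t)).
Proof.
by move=> [f1 f2]; apply: measurable_funD; exact: measurableT_comp.
Qed.

Lemma measC_expi (g : T -> R) : measurable_fun setT g ->
  measC (fun t => expi (g t)).
Proof.
move=> mg; split => /=; apply: measurableT_comp => //;
  apply: continuous_measurable_fun; [exact: continuous_cos|exact: continuous_sin].
Qed.

Lemma measC_if (P : T -> bool) f : measurable_fun setT P -> measC f ->
  measC (fun t => if P t then f t else 0).
Proof.
move=> mP [f1 f2]; split.
  rewrite (_ : (fun _ => _) = (fun t => if P t then complex.Re (f t) else 0)).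
    by apply: measurable_fun_ifT => //; exact: measurable_cst.
  by apply/funext => t; case: ifP.
rewrite (_ : (fun _ => _) = (fun t => if P t then complex.Im (f t) else 0)).
  by apply: measurable_fun_ifT => //; exact: measurable_cst.
by apply/funext => t; case: ifP.
Qed.

End measurability.

Lemma measC_comp (R : realType) (d d' : measure_display) (T : measurableType d)
    (T' : measurableType d') (f : T -> R[i]) (g : T' -> T) :
  measC f -> measurable_fun setT g -> measC (fun t => f (g t)).
Proof.
move=> [f1 f2] mg; split.
  exact: (measurableT_comp (f := fun t => complex.Re (f t)) f1 mg).
exact: (measurableT_comp (f := fun t => complex.Im (f t)) f2 mg).
Qed.

Section integration.
Context {R : realType}.
Notation mu := (@lebesgue_measure R).
Implicit Types (f g : R -> R[i]) (h k : R -> R).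

Definition intR h := mu.-integrable setT (EFin \o h).

Definition intC f := intR (fun t => complex.Re (f t)) /\
  intR (fun t => complex.Im (f t)).

Lemma intR_measurable h : intR h -> measurable_fun setT h.
Proof. by move=> /measurable_int /measurable_EFinP. Qed.

Lemma intR_le h k : measurable_fun setT h -> (forall t, `|h t| <= k t) ->
  intR k -> intR h.
Proof.
move=> mh hk ik; apply: (le_integrable measurableT _ _ ik).
  exact/measurable_EFinP.
by move=> t _ /=; rewrite lee_fin (le_trans (hk t))// ler_norm.
Qed.

Lemma intRD h k : intR h -> intR k -> intR (fun t => h t + k t).
Proof. by move=> ih ik; exact: (@integrableD _ _ _ mu setT measurableT _ _ ih ik). Qed.

Lemma intRN h : intR h -> intR (fun t => - h t).
Proof. by move=> ih; exact: (@integrableN _ _ _ mu setT _ ih). Qed.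

Lemma intRZ c h : intR h -> intR (fun t => c * h t).
Proof. by move=> ih; exact: (@integrableZl _ _ _ mu setT measurableT c _ ih). Qed.

Lemma intR_abs h : intR h -> intR (fun t => `|h t|).
Proof. by move=> ih; exact: (@integrable_abse _ _ _ mu setT _ ih). Qed.

Lemma intR0 : intR (fun=> 0).
Proof. exact: integrable0. Qed.

Lemma intC_measC f : intC f -> measC f.
Proof. by move=> [? ?]; split; exact: intR_measurable. Qed.

Lemma intC_norm1 f : intC f -> intR (fun t => norm1 (f t)).
Proof. by move=> [? ?]; apply: intRD; exact: intR_abs. Qed.

Lemma intC_le f k : measC f -> (forall t, norm1 (f t) <= k t) ->
  intR k -> intC f.
Proof.
move=> [m1 m2] fk ik; split; apply: (intR_le _ _ ik) => // t;
  by apply: le_trans (fk t); rewrite /norm1 ?lerDl ?lerDr.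
Qed.

Lemma intCP f : measC f -> intR (fun t => norm1 (f t)) -> intC f.
Proof. by move=> mf; apply: intC_le. Qed.

Lemma intCD f g : intC f -> intC g -> intC (fun t => f t + g t).
Proof.
move=> [f1 f2] [g1 g2]; split.
  by under eq_fun do rewrite cReD; exact: intRD.
by under eq_fun do rewrite cImD; exact: intRD.
Qed.

Lemma intCN f : intC f -> intC (fun t => - f t).
Proof.
move=> [f1 f2]; split.
  by under eq_fun do rewrite cReN; exact: intRN.
by under eq_fun do rewrite cImN; exact: intRN.
Qed.

Lemma intCB f g : intC f -> intC g -> intC (fun t => f t - g t).
Proof. by move=> ? ?; apply: intCD => //; apply: intCN. Qed.

Lemma intCMbd f g M : intC f -> measC g -> (forall t, norm1 (g t) <= M) ->
  intC (fun t => f t * g t).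
Proof.
move=> fi mg gM; apply: (@intC_le _ (fun t => M * norm1 (f t))).
- by apply: measCM => //; exact: intC_measC.
- move=> t; apply: (le_trans (norm1M _ _)).
  by rewrite mulrC ler_wpM2r// norm1_ge0.
- by apply: intRZ; exact: intC_norm1.
Qed.

Lemma intCZ c f : intC f -> intC (fun t => c * f t).
Proof.
move=> fi; under eq_fun do rewrite mulrC.
apply: (@intCMbd _ _ (norm1 c)) => //; exact: measC_cst.
Qed.

Lemma intC_real h : intR h -> intC (fun t => (h t)%:C).
Proof. by move=> ih; split => //=; exact: intR0. Qed.

Lemma CintegralD f g : intC f -> intC g ->
  Cintegral (fun t => f t + g t) = Cintegral f + Cintegral g.
Proof.
move=> [f1 f2] [g1 g2]; rewrite /Cintegral; apply: complexP => /=.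
  by under eq_Rintegral do rewrite cReD; rewrite RintegralD.
by under eq_Rintegral do rewrite cImD; rewrite RintegralD.
Qed.

Lemma CintegralZ c f : intC f ->
  Cintegral (fun t => c * f t) = c * Cintegral f.
Proof.
move=> [f1 f2]; rewrite /Cintegral; apply: complexP => /=.
  under eq_Rintegral do rewrite cReM.
  by rewrite RintegralB ?RintegralZl ?cReM//; exact: intRZ.
under eq_Rintegral do rewrite cImM.
by rewrite RintegralD ?RintegralZl ?cImM//; exact: intRZ.
Qed.

Lemma CintegralN f : intC f -> Cintegral (fun t => - f t) = - Cintegral f.
Proof.
move=> fi; under [X in Cintegral X]eq_fun do rewrite -mulN1r.
by rewrite CintegralZ// mulN1r.
Qed.

Lemma CintegralB f g : intC f -> intC g ->
  Cintegral (fun t => f t - g t) = Cintegral f - Cintegral g.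
Proof. by move=> fi gi; rewrite CintegralD ?CintegralN//; exact: intCN. Qed.

Lemma Cintegral0 : Cintegral (fun=> 0 : R[i]) = 0.
Proof.
rewrite /Cintegral /=; apply: complexP => /=;
  by rewrite /Rintegral integral0.
Qed.

Lemma norm1_Cintegral f : intC f ->
  norm1 (Cintegral f) <= \int[mu]_t norm1 (f t).
Proof.
move=> [f1 f2]; rewrite [leLHS]/norm1 /=.
rewrite [leRHS]RintegralD//; [|exact: intR_abs..].
by apply: lerD; exact: le_normr_Rintegral.
Qed.

Lemma Rintegral_le h k : intR h -> intR k -> (forall t, h t <= k t) ->
  \int[mu]_t h t <= \int[mu]_t k t.
Proof. by move=> ih ik hk; exact: le_Rintegral. Qed.

Lemma norm1_Cintegral_le f k : intC f -> intR k ->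
  (forall t, norm1 (f t) <= k t) -> norm1 (Cintegral f) <= \int[mu]_t k t.
Proof.
move=> fi ik fk; apply: (le_trans (norm1_Cintegral fi)).
by apply: Rintegral_le => //; exact: intC_norm1.
Qed.

Lemma cvg0_Rintegral (h : nat -> R -> R) k :
  (forall n, measurable_fun setT (h n)) ->
  (forall n t, `|h n t| <= k t) -> intR k ->
  {ae mu, forall t, h n t @[n --> \oo] --> 0} ->
  \int[mu]_t h n t @[n --> \oo] --> 0.
Proof.
move=> mh hk ik h0.
have D := @dominated_convergence _ _ _ mu setT measurableT
  (fun n => EFin \o h n) (fun=> 0%E) (EFin \o k).
have [|||||_ _ H] := D.
- by move=> n; apply/measurable_EFinP; exact: mh.
- exact: measurable_cst.
- apply: (@filterS _ _ (ae_filter_ringOfSetsType mu) _ _ _ h0) => t h0t _; by apply: cvg_EFin => //; exact: nearW.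
- exact: ik.
- by apply: aeW => t n _; rewrite /= lee_fin.
rewrite integral0 in H.
by move/fine_cvg : H.
Qed.

Lemma cvg0_Cintegral (F : nat -> R -> R[i]) k :
  (forall n, measC (F n)) -> (forall n t, norm1 (F n t) <= k t) -> intR k ->
  {ae mu, forall t, norm1 (F n t) @[n --> \oo] --> 0} ->
  norm1 (Cintegral (F n)) @[n --> \oo] --> 0.
Proof.
move=> mF Fk ik F0.
apply: (@squeeze_cvgr _ _ _ _ (fun=> 0) (fun n => \int[mu]_t norm1 (F n t))).
- near=> n; rewrite norm1_ge0/=; apply: norm1_Cintegral.
  by apply: (intC_le _ (Fk n) ik).
- exact: cvg_cst.
- apply: (@cvg0_Rintegral _ k) => // [n|n t]; first exact: measurable_norm1.
  by rewrite ger0_norm ?norm1_ge0.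
Unshelve. all: by end_near. Qed.

(** Sections are integrable for every parameter, not almost every one, so that [fine] can be removed
    from the inner integrals pointwise; the last clause is Tonelli's condition. *)
Definition intR2 (K : R * R -> R) :=
  [/\ measurable_fun setT K,
      (forall x, intR (fun y => K (x, y))),
      (forall y, intR (fun x => K (x, y))) &
      intR (fun x => \int[mu]_y `|K (x, y)|)].

Lemma intR_integral_EFin h : intR h ->
  (\int[mu]_t (h t)%:E)%E = (\int[mu]_t h t)%:E.
Proof. by move=> ih; rewrite /Rintegral fineK//; exact: integrable_fin_num. Qed.

Lemma Rintegral_Fubini K : intR2 K ->
  \int[mu]_x \int[mu]_y K (x, y) = \int[mu]_y \int[mu]_x K (x, y).
Proof.
move=> [mK K1 K2 K3].
have iK : (mu \x mu)%E.-integrable setT (EFin \o K).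
  apply/integrable12ltyP; first exact/measurable_EFinP.
  have : (\int[mu]_x (\int[mu]_y `|K (x, y)|)%:E < +oo)%E.
    by rewrite intR_integral_EFin ?ltry.
  congr (_ < _)%E; apply: eq_integral => x _ /=.
  by rewrite -intR_integral_EFin//; exact: intR_abs.
rewrite /Rintegral; congr fine.
under eq_integral do rewrite -/(Rintegral _ _ _) -intR_integral_EFin//.
under [RHS]eq_integral do rewrite -/(Rintegral _ _ _) -intR_integral_EFin//.
exact: (Fubini iK).
Qed.

Definition intC2 (K : R * R -> R[i]) :=
  [/\ measC K,
      (forall x, intR (fun y => norm1 (K (x, y)))),
      (forall y, intR (fun x => norm1 (K (x, y)))) &
      intR (fun x => \int[mu]_y norm1 (K (x, y)))].

Lemma measurable_Rintegral1 (K : R * R -> R) : measurable_fun setT K ->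
  (forall z, 0 <= K z) -> measurable_fun setT (fun x => \int[mu]_y K (x, y)).
Proof.
move=> mK K0; apply: (measurableT_comp (f := fine)) => //.
apply: (measurable_fun_fubini_tonelli_F (m2 := mu) (EFin \o K)).
  exact/measurable_EFinP.
by move=> z /=; rewrite lee_fin.
Qed.

Lemma intC2_Re K : intC2 K -> intR2 (fun z => complex.Re (K z)).
Proof.
move=> [[m1 m2] K1 K2 K3].
have le z : `|complex.Re (K z)| <= norm1 (K z) by rewrite /norm1 lerDl.
have i1 x : intR (fun y => complex.Re (K (x, y))).
  by apply: (intR_le _ _ (K1 x)) => //; apply: (measurableT_comp m1).
split=> //.
  by move=> y; apply: (intR_le _ _ (K2 y)) => //; apply: (measurableT_comp m1).
apply: (intR_le _ _ K3).
  apply: (@measurable_Rintegral1 (fun z => `|complex.Re (K z)|)) => //.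
  exact: measurableT_comp.
move=> x; rewrite ger0_norm ?Rintegral_ge0//.
by apply: Rintegral_le => // ; exact: intR_abs.
Qed.

Lemma intC2_Im K : intC2 K -> intR2 (fun z => complex.Im (K z)).
Proof.
move=> [[m1 m2] K1 K2 K3].
have le z : `|complex.Im (K z)| <= norm1 (K z) by rewrite /norm1 lerDr.
have i1 x : intR (fun y => complex.Im (K (x, y))).
  by apply: (intR_le _ _ (K1 x)) => //; apply: (measurableT_comp m2).
split=> //.
  by move=> y; apply: (intR_le _ _ (K2 y)) => //; apply: (measurableT_comp m2).
apply: (intR_le _ _ K3).
  apply: (@measurable_Rintegral1 (fun z => `|complex.Im (K z)|)) => //.
  exact: measurableT_comp.
move=> x; rewrite ger0_norm ?Rintegral_ge0//.
by apply: Rintegral_le => // ; exact: intR_abs.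
Qed.

Lemma Cintegral_Fubini K : intC2 K ->
  Cintegral (fun x => Cintegral (fun y => K (x, y))) =
  Cintegral (fun y => Cintegral (fun x => K (x, y))).
Proof.
move=> iK; apply: complexP; rewrite /Cintegral /=.
  exact: (Rintegral_Fubini (intC2_Re iK)).
exact: (Rintegral_Fubini (intC2_Im iK)).
Qed.

Lemma measC_Cintegral (K : R * R -> R[i]) : intC2 K ->
  measC (fun x => Cintegral (fun y => K (x, y))).
Proof.
suff H (L : R * R -> R) : intR2 L ->
    measurable_fun setT (fun x => \int[mu]_y L (x, y)).
  by move=> iK; split; [exact: H (intC2_Re iK)|exact: H (intC2_Im iK)].
move=> [mL L1 L2 L3].
have iL : (mu \x mu)%E.-integrable setT (EFin \o L).
  apply/integrable12ltyP; first exact/measurable_EFinP.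
  have : (\int[mu]_x (\int[mu]_y `|L (x, y)|)%:E < +oo)%E.
    by rewrite intR_integral_EFin ?ltry.
  congr (_ < _)%E; apply: eq_integral => x _ /=.
  by rewrite -intR_integral_EFin//; exact: intR_abs.
apply: (measurableT_comp (f := fine)) => //.
exact: (measurable_fubini_F iL).
Qed.

Lemma intC_Cintegral (K : R * R -> R[i]) : intC2 K ->
  intC (fun x => Cintegral (fun y => K (x, y))).
Proof.
move=> iK; apply: intCP; first exact: measC_Cintegral.
have [mK K1 K2 K3] := iK.
apply: (intR_le _ _ K3).
  by apply: measurable_norm1; exact: measC_Cintegral.
move=> t; rewrite ger0_norm ?norm1_ge0//; apply: norm1_Cintegral.
apply: intCP => //.
apply: (measC_comp (f := K) (g := fun y => (t, y))) => //.
exact: pair1_measurable.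
Qed.

Lemma measurable_affine (a b : R) :
  measurable_fun setT (fun t : R => a * t + b).
Proof.
by apply: measurable_funD; [exact: measurable_funM|exact: measurable_cst].
Qed.

Lemma ge0_integral_affine (a b : R) (h : R -> \bar R) : 0 < a ->
  measurable_fun setT h -> (forall t, 0 <= h t)%E ->
  (\int[mu]_t h t = a%:E * \int[mu]_t h (a * t + b)%R)%E.
Proof.
move=> a0 mh h0.
pose phi : R -> measurableTypeR R := fun t => a * t + b.
have mphi : measurable_fun setT phi by exact: measurable_affine.
pose r : {nonneg R} := NngNum (ltW a0).
pose m0 : {measure set _ -> \bar R} := mscale r (pushforward mu phi).
pose m := m0 mphi.
(* Lebesgue measure and [a] times its image under [phi] agree on the intervals ]x, y], hence on all
   measurable sets. *)
have E (A : set R) : measurable A -> mu A = m A.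
  apply: lebesgue_measure_unique => _ [[x y]] _ <-.
  rewrite /m /m0 /mscale /= /mscale /= /pushforward.
  have -> : phi @^-1` `]x, y] = `](x - b) / a, (y - b) / a]%classic.
    apply/seteqP; split => t /=; rewrite !in_itv/= /phi;
    by rewrite ltr_pdivrMr// ler_pdivlMr// ltrBlDr lerBrDr [t * a]mulrC.
  rewrite !lebesgue_measure_itv/= !lte_fin.
  rewrite ltr_pM2r ?invr_gt0// ltrD2r; case: ifPn => _; last by rewrite mule0.
  by rewrite -!EFinB -EFinM -mulrBl mulrCA divff ?gt_eqF// mulr1; congr EFin; ring.
rewrite (@eq_measure_integral _ _ _ setT m mu h); last by move=> A mA _; exact: E.
by rewrite ge0_integral_mscale//= ge0_integral_pushforward.
Qed.

Lemma intR_affine (a b : R) h : 0 < a -> intR h -> intR (fun t => h (a * t + b)).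
Proof.
move=> a0 ih; apply/integrableP; split.
  apply/measurable_EFinP; apply: measurableT_comp (measurable_affine a b).
  exact: intR_measurable.
have /integrableP[mh] := ih.
rewrite (@ge0_integral_affine a b (fun t => `|(EFin \o h) t|%E))//.
  case: (\int[mu]_t _)%E => //= [r _|]; first by rewrite ltry.
  by rewrite gt0_muley ?lte_fin.
exact: measurableT_comp.
Qed.

Lemma Rintegral_affine (a b : R) h : 0 < a -> intR h ->
  \int[mu]_t h (a * t + b) = a^-1 * \int[mu]_t h t.
Proof.
move=> a0 ih.
have ih' := intR_affine b a0 ih.
suff : \int[mu]_t h t = a * \int[mu]_t h (a * t + b).
  by move=> ->; rewrite mulrA mulVf ?mul1r ?gt_eqF.
apply: EFin_inj; rewrite EFinM -!intR_integral_EFin//.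
rewrite integralE [in RHS]integralE.
rewrite (@ge0_integral_affine a b (fun t => (EFin \o h)^\+ t)%E)//; last first.
  by apply: measurable_funepos; exact: measurable_int ih.
rewrite (@ge0_integral_affine a b (fun t => (EFin \o h)^\- t)%E)//; last first.
  by apply: measurable_funeneg; exact: measurable_int ih.
rewrite [RHS]muleBr//; last exact: (integrable_add_def measurableT ih').
by congr (_ * _ - _ * _)%E; apply: eq_integral => t _; rewrite ?funeposE ?funenegE.
Qed.

Lemma intC_affine (a b : R) f : 0 < a -> intC f ->
  intC (fun t => f (a * t + b)).
Proof.
move=> a0 [f1 f2]; split.
  exact: (intR_affine (h := fun t => complex.Re (f t)) b a0 f1).
exact: (intR_affine (h := fun t => complex.Im (f t)) b a0 f2).
Qed.

Lemma Cintegral_affine (a b : R) f : 0 < a -> intC f ->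
  Cintegral (fun t => f (a * t + b)) = (a^-1)%:C * Cintegral f.
Proof.
move=> a0 [f1 f2]; apply: complexP; rewrite ?cReM ?cImM /=.
  rewrite (Rintegral_affine (h := fun t => complex.Re (f t)) b a0 f1); ring.
rewrite (Rintegral_affine (h := fun t => complex.Im (f t)) b a0 f2); ring.
Qed.

Lemma intR_shift (b : R) h : intR h -> intR (fun t => h (t + b)).
Proof. by move=> /(intR_affine b ltr01); under eq_fun do rewrite mul1r. Qed.

Lemma Rintegral_shift (b : R) h : intR h ->
  \int[mu]_t h (t + b) = \int[mu]_t h t.
Proof.
move=> /(Rintegral_affine b ltr01); under eq_Rintegral do rewrite mul1r.
by rewrite invr1 mul1r.
Qed.

Lemma intC_shift (b : R) f : intC f -> intC (fun t => f (t + b)).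
Proof. by move=> /(intC_affine b ltr01); under eq_fun do rewrite mul1r. Qed.

Lemma Cintegral_shift (b : R) f : intC f ->
  Cintegral (fun t => f (t + b)) = Cintegral f.
Proof.
move=> fi; have := Cintegral_affine b ltr01 fi.
rewrite invr1 (_ : 1%:C = 1)// mul1r => <-.
by congr Cintegral; apply/funext => t; rewrite mul1r.
Qed.

End integration.

(** * The triangle and the Fejer kernels *)

Section tri.
Context {R : realType}.
Notation mu := (@lebesgue_measure R).

Definition tri (x : R) : R := Num.max 0 (1 - `|x|).

Lemma tri_ge0 x : 0 <= tri x. Proof. by rewrite /tri le_max lexx. Qed.

Lemma tri_le1 x : tri x <= 1.
Proof. by rewrite /tri ge_max ler01/= gerBl. Qed.

Lemma tri_out x : 1 <= `|x| -> tri x = 0.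
Proof. by move=> x1; apply/max_idPl; rewrite subr_le0. Qed.

Lemma tri_in x : `|x| <= 1 -> tri x = 1 - `|x|.
Proof. by move=> x1; apply/max_idPr; rewrite subr_ge0. Qed.

Lemma continuous_tri : continuous tri.
Proof.
move=> x; apply: (@continuous_max _ _ (cst 0) (fun x => 1 - `|x|)).
  exact: cst_continuous.
by apply: continuousB; [exact: cst_continuous|exact: norm_continuous].
Qed.

Lemma measurable_tri : measurable_fun setT tri.
Proof. by apply: continuous_measurable_fun; exact: continuous_tri. Qed.

Lemma Rintegral_FTC (F f : R -> R) (a b : R) : a < b ->
  (forall t : R, a <= t <= b -> is_derive t (1 : R) F (f t)) ->
  (forall t : R, a <= t <= b -> {for t, continuous f}) ->
  \int[mu]_(t in `[a, b]) f t = F b - F a.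
Proof.
move=> ab dF cf.
have cF t : a <= t <= b -> {for t, continuous F}.
  move=> /dF [dFt _]; apply: differentiable_continuous.
  exact/derivable1_diffP.
rewrite /Rintegral (@continuous_FTC2 _ f F)//.
- apply: continuous_in_subspaceT => t; rewrite inE/= in_itv/= => H.
  exact: cf.
- split.
  + by move=> t; rewrite in_itv/= => /andP[/ltW at_ /ltW tb];
      have [] : is_derive t (1 : R) F (f t) by apply: dF; rewrite at_ tb.
  + by apply: cvg_at_right_filter; apply: cF; rewrite lexx ltW.
  + by apply: cvg_at_left_filter; apply: cF; rewrite lexx ltW.
- move=> t; rewrite in_itv/= => /andP[/ltW at_ /ltW tb].
  by rewrite derive1E; have [_ ->] : is_derive t (1 : R) F (f t) by apply: dF; rewrite at_ tb.
Qed.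

Lemma integrable_itv_continuous (f : R -> R) (a b : R) :
  (forall t : R, a <= t <= b -> {for t, continuous f}) ->
  mu.-integrable `[a, b] (EFin \o f).
Proof.
move=> cf; apply: continuous_compact_integrable; first exact: segment_compact.
apply: continuous_in_subspaceT => t; rewrite inE/= in_itv/= => H; exact: cf.
Qed.

Lemma tri_second_difference (a b : R) (G G1 G2 : R -> R) : 0 < a -> a < b ->
  (forall s : R, -b < s < b -> is_derive s (1 : R) G (G1 s)) ->
  (forall s : R, -b < s < b -> is_derive s (1 : R) G1 (G2 s)) ->
  (forall s : R, -b < s < b -> {for s, continuous G2}) ->
  intR (fun s => tri (s / a) * G2 s) /\
  \int[mu]_s (tri (s / a) * G2 s) = a^-1 * (G a - 2 * G 0 + G (- a)).
Proof.
move=> a0 ab dG dG1 cG2.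
have cH (t : R) : -b < t < b -> {for t, continuous (fun s : R => tri (s / a) * G2 s)}.
  move=> tb; apply: continuousM; last exact: cG2.
  apply: (@continuous_comp _ _ _ (fun s : R => s / a) tri).
    exact: mulrr_continuous.
  exact: continuous_tri.
have patchE : (fun s => tri (s / a) * G2 s) \_ `[- a, a] =
    (fun s => tri (s / a) * G2 s).
  apply/funext => s; rewrite patchE; case: ifPn => //.
  rewrite notin_setE/= in_itv/= => /negP; rewrite -ler_norml => H.
  rewrite tri_out ?mul0r// normrM normfV (gtr0_norm a0) ler_pdivlMr// mul1r.
  by rewrite ltW// ltNge.
have iH : mu.-integrable `[- a, a] (EFin \o (fun s => tri (s / a) * G2 s)).
  apply: integrable_itv_continuous => t /andP[t1 t2]; apply: cH.
  by apply/andP; split; lra.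
split.
  rewrite /intR -patchE.
  have mI : measurable (`[- a, a]%classic : set (measurableTypeR R)) by [].
  have /(integrable_mkcond _ mI) := iH.
  by rewrite restrict_EFin.
have -> : \int[mu]_s (tri (s / a) * G2 s) =
    \int[mu]_(s in `[- a, a]) (tri (s / a) * G2 s).
  by rewrite [RHS]Rintegral_mkcond patchE.
have a1 : (BLeft (- a) <= BRight (0 : R))%O by rewrite bnd_simp; lra.
have a2 : (BRight (0 : R) <= BRight a)%O by rewrite bnd_simp; lra.
have := Rintegral_itvB iH a1 a2.
rewrite Rintegral_itv_obnd_cbnd; last first.
  by apply: integrableS iH => //; apply: subset_itvr; rewrite bnd_simp; lra.
have -> : \int[mu]_(t in `[0, a]) (tri (t / a) * G2 t) =
    \int[mu]_(t in `[0, a]) ((1 - a^-1 * t) * G2 t).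
  apply: eq_Rintegral => t; rewrite inE/= in_itv/= => /andP[t0 ta].
  have ta0 : 0 <= t / a by rewrite divr_ge0// ltW.
  have ta1 : t / a <= 1 by rewrite ler_pdivrMr// mul1r.
  by rewrite tri_in ger0_norm// [t / a]mulrC.
have -> : \int[mu]_(t in `[- a, 0]) (tri (t / a) * G2 t) =
    \int[mu]_(t in `[- a, 0]) ((1 + a^-1 * t) * G2 t).
  apply: eq_Rintegral => t; rewrite inE/= in_itv/= => /andP[t0 ta].
  have ta0 : t / a <= 0 by rewrite ler_pdivrMr// mul0r.
  have ta1 : - (t / a) <= 1 by rewrite -mulNr ler_pdivrMr// mul1r; lra.
  by rewrite tri_in ler0_norm// opprK [t / a]mulrC.
have caff (e t : R) : is_derive t (1 : R) (fun t => 1 + (e * a^-1) * t) (e * a^-1).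
  rewrite (_ : (fun t => _) = (cst 1 + (e * a^-1) \*: id)%R)//.
  apply: is_derive_eq; rewrite add0r; exact: mulr1.
have I1 : \int[mu]_(t in `[0, a]) ((1 - a^-1 * t) * G2 t) =
    ((1 - a^-1 * a) * G1 a + a^-1 * G a) - ((1 - a^-1 * 0) * G1 0 + a^-1 * G 0).
  apply: (@Rintegral_FTC (fun t => (1 - a^-1 * t) * G1 t + a^-1 * G t)
    (fun t => (1 - a^-1 * t) * G2 t)) => // t /andP[t0 ta].
    have tb : - b < t < b by apply/andP; split; lra.
    have d1 := dG t tb; have d2 := dG1 t tb; have d3 := caff (-1) t.
    rewrite mulN1r in d3.
    rewrite (_ : (fun t => _) = ((fun t => 1 + - a^-1 * t) * G1 + a^-1 \*: G)%R); last first.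
      by apply/funext => s; rewrite -mulNr.
    apply: is_derive_eq; rewrite /GRing.scale /=; ring.
  apply: continuousM.
    apply: continuousB; first exact: cst_continuous.
    exact: mulrl_continuous.
  by apply: cG2; apply/andP; split; lra.
have I2 : \int[mu]_(t in `[- a, 0]) ((1 + a^-1 * t) * G2 t) =
    ((1 + a^-1 * 0) * G1 0 - a^-1 * G 0) -
    ((1 + a^-1 * - a) * G1 (- a) - a^-1 * G (- a)).
  apply: (@Rintegral_FTC (fun t => (1 + a^-1 * t) * G1 t - a^-1 * G t)
    (fun t => (1 + a^-1 * t) * G2 t)) => [|t /andP[t0 ta]|t /andP[t0 ta]].
  - by lra.
  - have tb : - b < t < b by apply/andP; split; lra.
    have d1 := dG t tb; have d2 := dG1 t tb; have d3 := caff 1 t.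
    rewrite mul1r in d3.
    rewrite (_ : (fun t => _) = ((fun t => 1 + a^-1 * t) * G1 - a^-1 \*: G)%R)//.
    apply: is_derive_eq; rewrite /GRing.scale /=; ring.
  - apply: continuousM.
      apply: continuousD; first exact: cst_continuous.
      exact: mulrl_continuous.
    by apply: cG2; apply/andP; split; lra.
rewrite I1 I2.
move=> /eqP; rewrite subr_eq => /eqP ->.
rewrite mulVf ?gt_eqF// !mulrN mulVf ?gt_eqF// !mulr0; ring.
Qed.

End tri.

Section cderive.
Context {R : realType}.
Implicit Types f g : R -> R[i].

Definition is_cderive f (t : R) (l : R[i]) :=
  is_derive t (1 : R) (fun s => complex.Re (f s)) (complex.Re l) /\
  is_derive t (1 : R) (fun s => complex.Im (f s)) (complex.Im l).

Definition ccontinuous_at f (t : R) :=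
  {for t, continuous (fun s => complex.Re (f s))} /\
  {for t, continuous (fun s => complex.Im (f s))}.

Lemma is_cderiveM f g (t : R) (lf lg : R[i]) :
  is_cderive f t lf -> is_cderive g t lg ->
  is_cderive (fun s => f s * g s) t (f t * lg + lf * g t).
Proof.
move=> [f1 f2] [g1 g2]; split.
  rewrite (_ : (fun s => _) = (fun s => complex.Re (f s)) *
    (fun s => complex.Re (g s)) - (fun s => complex.Im (f s)) *
    (fun s => complex.Im (g s)) :> (R -> R)); last first.
    by apply/funext => s; rewrite cReM.
  apply: (is_derive_eq (is_deriveB (is_deriveM f1 g1) (is_deriveM f2 g2))).
  by rewrite cReD !cReM /GRing.scale /=; ring.
rewrite (_ : (fun s => _) = (fun s => complex.Re (f s)) *
  (fun s => complex.Im (g s)) + (fun s => complex.Im (f s)) *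
  (fun s => complex.Re (g s)) :> (R -> R)); last first.
  by apply/funext => s; rewrite cImM.
apply: (is_derive_eq (is_deriveD (is_deriveM f1 g2) (is_deriveM f2 g1))).
rewrite cImD !cImM /GRing.scale /=.
move: (complex.Re (f t)) (complex.Im (f t)) (complex.Re (g t)) (complex.Im (g t)).
move: (complex.Re lf) (complex.Im lf) (complex.Re lg) (complex.Im lg) => *; ring.
Qed.

Lemma is_cderive_cst (z : R[i]) (t : R) : is_cderive (fun=> z) t 0.
Proof. by split => /=; exact: is_derive_cst. Qed.

Lemma is_cderive_expi (x t : R) :
  is_cderive (fun s => expi (x * s)) t ((0 +i* x) * expi (x * t)).
Proof.
have d : is_derive t (1 : R) (fun s : R => x * s) x.
  rewrite (_ : (fun s => _) = (x \*: id)%R)//.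
  apply: is_derive_eq; exact: mulr1.
split => /=.
  have dc := is_derive_cos (x * t).
  apply: is_derive_eq; rewrite /=; ring.
have ds := is_derive_sin (x * t).
apply: is_derive_eq; rewrite /=; ring.
Qed.

Lemma ccontinuousM f g (t : R) : ccontinuous_at f t -> ccontinuous_at g t ->
  ccontinuous_at (fun s => f s * g s) t.
Proof.
move=> [f1 f2] [g1 g2]; split.
  rewrite (_ : (fun s => _) = (fun s : R => complex.Re (f s) * complex.Re (g s) -
    complex.Im (f s) * complex.Im (g s))).
    by apply: continuousB; exact: continuousM.
  by apply/funext => s; rewrite cReM.
rewrite (_ : (fun s => _) = (fun s : R => complex.Re (f s) * complex.Im (g s) +
  complex.Im (f s) * complex.Re (g s))).
  by apply: continuousD; exact: continuousM.
by apply/funext => s; rewrite cImM.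
Qed.

Lemma ccontinuous_expi (x t : R) : ccontinuous_at (fun s => expi (x * s)) t.
Proof.
split => /=.
  apply: (@continuous_comp _ _ _ (fun s : R => x * s) cos).
    exact: mulrl_continuous.
  exact: continuous_cos.
apply: (@continuous_comp _ _ _ (fun s : R => x * s) sin).
  exact: mulrl_continuous.
exact: continuous_sin.
Qed.

(* Integrating twice by parts against the triangle, whose second derivative is a
   combination of three Dirac masses. *)
Lemma tri_second_differenceC (a b : R) (G G1 G2 : R -> R[i]) : 0 < a -> a < b ->
  (forall s : R, -b < s < b -> is_cderive G s (G1 s)) ->
  (forall s : R, -b < s < b -> is_cderive G1 s (G2 s)) ->
  (forall s : R, -b < s < b -> ccontinuous_at G2 s) ->
  intC (fun s => (tri (s / a))%:C * G2 s) /\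
  Cintegral (fun s => (tri (s / a))%:C * G2 s) =
    (a^-1)%:C * (G a - 2 * G 0 + G (- a)).
Proof.
move=> a0 ab dG dG1 cG2.
have [i1 e1] := tri_second_difference a0 ab (fun s H => (dG s H).1)
  (fun s H => (dG1 s H).1) (fun s H => (cG2 s H).1).
have [i2 e2] := tri_second_difference a0 ab (fun s H => (dG s H).2)
  (fun s H => (dG1 s H).2) (fun s H => (cG2 s H).2).
have E1 : (fun s => complex.Re ((tri (s / a))%:C * G2 s)) =
    (fun s => tri (s / a) * complex.Re (G2 s)).
  by apply/funext => s; rewrite cReM /= mul0r subr0.
have E2 : (fun s => complex.Im ((tri (s / a))%:C * G2 s)) =
    (fun s => tri (s / a) * complex.Im (G2 s)).
  by apply/funext => s; rewrite cImM /= mul0r addr0.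
split; first by split; rewrite ?E1 ?E2.
have two : (2 : R[i]) = 2%:C by rewrite rmorph_nat.
rewrite two; rewrite /Cintegral E1 E2 e1 e2.
apply: complexP; rewrite ?cReM ?cImM ?cReD ?cImD ?cReN ?cImN ?cReM ?cImM /=; ring.
Qed.

End cderive.

Section fejer.
Context {R : realType}.
Notation mu := (@lebesgue_measure R).

(* Half the Fourier transform of the triangle; the value at 0 is the limit. *)
Definition fejer0 (x : R) : R := if x == 0 then 2^-1 else (1 - cos x) / x ^+ 2.

Lemma fejer0_ge0 x : 0 <= fejer0 x.
Proof.
rewrite /fejer0; case: ifPn => // x0.
by rewrite divr_ge0 ?sqr_ge0// subr_ge0 cos_le1.
Qed.

Lemma measurable_fejer0 : measurable_fun setT fejer0.
Proof.
apply: measurable_fun_if => //.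
- by apply: measurable_fun_eqr => //; exact: measurable_cst.
- have -> : [set: R] `&` (fun x => x == 0) @^-1` [set false] = ~` [set 0].
    apply/seteqP; split => x /=; first by move=> [_ /eqP].
    by move=> /eqP/negbTE ->.
  apply: subspace_continuous_measurable_fun; first exact: measurableC.
  apply: continuous_in_subspaceT => x; rewrite inE/= => /eqP x0.
  suff : {for x, continuous (fun t : R => (1 - cos t) / t ^+ 2)} by [].
  apply: continuousM.
    by apply: continuousB; [exact: cst_continuous|exact: continuous_cos].
  apply: continuousV; first by rewrite expf_neq0.
  exact: exprn_continuous.
Qed.

(** The second-difference formula with width 1, applied to a second primitive of e^(ixs): s^2 / 2
    when x = 0, and - x^(-2) e^(ixs) otherwise. *)
Lemma tri_fourier (x : R) :
  intC (fun s => (tri s)%:C * expi (x * s)) /\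
  Cintegral (fun s => (tri s)%:C * expi (x * s)) = (2 * fejer0 x)%:C.
Proof.
have sE : (fun s => (tri s)%:C * expi (x * s)) =
    (fun s => (tri (s / 1))%:C * expi (x * s)).
  by apply/funext => s; rewrite divr1.
rewrite {}sE.
have [->|x0] := eqVneq x 0.
  pose G2 : R -> R[i] := fun s => expi (0 * s).
  have E s : G2 s = 1 by rewrite /G2 mul0r expi0.
  have [|||||i ->] := @tri_second_differenceC R 1 2 (fun s => (s ^+ 2 / 2)%:C)
    (fun s => s%:C) G2.
  - exact: ltr01.
  - lra.
  - move=> s _; split => /=; last exact: is_derive_cst.
    rewrite (_ : (fun s => _) = (2^-1 \*: (id ^+ 2))%R); last first.
      by apply/funext => t; rewrite mulrC.
    by apply: is_derive_eq; rewrite /GRing.scale /=; field.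
  - move=> s _; rewrite E; split => /=; last exact: is_derive_cst.
    exact: is_derive_id.
  - by move=> s _; exact: ccontinuous_expi.
  split=> //.
  by rewrite /fejer0 eqxx; apply: complexP; rewrite ?cReM ?cImM /=; field.
pose c : R[i] := (- (x ^+ 2)^-1)%:C.
have [|||||i ->] := @tri_second_differenceC R 1 2 (fun s => c * expi (x * s))
    (fun s => c * ((0 +i* x) * expi (x * s))) (fun s => expi (x * s)).
- exact: ltr01.
- lra.
- move=> s _.
  have := is_cderiveM (is_cderive_cst c s) (is_cderive_expi x s).
  by rewrite mul0r addr0.
- move=> s _.
  have := is_cderiveM (is_cderive_cst (c * (0 +i* x)) s) (is_cderive_expi x s).
  rewrite mul0r addr0 mulrA -[c * _ * _]mulrA.
  rewrite (_ : c * _ * expi (x * s) = expi (x * s)); last first.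
    rewrite -[RHS]mul1r; congr (_ * _); rewrite /c.
    by apply: complexP; rewrite ?cReM ?cImM /=; field.
  by under eq_fun do rewrite -mulrA.
- by move=> s _; exact: ccontinuous_expi.
split => //.
rewrite /fejer0 (negbTE x0) mulr1 mulr0 expi0 mulrN1.
have two : (2 : R[i]) = 2%:C by rewrite rmorph_nat.
rewrite two /c /expi cosN sinN.
by apply: complexP; rewrite ?cReM ?cImM ?cReD ?cImD ?cReN ?cImN ?cReM ?cImM /=; field.
Qed.

Lemma intR_tri : intR (tri : R -> R).
Proof.
have [[+ _] _] := tri_fourier 0.
rewrite (_ : (fun t => _) = tri)//; apply/funext => s.
by rewrite mul0r expi0 mulr1.
Qed.

Lemma Rintegral_tri : \int[mu]_s tri s = 1.
Proof.
have [_ H] := tri_fourier 0.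
have := congr1 (@complex.Re R) H.
rewrite /= /fejer0 eqxx divff// => <-; apply: eq_Rintegral => s _.
by rewrite !mul0r cos0 mulr1 subr0.
Qed.

(** The transform of a nonnegative function is at most its integral, which is 1 for the triangle. *)
Lemma fejer0_le_half x : fejer0 x <= 2^-1.
Proof.
have [[i1 _] H] := tri_fourier x.
have := congr1 (@complex.Re R) H => /= {}H.
suff : 2 * fejer0 x <= 1 by lra.
rewrite -H -Rintegral_tri; apply: Rintegral_le; [exact: i1|exact: intR_tri|].
by move=> s; rewrite mul0r subr0 ler_piMr ?tri_ge0 ?cos_le1.
Qed.

(** The bounds 1/2 for [fejer0 x] and 2 for 1 - cos x add up to (1 + x^2) [fejer0 x] <= 5/2. *)
Lemma fejer0_le x : fejer0 x <= 4 * (oneDsqr x)^-1.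
Proof.
have p : 0 < 1 + x ^+ 2 by have := sqr_ge0 x; lra.
rewrite ler_pdivlMr//.
rewrite /fejer0 /oneDsqr; case: eqVneq => [->|x0]; first by rewrite expr0n /=; lra.
have x2 : 0 < x ^+ 2 by rewrite exprn_even_gt0.
rewrite mulrAC ler_pdivrMr//.
have c1 := cos_geN1 x.
have h := fejer0_le_half x; rewrite /fejer0 (negbTE x0) ler_pdivrMr// in h.
nra.
Qed.

Lemma intR_oneDsqrV : intR (fun x : R => (oneDsqr x)^-1).
Proof.
have mV : measurable_fun setT (fun x : R => (oneDsqr x)^-1).
  by apply: continuous_measurable_fun; exact: continuous_oneDsqrV.
have V0 x : 0 <= (oneDsqr x)^-1 :> R.
  by rewrite invr_ge0 /oneDsqr; have := sqr_ge0 x; lra.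
apply/integrableP; split; first exact/measurable_EFinP.
have -> : (\int[mu]_x `|(EFin \o (fun x0 : R => (oneDsqr x0)^-1%R)) x| =
    \int[mu]_x ((oneDsqr x)^-1%R)%:E)%E.
  by apply: eq_integral => x _ /=; rewrite ger0_norm.
have -> : [set: R] = `]-oo, 0%R]%classic `|` `]0%R, +oo[%classic.
  by apply/seteqP; split => x //= _; rewrite !in_itv/= andbT; case: leP; [left|right].
rewrite ge0_integral_setU//=; last 2 first.
- by apply/measurable_EFinP; exact: measurable_funTS.
- apply/disj_setPS => x /=; rewrite !in_itv/= andbT => -[].
  by move=> x0 /(le_lt_trans x0); rewrite ltxx.
have := @ge0_integration_by_substitution0 R (fun x => ((oneDsqr x)^-1)%:E).
have -> : (\int[mu]_(r in `]-oo, 0%R]) ((oneDsqr (- r))^-1%R)%:E =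
    \int[mu]_(r in `]-oo, 0%R]) ((oneDsqr r)^-1%R)%:E)%E.
  by apply: eq_integral => r _; rewrite /oneDsqr sqrrN.
move=> <-//; last exact/measurable_EFinP.
rewrite (@integral_itv_obnd_cbnd R); last first.
  by apply/measurable_EFinP; exact: measurable_funTS.
by rewrite integral0y_oneDsqr -EFinD ltry.
Qed.

Lemma intR_fejer0 : intR fejer0.
Proof.
apply: (intR_le measurable_fejer0 (k := fun x => 4 * (oneDsqr x)^-1)).
  by move=> t; rewrite ger0_norm ?fejer0_ge0 ?fejer0_le.
by apply: intRZ; exact: intR_oneDsqrV.
Qed.

(** This constant is pi; it is kept as a name, and the normalisations below rest on its
    positivity. *)
Definition fejer_mass : R := \int[mu]_x fejer0 x.

Lemma fejer_mass_gt0 : 0 < fejer_mass.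
Proof.
(* On [pi/2, pi] the cosine is nonpositive, so [fejer0 x] >= 1 / x^2 >= 1 / pi^2 there. *)
pose k : R -> R := fun x => (pi ^+ 2)^-1 * \1_(`[pi / 2, pi]%classic : set R) x.
have pi0 : 0 < pi :> R := pi_gt0 R.
have ik : intR k by apply: intRZ; exact: integrable_indic_itv.
have : \int[mu]_x k x <= fejer_mass.
  apply: Rintegral_le => //; first exact: intR_fejer0.
  move=> x; rewrite /k indicE; case: (boolP (x \in _)) => [|_]; last first.
    by rewrite mulr0 fejer0_ge0.
  rewrite inE/= in_itv/= => /andP[x1 x2]; rewrite mulr1.
  have x0 : 0 < x by lra.
  rewrite /fejer0 gt_eqF// ler_pdivlMr ?exprn_gt0//.
  have c : cos x <= 0.
    rewrite -cos_pihalf; have [->//|nx] := eqVneq x (pi / 2).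
    have lx : pi / 2 < x by rewrite lt_neqAle eq_sym nx.
    by rewrite ltW// ltr_cos// in_itv/=; apply/andP; split; lra.
  have xpi : (pi ^+ 2)^-1 * x ^+ 2 <= 1.
    rewrite mulrC ler_pdivrMr ?exprn_gt0// mul1r.
    by rewrite ler_pXn2r// nnegrE ltW.
  lra.
apply: lt_le_trans; rewrite RintegralZl//; last exact: integrable_indic_itv.
apply: mulr_gt0; first by rewrite invr_gt0 exprn_gt0.
rewrite /Rintegral integral_indic// setIT.
have E := lebesgue_measure_itv `[(pi / 2 : R), pi].
rewrite /= lte_fin (_ : pi / 2 < pi) in E; last by lra.
by rewrite [X in fine X]E -EFinB /=; lra.
Qed.

End fejer.

(** * Frequency windows and Fourier inversion for the Fejer kernels *)

Section windows.
Context {R : realType}.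
Notation mu := (@lebesgue_measure R).
Notation mass := (@fejer_mass R).

Lemma Cintegral_real (h : R -> R) :
  Cintegral (fun t => (h t)%:C) = (\int[mu]_t h t)%:C.
Proof.
rewrite /Cintegral /=; apply: complexP => //=.
by rewrite /Rintegral integral0.
Qed.

Lemma norm1_limit_unique (z : R[i]) (e : nat -> R) :
  (forall n, norm1 z <= e n) -> e n @[n --> \oo] --> 0 -> z = 0.
Proof.
move=> ze e0; apply: norm1_eq0; apply/eqP; rewrite eq_le norm1_ge0 andbT.
have <- := cvg_lim (@Rhausdorff R) e0.
apply: limr_ge; first by apply/cvg_ex; exists 0.
by apply: nearW.
Qed.

(** The shape of most kernels to which Fubini is applied below: two integrable factors and a
    bounded, usually oscillating, one. *)
Lemma intC2_prod (a b : R -> R[i]) (k : R * R -> R[i]) (M : R) :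
  intC a -> intC b -> measC k -> (forall z, norm1 (k z) <= M) ->
  intC2 (fun z => a z.1 * b z.2 * k z).
Proof.
move=> ia ib mk kM.
have M0 : 0 <= M by apply: le_trans (kM (0, 0)); exact: norm1_ge0.
have mK : measC (fun z : R * R => a z.1 * b z.2 * k z).
  apply: measCM => //; apply: measCM.
    by apply: (measC_comp (intC_measC ia)); exact: measurable_fst.
  by apply: (measC_comp (intC_measC ib)); exact: measurable_snd.
have le z : norm1 (a z.1 * b z.2 * k z) <= norm1 (a z.1) * norm1 (b z.2) * M.
  apply: (le_trans (norm1M _ _)); apply: ler_pM; rewrite ?norm1_ge0//.
  exact: norm1M.
have i1 x : intR (fun y => norm1 (a x * b y * k (x, y))).
  apply: (intR_le (k := fun y => norm1 (a x) * M * norm1 (b y))).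
  - apply: measurable_norm1.
    apply: (measC_comp (f := fun z : R * R => a z.1 * b z.2 * k z)
      (g := fun y => (x, y))) => //; exact: pair1_measurable.
  - by move=> y; rewrite ger0_norm ?norm1_ge0// [leRHS]mulrAC; exact: (le (x, y)).
  - by apply: intRZ; exact: intC_norm1.
split => //.
- move=> y; apply: (intR_le (k := fun x => norm1 (b y) * M * norm1 (a x))).
  + apply: measurable_norm1.
    apply: (measC_comp (f := fun z : R * R => a z.1 * b z.2 * k z)
      (g := fun x => (x, y))) => //; exact: pair2_measurable.
  + move=> x; rewrite ger0_norm ?norm1_ge0//; apply: (le_trans (le (x, y))).
    by rewrite /=; lra.
  + by apply: intRZ; exact: intC_norm1.
- apply: (intR_le (k := fun x => (M * \int[mu]_y norm1 (b y)) * norm1 (a x))).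
  + apply: (@measurable_Rintegral1 R (fun z => norm1 (a z.1 * b z.2 * k z))).
      exact: measurable_norm1.
    by move=> z; exact: norm1_ge0.
  + move=> x; rewrite ger0_norm ?Rintegral_ge0//; last first.
      by move=> y _; exact: norm1_ge0.
    rewrite mulrAC -RintegralZl//; last exact: intC_norm1.
    apply: Rintegral_le; [exact: (i1 x)|by apply: intRZ; exact: intC_norm1|].
    move=> y; apply: (le_trans (le (x, y))) => /=; lra.
  + by apply: intRZ; exact: intC_norm1.
Qed.

Definition win (c eta s : R) : R := tri ((s - c) / eta).

(** The function whose Fourier transform is the triangular window [win c eta], as [fhat_fejer]
    shows. *)
Definition fejer (c eta t : R) : R[i] :=
  expi (c * t) * (eta * fejer0 (eta * t) / mass)%:C.

Lemma measurable_win c eta : measurable_fun setT (win c eta).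
Proof.
apply: (measurableT_comp (f := tri)); first exact: measurable_tri.
apply: measurable_funM; last exact: measurable_cst.
by apply: measurable_funB => //; exact: measurable_cst.
Qed.

Lemma winE c eta s : win c eta s = tri (eta^-1 * s + - (c / eta)).
Proof. by rewrite /win mulrBl [s / eta]mulrC. Qed.

Lemma intR_win c eta : 0 < eta -> intR (win c eta).
Proof.
move=> e0; rewrite (_ : win c eta = (fun s => tri (eta^-1 * s + - (c / eta)))); last first.
  by apply/funext => s; rewrite winE.
by apply: (intR_affine (h := tri) (- (c / eta))); rewrite ?invr_gt0//; exact: intR_tri.
Qed.

Lemma win_ge0 c eta s : 0 <= win c eta s. Proof. exact: tri_ge0. Qed.

Lemma win_le1 c eta s : win c eta s <= 1. Proof. exact: tri_le1. Qed.

Lemma win_out c eta s : 0 < eta -> eta <= `|s - c| -> win c eta s = 0.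
Proof.
move=> e0 h; apply: tri_out.
by rewrite normrM normfV (gtr0_norm e0) ler_pdivlMr// mul1r.
Qed.

Lemma measC_fejer c eta : measC (fejer c eta).
Proof.
apply: measCM; first by apply: measC_expi; exact: measurable_funM.
apply: measC_real; apply: measurable_funM; last exact: measurable_cst.
apply: measurable_funM; first exact: measurable_cst.
apply: (measurableT_comp (f := fejer0)); first exact: measurable_fejer0.
exact: measurable_funM.
Qed.

Lemma norm1_fejer c eta t : 0 < eta ->
  norm1 (fejer c eta t) <= 2 / mass * eta * fejer0 (eta * t).
Proof.
move=> e0; apply: (le_trans (norm1M _ _)).
have m0 := (@fejer_mass_gt0 R).
rewrite norm1_real ger0_norm; last first.
  by rewrite divr_ge0 ?mulr_ge0 ?fejer0_ge0 ?ltW.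
apply: (le_trans (ler_wpM2r _ (norm1_expi _))).
  by rewrite divr_ge0 ?mulr_ge0 ?fejer0_ge0 ?ltW.
lra.
Qed.

Lemma intC_fejer c eta : 0 < eta -> intC (fejer c eta).
Proof.
move=> e0; apply: (intC_le (measC_fejer c eta) (fun t => norm1_fejer c t e0)).
apply: intRZ.
have := intR_affine (h := fejer0) 0 e0 (@intR_fejer0 R).
by under eq_fun do rewrite addr0.
Qed.

Lemma norm1_fejer_bd c eta t : 0 < eta -> norm1 (fejer c eta t) <= eta / mass.
Proof.
move=> e0; apply: (le_trans (norm1_fejer c t e0)).
have m0 := (@fejer_mass_gt0 R).
have h := fejer0_le_half (eta * t).
rewrite -[2 / mass * eta]mulrA mulrC mulrCA.
have : 0 <= mass^-1 * eta by rewrite mulr_ge0 ?invr_ge0 ?ltW.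
nra.
Qed.

Lemma fejer_win c eta t : 0 < eta ->
  intC (fun s => (win c eta s)%:C * expi (s * t)) /\
  Cintegral (fun s => (win c eta s)%:C * expi (s * t)) =
    (2 * mass)%:C * fejer c eta t.
Proof.
move=> e0; have m0 := (@fejer_mass_gt0 R).
have [i e] := tri_fourier (eta * t).
pose f x : R[i] := expi (c * t) * ((tri x)%:C * expi (eta * t * x)).
have fE : (fun s => (win c eta s)%:C * expi (s * t)) =
    (fun s => f (eta^-1 * s + - (c / eta))).
  apply/funext => s; rewrite /f winE mulrCA -expiD; congr (_ * expi _).
  by field; rewrite gt_eqF.
have iff : intC f by exact: intCZ.
rewrite fE; split; first by apply: intC_affine; rewrite ?invr_gt0.
rewrite Cintegral_affine ?invr_gt0// invrK CintegralZ// e /fejer.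
rewrite mulrCA [RHS]mulrCA; congr (_ * _).
by apply: complexP; rewrite ?cReM ?cImM /=; field; rewrite gt_eqF.
Qed.

Lemma mass2K : ((2 * mass)^-1)%:C * (2 * mass)%:C = 1 :> R[i].
Proof.
rewrite -rmorphM mulVf//.
by rewrite mulf_neq0 ?pnatr_eq0// gt_eqF// fejer_mass_gt0.
Qed.

(** On the Fourier side, a triangle of half-width 2 eta is the sum of the triangles of half-width
    eta at c - eta, c and c + eta with weights 1/2, 1, 1/2. On this side it is 1 - cos 2x = 2 (1 -
    cos x)(1 + cos x). It is what allows windows to be halved in [windows_null]. *)
Lemma fejer_double c eta t : 0 < eta ->
  fejer c (2 * eta) t = 2^-1 * fejer (c - eta) eta t + fejer c eta t +
    2^-1 * fejer (c + eta) eta t.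
Proof.
move=> e0; have m0 := (@fejer_mass_gt0 R).
have two : (2^-1 : R[i]) = (2^-1)%:C by rewrite fmorphV rmorph_nat.
rewrite /fejer.
have -> : (c - eta) * t = c * t + - (eta * t) by ring.
have -> : (c + eta) * t = c * t + eta * t by ring.
have -> : 2 * eta * t = 2 * (eta * t) by ring.
rewrite !expiD two.
have [->|t0] := eqVneq (eta * t) 0.
  rewrite !mulr0 oppr0 expi0 /fejer0 eqxx.
  by apply: complexP; rewrite ?cReM ?cImM ?cReD ?cImD ?cReM ?cImM /=; field; rewrite gt_eqF.
have -> : 2 * eta * fejer0 (2 * (eta * t)) =
    eta * fejer0 (eta * t) * (1 + cos (eta * t)).
  have c2 (x : R) : cos (2 * x) = 2 * cos x ^+ 2 - 1.
    by rewrite !mulr_natl cos_mulr2n.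
  rewrite /fejer0 mulf_eq0 (negbTE t0) pnatr_eq0 /= c2.
  by move: (eta * t) t0 => x x0; field; rewrite x0.
move: (fejer0 _) => z; rewrite /expi cosN sinN.
by apply: complexP; rewrite ?cReM ?cImM ?cReD ?cImD ?cReM ?cImM /=; field; rewrite gt_eqF.
Qed.

Definition fhat (f : R -> R[i]) (s : R) : R[i] :=
  Cintegral (fun t => expi (s * - t) * f t).

Lemma intC_expiM (f : R -> R[i]) (s : R) : intC f ->
  intC (fun t => expi (s * - t) * f t).
Proof.
move=> fi; under eq_fun do rewrite mulrC; apply: (@intCMbd _ _ _ 2) => //.
  by apply: measC_expi; apply: measurable_funM => //; exact: measurableT_comp.
by move=> t; exact: norm1_expi.
Qed.

(** The kernel is an integral of characters over its window ([fejer_win]); exchanging the integrals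
    shows that the convolution depends on f only through [fhat f] on the window. *)
Lemma conv_fejer (f : R -> R[i]) c eta y : 0 < eta -> intC f ->
  Cintegral (fun t => f t * fejer c eta (y - t)) =
  ((2 * mass)^-1)%:C *
    Cintegral (fun s => (win c eta s)%:C * expi (s * y) * fhat f s).
Proof.
move=> e0 fi; have m0 := (@fejer_mass_gt0 R).
pose K (z : R * R) : R[i] := f z.1 * (win c eta z.2)%:C * expi (z.2 * (y - z.1)).
have iK : intC2 K.
  apply: (@intC2_prod f (fun s => (win c eta s)%:C)
    (fun z => expi (z.2 * (y - z.1))) 2) => //.
  - by apply: intC_real; exact: intR_win.
  - apply: measC_expi; apply: measurable_funM; first exact: measurable_snd.
    apply: measurable_funB; first exact: measurable_cst.
    exact: measurable_fst.
  - by move=> z; exact: norm1_expi.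
have -> : (fun t => f t * fejer c eta (y - t)) =
    (fun t => ((2 * mass)^-1)%:C * Cintegral (fun s => K (t, s))).
  apply/funext => t; have [i e] := fejer_win c (y - t) e0.
  rewrite /K /=; under [X in Cintegral X]eq_fun do rewrite -mulrA.
  rewrite CintegralZ// e; set F := fejer _ _ _.
  by rewrite [RHS]mulrCA; congr (_ * _); rewrite mulrA mass2K mul1r.
rewrite CintegralZ; last exact: (intC_Cintegral iK).
congr (_ * _); rewrite Cintegral_Fubini//; congr Cintegral; apply/funext => s.
rewrite /fhat -CintegralZ; last exact: intC_expiM.
congr Cintegral; apply/funext => t; rewrite /K /= mulrBr expiD -mulrN.
by ring.
Qed.

(** The inversion integral with the convergence factor tri(t/a). After Fubini the t-integral is the
    transform of that factor, a Fejer kernel of width 1/a, so the result is the window averaged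
    around s0. *)
Lemma Cintegral_win_fejer0 (c eta s0 a : R) : 0 < eta -> 0 < a ->
  Cintegral (fun t => (tri (t / a))%:C * (expi (s0 * - t) * fejer c eta t)) =
  (mass^-1 * \int[mu]_x (win c eta (s0 + x / a) * fejer0 x))%:C.
Proof.
move=> e0 a0; have m0 := (@fejer_mass_gt0 R).
pose K (z : R * R) : R[i] := (win 0 a z.1)%:C * (win c eta z.2)%:C *
  expi (z.1 * (z.2 - s0)).
have iK : intC2 K.
  apply: (@intC2_prod (fun s => (win 0 a s)%:C) (fun s => (win c eta s)%:C)
    (fun z => expi (z.1 * (z.2 - s0))) 2) => //.
  - by apply: intC_real; exact: intR_win.
  - by apply: intC_real; exact: intR_win.
  - apply: measC_expi; apply: measurable_funM; first exact: measurable_fst.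
    apply: measurable_funB; last exact: measurable_cst.
    exact: measurable_snd.
  - by move=> z; exact: norm1_expi.
have [mK K1 K2 K3] := iK.
have i1 x : intC (fun y => K (x, y)).
  apply: intCP => //.
  apply: (measC_comp (f := K) (g := fun y => (x, y))) => //.
  exact: pair1_measurable.
have -> : (fun t => (tri (t / a))%:C * (expi (s0 * - t) * fejer c eta t)) =
    (fun t => ((2 * mass)^-1)%:C * Cintegral (fun s => K (t, s))).
  apply/funext => t; have [i e] := fejer_win c t e0.
  have -> : (fun s => K (t, s)) = (fun s => ((win 0 a t)%:C * expi (s0 * - t)) *
      ((win c eta s)%:C * expi (s * t))).
    apply/funext => s; rewrite /K /=.
    have -> : t * (s - s0) = s * t + s0 * - t by ring.
    by rewrite expiD; ring.
  rewrite CintegralZ// e.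
  set F := fejer _ _ _.
  transitivity ((((2 * mass)^-1)%:C * (2 * mass)%:C) *
    ((tri (t / a))%:C * (expi (s0 * - t) * F))).
    by rewrite mass2K mul1r.
  by rewrite /win subr0; ring.
rewrite CintegralZ; last first.
  apply: intCP; first exact: measC_Cintegral.
  apply: (intR_le _ _ K3).
    by apply: measurable_norm1; exact: measC_Cintegral.
  by move=> t; rewrite ger0_norm ?norm1_ge0//; exact: norm1_Cintegral.
rewrite Cintegral_Fubini//.
pose h x : R := 2 * (win c eta (s0 + x / a) * fejer0 x).
have ih0 : intR (fun x => win c eta (s0 + x / a) * fejer0 x).
  apply: (intR_le _ _ (@intR_fejer0 R)).
    apply: measurable_funM; last exact: measurable_fejer0.
    apply: (measurableT_comp (measurable_win c eta)).
    apply: measurable_funD; first exact: measurable_cst.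
    exact: measurable_funM.
  move=> t; rewrite normrM !ger0_norm ?fejer0_ge0 ?win_ge0//.
  by rewrite ler_piMl ?fejer0_ge0 ?win_le1.
have ih : intR h by exact: intRZ.
have -> : (fun s => Cintegral (fun t => K (t, s))) =
    (fun s => a%:C * (h (a * s + - (a * s0)))%:C).
  apply/funext => s; rewrite /K /=.
  have -> : (fun t => (win 0 a t)%:C * (win c eta s)%:C * expi (t * (s - s0))) =
     (fun t => (win c eta s)%:C * ((win 0 a t)%:C * expi (t * (s - s0)))).
    by apply/funext => t; ring.
  have [i e] := fejer_win 0 (s - s0) a0.
  rewrite CintegralZ// e /fejer mul0r expi0 mul1r -!rmorphM; congr (_%:C).
  rewrite /h -mulrBr; have -> : s0 + a * (s - s0) / a = s by field; rewrite gt_eqF.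
  by field; rewrite gt_eqF.
rewrite CintegralZ; last first.
  by apply: (intC_affine (f := fun x => (h x)%:C) (- (a * s0))) => //; exact: intC_real.
rewrite (Cintegral_affine (f := fun x => (h x)%:C) (- (a * s0)))//; last exact: intC_real.
rewrite Cintegral_real /h RintegralZl// -!rmorphM; congr (_%:C).
by field; rewrite !gt_eqF.
Qed.

(** Fourier inversion by Fejer summation: the width [a n] of the convergence factor tends to
    infinity, and the averaged window tends to its value at s0 by continuity. *)
Lemma fhat_fejer c eta s0 : 0 < eta -> fhat (fejer c eta) s0 = (win c eta s0)%:C.
Proof.
move=> e0; have m0 := (@fejer_mass_gt0 R).
pose a (n : nat) : R := n.+1%:R.
have a0 n : 0 < a n by [].
pose g t : R[i] := expi (s0 * - t) * fejer c eta t.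
have ig : intC g by apply: intC_expiM; exact: intC_fejer.
have acv (x : R) : x / a n @[n --> \oo] --> 0.
  rewrite -(mulr0 x); apply: cvgM; first exact: cvg_cst.
  exact: cvg_harmonic.
(* [e1] is the error of inserting the convergence factor, [e2] that of averaging the window; both
   vanish in the limit by dominated convergence. *)
pose e1 n := norm1 (Cintegral (fun t => (1 - (tri (t / a n))%:C) * g t)).
pose d x n : R := (win c eta (s0 + x / a n) - win c eta s0) * fejer0 x.
pose e2 n := `|mass^-1 * \int[mu]_x (d x n)|.
have mtri n : measurable_fun setT (fun t : R => tri (t / a n)).
  apply: (measurableT_comp (f := tri)); first exact: measurable_tri.
  exact: measurable_funM.
have c1 : e1 n @[n --> \oo] --> 0.
  apply: (@cvg0_Cintegral R _ (fun t => norm1 (g t))).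
  - move=> n; apply: measCM; last exact: intC_measC.
    by apply: measCB; [exact: measC_cst|exact: measC_real].
  - move=> n t; have -> : 1 - (tri (t / a n))%:C = (1 - tri (t / a n))%:C.
      by rewrite rmorphB.
    rewrite norm1_realM ler_piMl ?norm1_ge0// ger0_norm ?subr_ge0 ?tri_le1//.
    by rewrite gerBl tri_ge0.
  - exact: intC_norm1.
  - apply: aeW => t /=.
    have -> : (fun n => norm1 ((1 - (tri (t / a n))%:C) * g t)) =
        (fun n => `|tri 0 - tri (t / a n)| * norm1 (g t)).
      apply/funext => n; have -> : 1 - (tri (t / a n))%:C = (1 - tri (t / a n))%:C.
        by rewrite rmorphB.
      by rewrite norm1_realM (@tri_in _ 0) normr0 ?subr0.
    suff : (fun n => `|tri 0 - tri (t / a n)| * norm1 (g t)) @ \oo -->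
        `|tri 0 - tri 0 : R| * norm1 (g t) by rewrite subrr normr0 mul0r.
    apply: cvgM; last exact: cvg_cst.
    apply: cvg_norm; apply: cvgB; first exact: cvg_cst.
    by apply: (continuous_cvg _ (@continuous_tri R 0)); exact: acv.
have md n : measurable_fun setT (fun x => d x n).
  apply: measurable_funM; last exact: measurable_fejer0.
  apply: measurable_funB; last exact: measurable_cst.
  apply: (measurableT_comp (measurable_win c eta)).
  apply: measurable_funD; first exact: measurable_cst.
  exact: measurable_funM.
have ld n t : `|d t n| <= fejer0 t.
  rewrite normrM [`|fejer0 t|]ger0_norm ?fejer0_ge0// ler_piMl ?fejer0_ge0//.
  have := win_ge0 c eta (s0 + t / a n); have := win_ge0 c eta s0.
  have := win_le1 c eta (s0 + t / a n); have := win_le1 c eta s0.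
  by rewrite ler_norml => *; apply/andP; split; lra.
have c2 : e2 n @[n --> \oo] --> 0.
  suff : e2 n @[n --> \oo] --> `|mass^-1 * 0| by rewrite mulr0 normr0.
  apply: cvg_norm; apply: cvgM; first exact: cvg_cst.
  apply: (@cvg0_Rintegral R _ fejer0) => //; first exact: intR_fejer0.
  apply: aeW => x /=.
  suff : d x n @[n --> \oo] --> (win c eta (s0 + 0) - win c eta s0) * fejer0 x.
    by rewrite addr0 subrr mul0r.
  apply: cvgM; last exact: cvg_cst.
  apply: cvgB; last exact: cvg_cst.
  have cw : {for (s0 + 0), continuous (win c eta)}.
    apply: (@continuous_comp _ _ _ (fun s : R => (s - c) / eta) tri).
      apply: continuousM; last exact: cst_continuous.
      by apply: continuousB; [exact: id|exact: cst_continuous].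
    exact: continuous_tri.
  apply: (continuous_cvg _ cw).
  by apply: cvgD; [exact: cvg_cst|exact: acv].
apply/eqP; rewrite -subr_eq0; apply/eqP.
apply: (@norm1_limit_unique _ (fun n => e1 n + e2 n)); last first.
  by rewrite -(addr0 0); exact: cvgD.
move=> n.
have itg : intC (fun t => (tri (t / a n))%:C * g t).
  under eq_fun do rewrite mulrC; apply: (@intCMbd _ _ _ 1) => //.
    exact: measC_real.
  by move=> t; rewrite norm1_real ger0_norm ?tri_ge0 ?tri_le1.
have E1 : Cintegral (fun t => (1 - (tri (t / a n))%:C) * g t) =
    fhat (fejer c eta) s0 - Cintegral (fun t => (tri (t / a n))%:C * g t).
  rewrite /fhat -CintegralB//; congr Cintegral; apply/funext => t.
  by rewrite mulrBl mul1r.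
have E2 : mass^-1 * \int[mu]_x (d x n) = mass^-1 *
    \int[mu]_x (win c eta (s0 + x / a n) * fejer0 x) - win c eta s0.
  have i2 : intR (fun x => win c eta s0 * fejer0 x) by apply: intRZ; exact: intR_fejer0.
  have -> : \int[mu]_x (d x n) = \int[mu]_x (win c eta (s0 + x / a n) * fejer0 x) -
      \int[mu]_x (win c eta s0 * fejer0 x).
    rewrite -RintegralB//.
      by apply: eq_Rintegral => x _; rewrite /d mulrBl.
    have -> : (fun x => win c eta (s0 + x / a n) * fejer0 x) =
       (fun x => d x n + win c eta s0 * fejer0 x).
      by apply/funext => x; rewrite /d mulrBl subrK.
    apply: intRD => //.
    by apply: (intR_le (md n) (ld n)); exact: intR_fejer0.
  rewrite RintegralZl//; last exact: intR_fejer0.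
  by rewrite -/mass; field; rewrite gt_eqF.
have -> : fhat (fejer c eta) s0 - (win c eta s0)%:C =
    Cintegral (fun t => (1 - (tri (t / a n))%:C) * g t) +
    (mass^-1 * \int[mu]_x (d x n))%:C.
  rewrite E1 E2 Cintegral_win_fejer0// rmorphB; ring.
apply: (le_trans (norm1D _ _)); by rewrite norm1_real.
Qed.

End windows.

Section cvg0.
Context {R : realType}.

Lemma cvg0P (u : nat -> R) : (forall n, 0 <= u n) ->
  (u n @[n --> \oo] --> 0) <->
  (forall e : R, 0 < e -> exists N, forall n, (N <= n)%N -> u n <= e).
Proof.
move=> u0; split=> [/cvgrPdist_le cu e e0|H].
  have [N _ HN] := cu e e0; exists N => n Nn.
  by have := HN n Nn; rewrite /= sub0r normrN ger0_norm.
apply/cvgrPdist_le => e e0; have [N HN] := H e e0.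
by exists N => // n Nn; rewrite /= sub0r normrN ger0_norm// HN.
Qed.

End cvg0.

(** * Continuity of translation in L^1 *)

Section shift.
Context {R : realType}.
Notation mu := (@lebesgue_measure R).
Implicit Types h : R -> R.

Lemma intR_itv (a b M : R) : intR (fun t : R => M * \1_(`[a, b]%classic : set R) t).
Proof. by apply: intRZ; exact: integrable_indic_itv. Qed.

(** Dominated convergence needs a sequence, so the failure of the claim is turned into translations
    t_k with |t_k| < 1 / (k + 1) <= 1; all integrands then live on [-(n + 1), n + 1]. *)
Lemma shift_continuous_compact h (n : R) : continuous h -> 0 < n ->
  (forall t, n <= `|t| -> h t = 0) -> forall e : R, 0 < e ->
  exists2 d : R, 0 < d & forall t, `|t| < d -> \int[mu]_s `|h (s + t) - h s| <= e.
Proof.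
move=> ch n0 hout e e0.
have [B hB] : exists B : R, forall t, `|h t| <= B.
  have cab : {within `[- n, n], continuous (fun t => `|h t|)}.
    apply: continuous_subspaceT => t; apply: continuous_comp; first exact: ch.
    exact: norm_continuous.
  have [|c cn Hc] := EVT_max _ cab; first lra.
  exists `|h c| => t; have [nt|tn] := leP n `|t|.
    by rewrite hout// normr0.
  by apply: Hc; rewrite in_itv/= -ler_norml ltW.
apply: contrapT => /forallPNP H.
have H' (k : nat) : exists t : R, `|t| < k.+1%:R^-1 /\ e < \int[mu]_s `|h (s + t) - h s|.
  apply: contrapT => /forallNP Hk; apply: (H k.+1%:R^-1) => // t tk.
  by rewrite leNgt; apply/negP => lt; apply: (Hk t).
have {H'} [t_ Ht] := choice H'.
have t0 : t_ k @[k --> \oo] --> 0.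
  apply/norm_cvg0P; apply: (squeeze_cvgr _ (cvg_cst 0) cvg_harmonic).
  by apply: nearW => k; rewrite normr_ge0/= ltW// (Ht k).1.
have mh : measurable_fun setT h by exact: continuous_measurable_fun.
have ms (t : R) : measurable_fun setT (fun s : R => `|h (s + t) - h s|).
  apply: measurableT_comp => //; apply: measurable_funB => //.
  by apply: (measurableT_comp mh); apply: measurable_funD => //; exact: measurable_cst.
have : (fun k => \int[mu]_s `|h (s + t_ k) - h s|) @ \oo --> 0.
  apply: (@cvg0_Rintegral R _
    (fun s => (2 * B) * \1_(`[- (n + 1), n + 1]%classic : set R) s)).
- by move=> k; exact: ms.
- move=> k s; rewrite normr_id indicE; case: (boolP (s \in _)) => [_|].
    rewrite mulr1; apply: (le_trans (ler_normB _ _)).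
    by have := hB (s + t_ k); have := hB s; lra.
  rewrite notin_setE/= in_itv/= => /negP; rewrite -ler_norml -ltNge => sn.
  have tk1 : `|t_ k| < 1.
    apply: (lt_le_trans (Ht k).1); rewrite invf_le1//.
    by rewrite -natr1 lerDr.
  rewrite mulr0 !hout ?subrr ?normr0//; first by lra.
  have := ler_normB (s + t_ k) (t_ k); rewrite addrK; lra.
- exact: intR_itv.
- apply: aeW => s.
  suff : `|h (s + t_ k) - h s| @[k --> \oo] --> `|h (s + 0) - h s|.
    by rewrite addr0 subrr normr0.
  apply: cvg_norm; apply: cvgB; last exact: cvg_cst.
  apply: (continuous_cvg _ (ch _)).
  by apply: cvgD; [exact: cvg_cst|].
move=> /cvgrPdist_lt /(_ e e0) [k _ /(_ k (leqnn k))] /=.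
rewrite sub0r normrN ger0_norm ?Rintegral_ge0//.
by rewrite ltNge (ltW (Ht k).2).
Qed.

Lemma intR_dist h (k : R -> R) : intR h -> intR k -> intR (fun t => `|h t - k t|).
Proof. by move=> ih ik; apply: intR_abs; apply: intRD => //; exact: intRN. Qed.

Lemma Rintegral_dist_triangle h (k g : R -> R) : intR h -> intR k -> intR g ->
  \int[mu]_t `|h t - g t| <=
  \int[mu]_t `|h t - k t| + \int[mu]_t `|k t - g t|.
Proof.
move=> ih ik ig; rewrite -RintegralD//; [|exact: intR_dist..].
apply: Rintegral_le; first exact: intR_dist.
  by apply: intRD; exact: intR_dist.
by move=> t; rewrite -(subrKA (k t)); exact: ler_normD.
Qed.

(** A continuous approximation on [-N, N] would jump at the ends if restricted; multiplying it by
    the cutoff tri(t/N) keeps it continuous on R. Half of e pays for cutting h off, half for the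
    approximation. *)
Lemma intR_approx h (e : R) : intR h -> 0 < e -> exists g : R -> R, exists n : R,
  [/\ continuous g, 0 < n, (forall t, n <= `|t| -> g t = 0), intR g &
      \int[mu]_t `|h t - g t| <= e].
Proof.
move=> ih e0; have mh := intR_measurable ih.
pose c (n : nat) (t : R) : R := tri (t / n.+1%:R).
have cc n : continuous (c n).
  move=> t; apply: (@continuous_comp _ _ _ (fun s : R => s / n.+1%:R) tri).
    exact: mulrr_continuous.
  exact: continuous_tri.
have mc n : measurable_fun setT (c n) by exact: continuous_measurable_fun.
have c01 n t : 0 <= c n t <= 1 by rewrite tri_ge0 tri_le1.
have cout n t : n.+1%:R <= `|t| -> c n t = 0.
  by move=> nt; apply: tri_out; rewrite normrM normfV (ger0_norm (ler0n _ _)) ler_pdivlMr// mul1r.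
have : (fun n => \int[mu]_t (`|h t| * (1 - c n t))) @ \oo --> 0.
  apply: (@cvg0_Rintegral R _ (fun t => `|h t|)).
  - move=> n; apply: measurable_funM; first exact: measurableT_comp.
    by apply: measurable_funB => //; exact: measurable_cst.
  - move=> n t; have /andP[c0 c1] := c01 n t.
    rewrite normrM normr_id [`|1 - _|]ger0_norm ?subr_ge0//.
    by rewrite ler_piMr// gerBl.
  - exact: intR_abs.
  - apply: aeW => t.
    suff : `|h t| * (1 - c n t) @[n --> \oo] --> `|h t| * (1 - tri 0).
      by rewrite tri_in ?normr0// subr0 subrr mulr0.
    apply: cvgM; first exact: cvg_cst.
    apply: cvgB; first exact: cvg_cst.
    apply: (continuous_cvg _ (@continuous_tri R 0)).
    rewrite -(mulr0 t); apply: cvgM; first exact: cvg_cst.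
    exact: cvg_harmonic.
have e2 : 0 < e / 2 by lra.
move=> /cvgrPdist_lt /(_ _ e2) [n _ /(_ n (leqnn n))] /=.
rewrite sub0r normrN ger0_norm; last first.
  apply: Rintegral_ge0 => t _; apply: mulr_ge0 => //.
  by rewrite subr_ge0; have /andP[] := c01 n t.
move=> /ltW Hn.
pose N : R := n.+1%:R; have N0 : 0 < N by [].
pose I : set (measurableTypeR R) := `[- N, N]%classic.
have mI : measurable I by exact: measurable_itv.
have muI : (mu I < +oo)%E.
  by rewrite /I lebesgue_measure_itv/= lte_fin; case: ifP => _; rewrite -?EFinB ltry.
have ihI : mu.-integrable I (EFin \o h) by apply: integrableS ih.
have [g_ [cg ig Hg]] := approximation_continuous_integrable mI muI ihI.
have [k Hk] : exists k, (\int[mu]_(z in I) `|(h z - g_ k z)%:E| <= (e / 2)%:E)%E.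
  have /fine_cvgP [[k1 _ F1] /cvgrPdist_lt /(_ _ e2) [k2 _ F2]] := Hg.
  exists (maxn k1 k2); rewrite -[leLHS]fineK; last by apply: F1; exact: leq_maxl.
  have := F2 (maxn k1 k2) (leq_maxr _ _); rewrite /= sub0r normrN.
  by move=> /ltW /(le_trans (ler_norm _)); rewrite lee_fin.
have cg2 : continuous (fun t : R => g_ k t * c n t).
  by move=> t; apply: continuousM; [exact: cg|exact: cc].
have patchE (u : R -> R) : (fun t => u t * c n t) \_ I = (fun t => u t * c n t).
  apply/funext => t; rewrite patchE; case: ifPn => //.
  rewrite notin_setE/= /I /= in_itv/= => /negP; rewrite -ler_norml -ltNge => Nt.
  by rewrite cout ?mulr0 ?ltW.
have ig2 : intR (fun t => g_ k t * c n t).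
  have i1 : mu.-integrable I (EFin \o (fun t => g_ k t * c n t)).
    by apply: integrable_itv_continuous => t _; exact: cg2.
  by move: i1 => /(integrable_mkcond _ mI); rewrite restrict_EFin patchE.
have ihc : intR (fun t => h t * c n t).
  apply: (intR_le _ _ (intR_abs ih)); first exact: measurable_funM.
  move=> t; have /andP[c0 c1] := c01 n t.
  by rewrite normrM [`|c n t|]ger0_norm// ler_piMr.
exists (fun t => g_ k t * c n t), N; split => //.
  by move=> t Nt; rewrite cout ?mulr0.
have := Rintegral_dist_triangle ih ihc ig2.
have -> : \int[mu]_t `|h t - h t * c n t| = \int[mu]_t (`|h t| * (1 - c n t)).
  apply: eq_Rintegral => t _; have /andP[c0 c1] := c01 n t.
  by rewrite -{1}[h t]mulr1 -mulrBr normrM [`|1 - _|]ger0_norm ?subr_ge0.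
suff : \int[mu]_t `|h t * c n t - g_ k t * c n t| <= e / 2 by lra.
rewrite -lee_fin -intR_integral_EFin; last exact: intR_dist.
apply: le_trans Hk.
have -> : (\int[mu]_t (`|h t * c n t - g_ k t * c n t|)%:E =
    \int[mu]_(t in I) (`|h t - g_ k t| * c n t)%:E)%E.
  rewrite [RHS]integral_mkcond -[X in X \_ I]/(EFin \o (fun t => `|h t - g_ k t| * c n t)).
  rewrite restrict_EFin (patchE (fun t => `|h t - g_ k t|)); apply: eq_integral => t _.
  have /andP[c0 c1] := c01 n t.
  by rewrite -mulrBl normrM [`|c n t|]ger0_norm.
have mgI : measurable_fun I (fun t => `|h t - g_ k t|).
  apply: measurableT_comp => //; apply: measurable_funB.
    exact: measurable_funTS.
  by apply: measurable_funTS; exact: continuous_measurable_fun.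
apply: ge0_le_integral => //.
- move=> t _; have /andP[c0 c1] := c01 n t.
  by rewrite lee_fin mulr_ge0.
- apply/measurable_EFinP; apply: measurable_funM => //.
  exact: measurable_funTS (mc n).
- by apply/measurable_EFinP.
- move=> t _; have /andP[c0 c1] := c01 n t.
  by rewrite lee_fin ler_piMr.
Qed.

Lemma intR_shift_continuous h (e : R) : intR h -> 0 < e ->
  exists2 d : R, 0 < d & forall t, `|t| < d -> \int[mu]_s `|h (s + t) - h s| <= e.
Proof.
move=> ih e0; have e3 : 0 < e / 3 by lra.
have [g [n [cg n0 gout ig Hg]]] := intR_approx ih e3.
have [d d0 Hd] := shift_continuous_compact cg n0 gout e3.
exists d => // t td.
have iht := intR_shift t ih; have igt := intR_shift t ig.
have H1 := Rintegral_dist_triangle iht igt ih.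
have H2 := Rintegral_dist_triangle igt ig ih.
have H3 := Hd t td.
have E : \int[mu]_s `|h (s + t) - g (s + t)| = \int[mu]_s `|h s - g s|.
  exact: (Rintegral_shift t (intR_dist ih ig)).
have ee : e / 3 + (e / 3 + e / 3) = e by field.
rewrite -[leRHS]ee; apply: (le_trans H1); apply: lerD; first by rewrite E.
apply: (le_trans H2); apply: lerD => //.
have E2 : \int[mu]_s `|g s - h s| = \int[mu]_s `|h s - g s|.
  by apply: eq_Rintegral => s _; exact: distrC.
by rewrite E2.
Qed.

Lemma intC_shift_continuous (f : R -> R[i]) (e : R) : intC f -> 0 < e ->
  exists2 d : R, 0 < d &
    forall t, `|t| < d -> \int[mu]_s norm1 (f (s + t) - f s) <= e.
Proof.
move=> [f1 f2] e0; have e2 : 0 < e / 2 by lra.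
have [d1 d10 H1] := intR_shift_continuous f1 e2.
have [d2 d20 H2] := intR_shift_continuous f2 e2.
exists (Num.min d1 d2); first by rewrite lt_min d10.
move=> t; rewrite lt_min => /andP[td1 td2].
have -> : (fun s => norm1 (f (s + t) - f s)) =
   (fun s => `|complex.Re (f (s + t)) - complex.Re (f s)| +
     `|complex.Im (f (s + t)) - complex.Im (f s)|).
  by apply/funext => s; rewrite /norm1 cReD cImD cReN cImN.
rewrite RintegralD//.
- by have := H1 t td1; have := H2 t td2; lra.
- by apply: intR_dist => //; exact: (intR_shift (h := fun s => complex.Re (f s)) t).
- by apply: intR_dist => //; exact: (intR_shift (h := fun s => complex.Im (f s)) t).
Qed.

End shift.

(** * Spectral synthesis for sequences of functions *)

Section act.
Context {R : realType}.
Notation mu := (@lebesgue_measure R).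
Notation mass := (@fejer_mass R).
Implicit Types (f g h psi : R -> R[i]) (M : R).

Definition bdmeas M psi := measC psi /\ forall t, norm1 (psi t) <= M.

(** A correlation rather than a convolution: at r = 0 it is the pairing of h with psi, and it
    multiplies the function e^(-ist) of t by [fhat h s]. *)
Definition act h psi (r : R) : R[i] := Cintegral (fun s => h s * psi (s + r)).

Definition norm1_mass h : R := \int[mu]_s norm1 (h s).

Lemma norm1_mass_ge0 h : 0 <= norm1_mass h.
Proof. by apply: Rintegral_ge0 => t _; exact: norm1_ge0. Qed.

Lemma bdmeas_ge0 M psi : bdmeas M psi -> 0 <= M.
Proof. by move=> [_ /(_ 0)]; apply: le_trans; exact: norm1_ge0. Qed.

Lemma measurable_shift (r : R) : measurable_fun setT (fun s : R => s + r).
Proof. by apply: measurable_funD => //; exact: measurable_cst. Qed.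

Lemma bdmeas_shift M psi (r : R) : bdmeas M psi -> bdmeas M (fun s => psi (s + r)).
Proof.
move=> [mp pM]; split=> [|t]; last exact: pM.
by apply: (measC_comp mp); exact: measurable_shift.
Qed.

Lemma intC_act M h psi r : intC h -> bdmeas M psi ->
  intC (fun s => h s * psi (s + r)).
Proof.
move=> ih /(bdmeas_shift r) [mp pM]; exact: (intCMbd ih mp pM).
Qed.

Lemma norm1_act M h psi r : intC h -> bdmeas M psi ->
  norm1 (act h psi r) <= M * norm1_mass h.
Proof.
move=> ih bp; rewrite /norm1_mass -RintegralZl//; last exact: intC_norm1.
apply: norm1_Cintegral_le; first exact: (intC_act _ ih bp).
  by apply: intRZ; exact: intC_norm1.
move=> t; apply: (le_trans (norm1M _ _)); rewrite mulrC ler_wpM2r ?norm1_ge0//.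
exact: bp.2.
Qed.

Lemma actB M M' h psi psi' r : intC h -> bdmeas M psi -> bdmeas M' psi' ->
  act h (fun s => psi s - psi' s) r = act h psi r - act h psi' r.
Proof.
move=> ih bp bp'; rewrite /act -CintegralB; first last.
- exact: (intC_act _ ih bp').
- exact: (intC_act _ ih bp).
by congr Cintegral; apply/funext => s; rewrite mulrBr.
Qed.

Lemma actBl M g h psi r : intC g -> intC h -> bdmeas M psi ->
  act (fun s => g s - h s) psi r = act g psi r - act h psi r.
Proof.
move=> ig ih bp; rewrite /act -CintegralB; first last.
- exact: (intC_act _ ih bp).
- exact: (intC_act _ ig bp).
by congr Cintegral; apply/funext => s; rewrite mulrBl.
Qed.

Lemma actDl M g h psi r : intC g -> intC h -> bdmeas M psi ->
  act (fun s => g s + h s) psi r = act g psi r + act h psi r.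
Proof.
move=> ig ih bp; rewrite /act -CintegralD; first last.
- exact: (intC_act _ ih bp).
- exact: (intC_act _ ig bp).
by congr Cintegral; apply/funext => s; rewrite mulrDl.
Qed.

Lemma actZl M c h psi r : intC h -> bdmeas M psi ->
  act (fun s => c * h s) psi r = c * act h psi r.
Proof.
move=> ih bp; rewrite /act -CintegralZ; last exact: (intC_act _ ih bp).
by congr Cintegral; apply/funext => s; rewrite mulrA.
Qed.

Lemma act_comm M f g psi r : intC f -> intC g -> bdmeas M psi ->
  act f (act g psi) r = act g (act f psi) r.
Proof.
move=> fi gi [mp pM].
pose K (z : R * R) : R[i] := f z.1 * g z.2 * psi (z.1 + z.2 + r).
have iK : intC2 K.
  apply: (@intC2_prod _ f g (fun z => psi (z.1 + z.2 + r)) M) => //.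
  apply: (measC_comp mp); apply: measurable_funD; last exact: measurable_cst.
  by apply: measurable_funD; [exact: measurable_fst|exact: measurable_snd].
have E1 : act f (act g psi) r = Cintegral (fun s => Cintegral (fun t => K (s, t))).
  congr Cintegral; apply/funext => s; rewrite /act -CintegralZ; last first.
    by apply: (intC_act (M := M)).
  congr Cintegral; apply/funext => t; rewrite /K /= mulrA.
  by congr (_ * psi _); ring.
rewrite E1 (Cintegral_Fubini iK).
congr Cintegral; apply/funext => s; rewrite /act -CintegralZ; last first.
  by apply: (intC_act (M := M)).
congr Cintegral; apply/funext => t; rewrite /K /= mulrCA mulrA.
by congr (_ * psi _); ring.
Qed.


(** Composition is the action of the convolution. The bound B on g makes [f t * g (y - t)]
    integrable in t for every y, as [intC2] demands. *)
Lemma act_conv M B f g psi r : intC f -> intC g ->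
  (forall t, norm1 (g t) <= B) -> bdmeas M psi ->
  act f (act g psi) r =
  Cintegral (fun y => Cintegral (fun t => f t * g (y - t)) * psi (y + r)).
Proof.
move=> fi gi gB bp; have M0 := bdmeas_ge0 bp.
have [mp pM] := bp.
have mf := intC_measC fi; have mg := intC_measC gi.
have B0 : 0 <= B by apply: le_trans (gB 0); exact: norm1_ge0.
pose K (z : R * R) : R[i] := f z.1 * g (z.2 - z.1) * psi (z.2 + r).
have mK : measC K.
  apply: measCM.
    apply: measCM; first by apply: (measC_comp mf); exact: measurable_fst.
    apply: (measC_comp mg).
    by apply: measurable_funB; [exact: measurable_snd|exact: measurable_fst].
  apply: (measC_comp mp); apply: measurable_funD; last exact: measurable_cst.
  exact: measurable_snd.
have le1 z : norm1 (K z) <= norm1 (f z.1) * norm1 (g (z.2 - z.1)) * M.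
  apply: (le_trans (norm1M _ _)); apply: ler_pM; rewrite ?norm1_ge0//.
  exact: norm1M.
have mK1 x : measurable_fun setT (fun y => norm1 (K (x, y))).
  apply: measurable_norm1; by apply: (measC_comp (f := K)).
have mK2 y : measurable_fun setT (fun x => norm1 (K (x, y))).
  apply: measurable_norm1; by apply: (measC_comp (f := K)).
have ig x : intR (fun y => norm1 (g (y - x))).
  exact: (intR_shift (h := fun y => norm1 (g y)) (- x) (intC_norm1 gi)).
have iK1 x : intR (fun y => norm1 (K (x, y))).
  apply: (intR_le (k := fun y => (norm1 (f x) * M) * norm1 (g (y - x)))) => //.
    by move=> y; rewrite ger0_norm ?norm1_ge0// [leRHS]mulrAC; exact: (le1 (x, y)).
  exact: intRZ.
have iK : intC2 K.
  split => //.
  - move=> y; apply: (intR_le (k := fun x => (B * M) * norm1 (f x))) => //.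
      move=> x; rewrite ger0_norm ?norm1_ge0//; apply: (le_trans (le1 (x, y))) => /=.
      rewrite [B * M]mulrC -mulrA mulrC -mulrA.
      rewrite mulrC [leRHS]mulrC -mulrA.
      have := gB (y - x); have := norm1_ge0 (f x); have := norm1_ge0 (g (y - x)).
      move: (norm1 _) (norm1 _) => a b b0 a0 bB.
      by rewrite mulrC; apply: ler_wpM2l => //; exact: mulr_ge0.
    by apply: intRZ; exact: intC_norm1.
  - apply: (intR_le (k := fun x => (M * norm1_mass g) * norm1 (f x))).
    + apply: (@measurable_Rintegral1 R (fun z => norm1 (K z))).
        exact: measurable_norm1.
      by move=> z; exact: norm1_ge0.
    + move=> x; rewrite ger0_norm ?Rintegral_ge0//; last first.
        by move=> y _; exact: norm1_ge0.
      have -> : norm1_mass g = \int[mu]_y norm1 (g (y - x)).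
        by rewrite (Rintegral_shift (h := fun y => norm1 (g y)) (- x) (intC_norm1 gi)).
      rewrite mulrAC -RintegralZl//; last exact: ig.
      apply: Rintegral_le; [exact: iK1|exact: intRZ|].
      by move=> y; apply: (le_trans (le1 (x, y))) => /=; lra.
    + by apply: intRZ; exact: intC_norm1.
have E1 : act f (act g psi) r = Cintegral (fun t => Cintegral (fun y => K (t, y))).
  congr Cintegral; apply/funext => t.
  have iu : intC (fun s => g s * psi (s + (t + r))) by exact: (intC_act (M := M)).
  rewrite /act -(Cintegral_shift (- t) iu) -CintegralZ; last first.
    exact: (intC_shift (f := fun s => g s * psi (s + (t + r))) (- t) iu).
  congr Cintegral; apply/funext => y; rewrite /K /= mulrA.
  by congr (_ * psi _); ring.
rewrite E1 (Cintegral_Fubini iK); congr Cintegral; apply/funext => y.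
rewrite [RHS]mulrC -CintegralZ; last first.
  apply: (intCMbd (M := B)) => //.
    apply: (measC_comp mg); apply: measurable_funB => //; exact: measurable_cst.
congr Cintegral; apply/funext => t; rewrite /K /= mulrC//.
Qed.

(** Locality in frequency: behind a window, the action of g depends only on [fhat g] inside ]c -
    eta, c + eta[. The next two lemmas are the cases where this restriction is 0 and 1. *)
Lemma act_window M g c eta psi r : 0 < eta -> intC g -> bdmeas M psi ->
  act g (act (fejer c eta) psi) r =
  Cintegral (fun y => ((2 * mass)^-1)%:C *
    Cintegral (fun s => (win c eta s)%:C * expi (s * y) * fhat g s) *
    psi (y + r)).
Proof.
move=> e0 ig bp.
rewrite (act_conv r ig (intC_fejer c e0) (fun t => norm1_fejer_bd c t e0) bp).
by congr Cintegral; apply/funext => y; rewrite conv_fejer.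
Qed.

Lemma act_window0 M g c eta psi r : 0 < eta -> intC g -> bdmeas M psi ->
  (forall s, `|s - c| < eta -> fhat g s = 0) ->
  act g (act (fejer c eta) psi) r = 0.
Proof.
move=> e0 ig bp g0; rewrite (act_window _ _ _ ig bp)//.
have -> : (fun y => ((2 * mass)^-1)%:C *
    Cintegral (fun s => (win c eta s)%:C * expi (s * y) * fhat g s) *
    psi (y + r)) = (fun=> 0); last exact: Cintegral0.
apply/funext => y.
have -> : (fun s => (win c eta s)%:C * expi (s * y) * fhat g s) = (fun=> 0).
  apply/funext => s; have [sc|sc] := ltP `|s - c| eta.
    by rewrite g0 ?mulr0.
  by rewrite win_out// !mul0r.
by rewrite Cintegral0 mulr0 mul0r.
Qed.

Lemma act_window1 M g c eta psi r : 0 < eta -> intC g -> bdmeas M psi ->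
  (forall s, `|s - c| < eta -> fhat g s = 1) ->
  act g (act (fejer c eta) psi) r = act (fejer c eta) psi r.
Proof.
move=> e0 ig bp g1; rewrite (act_window _ _ _ ig bp)//.
congr Cintegral; apply/funext => y; congr (_ * _).
have -> : (fun s => (win c eta s)%:C * expi (s * y) * fhat g s) =
    (fun s => (win c eta s)%:C * expi (s * y)).
  apply/funext => s; have [sc|sc] := ltP `|s - c| eta.
    by rewrite g1 ?mulr1.
  by rewrite win_out// !mul0r.
by have [_ ->] := fejer_win c y e0; rewrite mulrA mass2K mul1r.
Qed.

End act.

Section families.
Context {R : realType}.
Notation mu := (@lebesgue_measure R).
Notation mass := (@fejer_mass R).
Implicit Types (f g h : R -> R[i]) (Psi : nat -> R -> R[i]).

Definition equi_uniformly_continuous Psi := forall e : R, 0 < e ->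
  exists2 d : R, 0 < d & forall n r t, `|t| < d ->
    norm1 (Psi n (r + t) - Psi n r) <= e.

Definition nice Psi := (exists M, forall n, bdmeas M (Psi n)) /\ equi_uniformly_continuous Psi.

Definition null Psi := forall r, norm1 (Psi n r) @[n --> \oo] --> 0.

Definition actS h Psi : nat -> R -> R[i] := fun n => act h (Psi n).

Lemma equicontinuous_measC Psi n : equi_uniformly_continuous Psi -> measC (Psi n).
Proof.
move=> eq.
have H (p : R[i] -> R) : (forall z w, `|p z - p w| <= norm1 (z - w)) ->
    measurable_fun setT (fun t => p (Psi n t)).
  move=> pl; apply: continuous_measurable_fun => x.
  apply/cvgrPdist_le => e e0; have [d d0 Hd] := eq e e0.
  apply/nbhs_ballP; exists d => //= y xy.
  apply: (le_trans (pl _ _)); rewrite -norm1N opprB.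
  by have := Hd n x (y - x); rewrite subrKC; apply; rewrite distrC.
split; apply: H => z w; rewrite /norm1.
  by rewrite -cReN -cReD lerDl.
by rewrite -cImN -cImD lerDr.
Qed.

(** Translating the result amounts to translating f, and translation is continuous in L^1; hence a
    merely bounded family becomes equicontinuous. *)
Lemma nice_act0 f Psi M : intC f -> (forall n, bdmeas M (Psi n)) ->
  nice (actS f Psi).
Proof.
move=> fi bP; have M0 := bdmeas_ge0 (bP 0%N).
have eq : equi_uniformly_continuous (actS f Psi).
  (* M may be 0, hence the divisor M + 1. *)
  move=> e e0; have e1 : 0 < e / (M + 1) by rewrite divr_gt0//; lra.
  have [d d0 Hd] := intC_shift_continuous fi e1.
  exists d => // n r t td.
  have E : actS f Psi n (r + t) = act (fun s => f (s + - t)) (Psi n) r.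
    have iu : intC (fun s => f s * Psi n (s + (r + t))) by exact: (intC_act _ fi (bP n)).
    rewrite /actS {1}/act -(Cintegral_shift (- t) iu).
    by congr Cintegral; apply/funext => s; congr (_ * Psi n _); ring.
  have ift := intC_shift (- t) fi.
  rewrite E /actS -(actBl r ift fi (bP n)).
  apply: (le_trans (norm1_act _ (intCB ift fi) (bP n))).
  have H := Hd (- t); rewrite normrN in H; have {}H := H td.
  apply: (@le_trans _ _ (M * (e / (M + 1)))); first by apply: ler_wpM2l.
  by rewrite mulrA ler_pdivrMr; lra.
split=> //; exists (M * norm1_mass f) => n; split.
  exact: equicontinuous_measC.
by move=> t; exact: norm1_act.
Qed.

Lemma nice_act h Psi : intC h -> nice Psi -> nice (actS h Psi).
Proof. by move=> ih [[M bP] _]; exact: nice_act0 bP. Qed.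

Lemma niceB Psi Phi : nice Psi -> nice Phi -> nice (fun n r => Psi n r - Phi n r).
Proof.
move=> [[M bP] eP] [[M' bP'] eP']; split.
  exists (M + M') => n; split.
    by apply: measCB; [exact: (bP n).1|exact: (bP' n).1].
  by move=> t; apply: (le_trans (norm1B _ _)); apply: lerD; [exact: (bP n).2|exact: (bP' n).2].
move=> e e0; have e2 : 0 < e / 2 by lra.
have [d1 d10 H1] := eP _ e2; have [d2 d20 H2] := eP' _ e2.
exists (Num.min d1 d2); first by rewrite lt_min d10.
move=> n r t; rewrite lt_min => /andP[t1 t2].
have -> : Psi n (r + t) - Phi n (r + t) - (Psi n r - Phi n r) =
  (Psi n (r + t) - Psi n r) - (Phi n (r + t) - Phi n r) by ring.
apply: (le_trans (norm1B _ _)).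
by have := H1 n r t t1; have := H2 n r t t2; lra.
Qed.

Lemma null0 Psi : (forall n r, Psi n r = 0) -> null Psi.
Proof.
move=> H r; under eq_fun do rewrite H norm1_0; exact: cvg_cst.
Qed.

Lemma eq_null Psi Phi : (forall n r, Psi n r = Phi n r) -> null Phi -> null Psi.
Proof. by move=> H nP r; under eq_fun do rewrite H; exact: nP. Qed.

Lemma le_null Psi (u : R -> nat -> R) : (forall n r, norm1 (Psi n r) <= u r n) ->
  (forall r, u r n @[n --> \oo] --> 0) -> null Psi.
Proof.
move=> le u0 r; apply: (squeeze_cvgr _ (cvg_cst 0) (u0 r)).
by apply: nearW => n; rewrite norm1_ge0/=.
Qed.

Lemma nullD Psi Phi : null Psi -> null Phi -> null (fun n r => Psi n r + Phi n r).
Proof.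
move=> n1 n2; apply: (@le_null _ (fun r n => norm1 (Psi n r) + norm1 (Phi n r))).
  by move=> n r; exact: norm1D.
by move=> r; rewrite -(addr0 0); apply: cvgD; [exact: n1|exact: n2].
Qed.

Lemma nullZ (c : R[i]) Psi : null Psi -> null (fun n r => c * Psi n r).
Proof.
move=> n1; apply: (@le_null _ (fun r n => norm1 c * norm1 (Psi n r))).
  by move=> n r; exact: norm1M.
by move=> r; rewrite -(mulr0 (norm1 c)); apply: cvgM; [exact: cvg_cst|exact: n1].
Qed.

Lemma nullB Psi Phi : null Psi -> null Phi -> null (fun n r => Psi n r - Phi n r).
Proof.
move=> n1 n2; apply: (@le_null _ (fun r n => norm1 (Psi n r) + norm1 (Phi n r))).
  by move=> n r; exact: norm1B.
by move=> r; rewrite -(addr0 0); apply: cvgD; [exact: n1|exact: n2].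
Qed.

(** Dominated convergence with majorant M |h|: this is why a common bound goes with pointwise
    convergence throughout. *)
Lemma null_act M h Psi : intC h -> (forall n, bdmeas M (Psi n)) -> null Psi ->
  null (actS h Psi).
Proof.
move=> ih bP nP r; apply: (@cvg0_Cintegral R _ (fun s => M * norm1 (h s))).
- by move=> n; have /intC_measC := intC_act r ih (bP n).
- move=> n t; apply: (le_trans (norm1M _ _)).
  by rewrite mulrC ler_wpM2r ?norm1_ge0//; exact: (bP n).2.
- by apply: intRZ; exact: intC_norm1.
- apply: aeW => t.
  suff : (fun n => norm1 (h t) * norm1 (Psi n (t + r))) @ \oo --> 0.
    move=> c0; apply: (squeeze_cvgr _ (cvg_cst 0) c0).
    by apply: nearW => n; rewrite norm1_ge0/= norm1M.
  by rewrite -(mulr0 (norm1 (h t))); apply: cvgM; [exact: cvg_cst|exact: nP].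
Qed.

(** The condition |c - s| + eta < d says that the support [c - eta, c + eta] of the window lies in
    ]s - d, s + d[. The complement of the good set is a Beurling spectrum of the sequence modulo
    null sequences. *)
Definition good Psi (s : R) := exists2 d : R, 0 < d &
  forall c eta : R, 0 < eta -> `|c - s| + eta < d -> null (actS (fejer c eta) Psi).

Lemma good_open Psi s : good Psi s ->
  exists2 d : R, 0 < d & forall s', `|s' - s| < d -> good Psi s'.
Proof.
move=> [d d0 H]; have d2 : 0 < d / 2 by lra.
exists (d / 2) => // s' s's; exists (d / 2) => // c eta e0 ce; apply: H => //.
have := ler_distD s' c s; lra.
Qed.

End families.

(** * From good frequencies to pointwise convergence *)

Section synthesis.
Context {R : realType}.
Notation mu := (@lebesgue_measure R).
Notation mass := (@fejer_mass R).
Implicit Types (f g h : R -> R[i]) (Psi : nat -> R -> R[i]).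

Lemma act_fejer_double M (psi : R -> R[i]) (c eta r : R) : 0 < eta ->
  bdmeas M psi ->
  act (fejer c (2 * eta)) psi r = 2^-1 * act (fejer (c - eta) eta) psi r +
    act (fejer c eta) psi r + 2^-1 * act (fejer (c + eta) eta) psi r.
Proof.
move=> e0 bp.
have i1 := intC_fejer (c - eta) e0; have i2 := intC_fejer c e0.
have i3 := intC_fejer (c + eta) e0.
have -> : fejer c (2 * eta) = (fun t => 2^-1 * fejer (c - eta) eta t +
    fejer c eta t + 2^-1 * fejer (c + eta) eta t).
  by apply/funext => t; exact: fejer_double.
rewrite -(actZl 2^-1 r i1 bp) -(actZl 2^-1 r i3 bp).
rewrite -(actDl r (intCZ 2^-1 i1) i2 bp).
by rewrite -(actDl r (intCD (intCZ 2^-1 i1) i2) (intCZ 2^-1 i3) bp).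
Qed.

(** Compactness by bisection: by [fejer_double], a window that is not null has a child of half the
    width that is not null. The nested windows shrink to a frequency s, and goodness at s
    contradicts the badness of a small one. *)
Lemma windows_null M Psi : (forall n, bdmeas M (Psi n)) ->
  (forall s, good Psi s) ->
  forall c eta : R, 0 < eta -> null (actS (fejer c eta) Psi).
Proof.
move=> bP gP c eta e0; apply: contrapT => nn.
pose bad (p : R * R) := 0 < p.2 /\ ~ null (actS (fejer p.1 p.2) Psi).
have step p : exists q : R * R, bad p ->
    [/\ bad q, q.2 = p.2 / 2 & `|q.1 - p.1| <= q.2].
  have [|nb] := pselect (bad p); last by exists p.
  case: p => a b [/= b0 nb]; have b2 : 0 < b / 2 by lra.
  have [n1|] := pselect (null (actS (fejer (a - b / 2) (b / 2)) Psi)); last first.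
    move=> n1; exists (a - b / 2, b / 2) => _.
    split; [exact: (conj b2 n1)|reflexivity|rewrite /=].
    by rewrite addrAC subrr add0r normrN (ger0_norm (ltW b2)).
  have [n2|] := pselect (null (actS (fejer a (b / 2)) Psi)); last first.
    move=> n2; exists (a, b / 2) => _.
    split; [exact: (conj b2 n2)|reflexivity|rewrite /=].
    by rewrite subrr normr0; exact: ltW.
  have [n3|] := pselect (null (actS (fejer (a + b / 2) (b / 2)) Psi)); last first.
    move=> n3; exists (a + b / 2, b / 2) => _.
    split; [exact: (conj b2 n3)|reflexivity|rewrite /=].
    by rewrite addrAC subrr add0r (ger0_norm (ltW b2)).
  exfalso; apply: nb; have := nullD (nullD (nullZ 2^-1 n1) n2) (nullZ 2^-1 n3).
  have bb : 2 * (b / 2) = b by field.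
  apply: eq_null => n r.
  by rewrite -(act_fejer_double a r b2 (bP n)) bb.
have [F HF] := choice step.
pose x n := iter n F (c, eta).
have badx n : bad (x n).
  elim: n => [|n IH]; first exact: (conj e0 nn).
  by have [b _ _] := HF _ IH; exact: b.
have x2 n : (x n.+1).2 = (x n).2 / 2 by have [] := HF _ (badx n).
have x1 n : `|(x n.+1).1 - (x n).1| <= (x n.+1).2 by have [] := HF _ (badx n).
have xpos n : 0 < (x n).2 by have [] := badx n.
(* The intervals are nested because the centre moves by at most the new half-width, which is half of
   the old one; s is the supremum of their left ends. *)
have Lmono n k : (x n).1 - (x n).2 <= (x (n + k)%N).1 - (x (n + k)%N).2 /\
    (x (n + k)%N).1 + (x (n + k)%N).2 <= (x n).1 + (x n).2.
  elim: k => [|k [IH1 IH2]]; first by rewrite addn0.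
  rewrite addnS; have := x1 (n + k)%N; rewrite ler_norml => /andP[h1 h2].
  have := x2 (n + k)%N; lra.
pose L := [set y | exists n, y = (x n).1 - (x n).2].
have LU n m : (x m).1 - (x m).2 <= (x n).1 + (x n).2.
  have [mn|nm] := leqP m n.
    have := (Lmono m (n - m)%N).1; rewrite subnKC//; have := xpos n; lra.
  have := (Lmono n (m - n)%N).2; rewrite subnKC ?(ltnW nm)//; have := xpos m; lra.
have supL : has_sup L.
  split; first by exists ((x 0%N).1 - (x 0%N).2); exists 0%N.
  by exists ((x 0%N).1 + (x 0%N).2) => y [n ->]; exact: LU.
pose s := sup L.
have sx n : `|(x n).1 - s| <= (x n).2.
  have h1 : (x n).1 - (x n).2 <= s by apply: sup_upper_bound => //; exists n.
  have h2 : s <= (x n).1 + (x n).2.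
    apply: ge_sup; first by case: supL.
    by move=> y [m ->]; exact: LU.
  by rewrite ler_norml; apply/andP; split; lra.
have [d d0 Hd] := gP s.
have xe n : (x n).2 = eta / 2 ^+ n.
  elim: n => [|n IH]; first by rewrite expr0 divr1.
  by rewrite x2 IH exprS invfM mulrA mulrAC.
have [n Hn] : exists n, (x n).2 < d / 2.
  pose n := Num.bound (2 * eta / d); exists n; rewrite xe.
  have h1 : 2 * eta / d < n%:R.
    by apply: archi_boundP; rewrite divr_ge0 ?ltW// mulr_gt0.
  have h2 : n%:R <= 2 ^+ n :> R by rewrite -natrX ler_nat ltnW// ltn_expl.
  rewrite ltr_pdivrMr ?exprn_gt0//; rewrite ltr_pdivrMr// in h1; nra.
apply: (badx n).2; apply: Hd; first exact: xpos.
have := sx n; lra.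
Qed.

Lemma Cintegral_fejer0 (m : R) : 0 < m -> Cintegral (fejer 0 m) = 1.
Proof.
move=> m0; have H := fhat_fejer 0 0 m0.
rewrite /win subr0 mul0r tri_in ?normr0// subr0 in H.
rewrite -[RHS]H /fhat.
by congr Cintegral; apply/funext => t; rewrite mul0r expi0 mul1r.
Qed.

Lemma norm1_mass_fejer0 (m : R) : 0 < m -> norm1_mass (fejer 0 m) <= 2.
Proof.
move=> m0; have k0 := @fejer_mass_gt0 R.
have i1 : intR (fun t => fejer0 (m * t)).
  have := intR_affine (h := fejer0) 0 m0 (@intR_fejer0 R).
  by under eq_fun do rewrite addr0.
apply: (@le_trans _ _ (\int[mu]_t (2 / mass * m * fejer0 (m * t)))).
  apply: Rintegral_le; [exact: intC_norm1 (intC_fejer 0 m0)|exact: intRZ|].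
  by move=> t; exact: norm1_fejer.
rewrite RintegralZl//.
have := Rintegral_affine (h := fejer0) 0 m0 (@intR_fejer0 R).
under eq_Rintegral do rewrite addr0.
move=> ->; rewrite -/mass.
have -> : 2 / mass * m * (m^-1 * mass) = 2; last by [].
by field; rewrite !gt_eqF.
Qed.

(** An approximate identity: near 0 the increments of [Psi n] are small uniformly in n and r, and
    away from 0 the kernel is of size 1/m. *)
Lemma fejer_approx Psi : nice Psi -> forall e : R, 0 < e ->
  exists2 m : R, 0 < m &
    forall n r, norm1 (act (fejer 0 m) (Psi n) r - Psi n r) <= e.
Proof.
move=> [[M bP] eP] e e0; have k0 := @fejer_mass_gt0 R.
have M0 := bdmeas_ge0 (bP 0%N).
have e4 : 0 < e / 4 by lra.
have [d d0 Hd] := eP _ e4.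
pose P : R := \int[mu]_x (oneDsqr x)^-1.
have V0 x : 0 < (oneDsqr x)^-1 :> R.
  by rewrite invr_gt0 /oneDsqr; have := sqr_ge0 x; lra.
have P0 : 0 <= P by apply: Rintegral_ge0 => x _; exact: ltW.
(* 2 M bounds the increments of [Psi n], (4 / mass) / (m s^2) bounds the kernel, and for |s| >= d
   the last factor trades s^(-2) for the integrable (1 + s^2)^(-1). The choice of m then makes this
   part at most e / 2. *)
pose C : R := 2 * M * (4 / mass) * (1 + (d ^+ 2)^-1).
have C0 : 0 <= C.
  have h1 : 0 <= 4 / mass by rewrite divr_ge0// ltW.
  have h2 : 0 <= (d ^+ 2)^-1 by rewrite invr_ge0 sqr_ge0.
  by rewrite /C !mulr_ge0//; lra.
pose m : R := 2 * C * P / e + 1.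
have m0 : 0 < m.
  have h : 0 <= 2 * C * P / e by exact: divr_ge0 (mulr_ge0 (mulr_ge0 (ler0n _ 2) C0) P0) (ltW e0).
  by rewrite /m; lra.
have Cm : C / m * P <= e / 2.
  rewrite mulrAC ler_pdivrMr// /m mulrDr mulr1.
  have -> : e / 2 * (2 * C * P / e) = C * P by field; rewrite gt_eqF.
  by rewrite lerDl; lra.
exists m => // n r.
have iF := intC_fejer 0 m0.
have bpr := bdmeas_shift r (bP n).
have -> : act (fejer 0 m) (Psi n) r - Psi n r =
    Cintegral (fun s => fejer 0 m s * (Psi n (s + r) - Psi n r)).
  rewrite -[Psi n r in LHS]mulr1 -(Cintegral_fejer0 m0) -CintegralZ//.
  rewrite /act -CintegralB//; last exact: intCZ.
    by congr Cintegral; apply/funext => s; ring.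
  exact: (intC_act _ iF (bP n)).
have iV := @intR_oneDsqrV R.
pose k s := e / 4 * norm1 (fejer 0 m s) + C / m * (oneDsqr s)^-1.
have ik : intR k.
  by apply: intRD; apply: intRZ => //; exact: intC_norm1.
apply: (@le_trans _ _ (\int[mu]_s k s)).
  apply: norm1_Cintegral_le => //.
    apply: (intCMbd (M := M + M) iF).
      by apply: measCB; [exact: bpr.1|exact: measC_cst].
    move=> t; apply: (le_trans (norm1B _ _)); apply: lerD; exact: (bP n).2.
  move=> s; apply: (le_trans (norm1M _ _)); rewrite /k.
  have N0 := norm1_ge0 (fejer 0 m s).
  have [sd|ds] := ltP `|s| d.
    apply: ler_wpDr.
      by apply: mulr_ge0; [apply: divr_ge0 => //; exact: ltW|exact: ltW].
    by rewrite mulrC ler_wpM2r// [s + r]addrC; exact: Hd.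
  apply: ler_wpDl; first by apply: mulr_ge0 => //; exact: ltW.
  have F1 := norm1_fejer 0 s m0.
  have s0 : s != 0 by apply: contraTneq ds => ->; rewrite normr0 -ltNge.
  have s2 : 0 < s ^+ 2 by rewrite exprn_even_gt0.
  have F2 : fejer0 (m * s) <= 2 / (m * s) ^+ 2.
    rewrite /fejer0 mulf_eq0 (negbTE s0) gt_eqF//= ler_wpM2r ?invr_ge0 ?sqr_ge0//.
    by have := cos_geN1 (m * s); lra.
  have F3 : norm1 (fejer 0 m s) <= 4 / mass / m * (s ^+ 2)^-1.
    apply: (le_trans F1).
    have h : 0 <= 2 / mass * m by apply: mulr_ge0; [apply: divr_ge0 => //; exact: ltW|exact: ltW].
    apply: (le_trans (ler_wpM2l h F2)); rewrite le_eqVlt; apply/orP; left.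
    by apply/eqP; field; rewrite s0 !gt_eqF.
  have F4 : (s ^+ 2)^-1 <= (1 + (d ^+ 2)^-1) * (oneDsqr s)^-1.
    rewrite ler_pdivlMr; last by rewrite -invr_gt0.
    rewrite /oneDsqr mulrDr mulr1 mulVf ?gt_eqF// addrC lerD2l.
    have d2 : 0 < d ^+ 2 by exact: exprn_gt0.
    rewrite lef_pV2 ?posrE//.
    by rewrite -[s ^+ 2]real_normK ?num_real// ler_pXn2r// ?nnegrE ?ltW.
  have F5 : norm1 (Psi n (s + r) - Psi n r) <= 2 * M.
    apply: (le_trans (norm1B _ _)); have := (bP n).2 (s + r).
    have := (bP n).2 r; lra.
  have h1 : 0 <= 4 / mass / m by apply: divr_ge0; [apply: divr_ge0 => //|]; exact: ltW.
  apply: (le_trans (ler_pM N0 (norm1_ge0 _) (le_trans F3 (ler_wpM2l h1 F4)) F5)).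
  rewrite le_eqVlt; apply/orP; left; apply/eqP; rewrite /C; ring.
rewrite RintegralD//; [|by apply: intRZ => //; exact: intC_norm1|exact: intRZ].
rewrite !RintegralZl//; last exact: intC_norm1.
have := norm1_mass_fejer0 m0; rewrite /norm1_mass -/P => H2.
apply: (@le_trans _ _ (e / 4 * 2 + e / 2)); last lra.
by apply: lerD => //; apply: ler_wpM2l => //; exact: ltW.
Qed.

(** A wide window at 0 is close to the identity uniformly in n, and its action on the sequence is
    null by [windows_null]. *)
Lemma all_good_null Psi : nice Psi -> (forall s, good Psi s) -> null Psi.
Proof.
move=> nP gP r; apply/cvg0P; first by move=> n; exact: norm1_ge0.
move=> e e0; have e2 : 0 < e / 2 by lra.
have [m m0 Hm] := fejer_approx nP e2.
have [[M bP] _] := nP.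
have p0 n : 0 <= norm1 (actS (fejer 0 m) Psi n r) by exact: norm1_ge0.
have [N HN] := (cvg0P p0).1 (windows_null bP gP 0 m0 r) _ e2; exists N => n Nn.
have := norm1_sub (Psi n r) (act (fejer 0 m) (Psi n) r).
have := HN n Nn; have := Hm n r; rewrite /actS -norm1N opprB.
lra.
Qed.

End synthesis.

(** * The de la Vallee Poussin kernel and the estimate at a zero of the transform *)

Section trapezoid.
Context {R : realType}.
Notation mu := (@lebesgue_measure R).
Notation mass := (@fejer_mass R).
Implicit Types (f g h : R -> R[i]) (Psi : nat -> R -> R[i]).

(* de la Vallee Poussin kernel: its Fourier transform is a trapezoid which is
   equal to 1 on [s0 - d, s0 + d]. *)
Definition trap (s0 d t : R) : R[i] := 2 * fejer s0 (2 * d) t - fejer s0 d t.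

Lemma intC_trap s0 d : 0 < d -> intC (trap s0 d).
Proof.
by move=> d0; apply: intCB; [apply: intCZ|]; apply: intC_fejer => //; exact: mulr_gt0.
Qed.

Lemma fhatB f g s : intC f -> intC g ->
  fhat (fun t => f t - g t) s = fhat f s - fhat g s.
Proof.
move=> fi gi; rewrite /fhat -CintegralB; [|exact: intC_expiM..].
by congr Cintegral; apply/funext => t; rewrite mulrBr.
Qed.

Lemma fhatZ c f s : intC f -> fhat (fun t => c * f t) s = c * fhat f s.
Proof.
move=> fi; rewrite /fhat -CintegralZ; last exact: intC_expiM.
by congr Cintegral; apply/funext => t; rewrite mulrCA.
Qed.

Lemma fhat_trap s0 d s : 0 < d -> `|s - s0| <= d -> fhat (trap s0 d) s = 1.
Proof.
move=> d0 sd; have d20 : 0 < 2 * d by lra.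
have i2 := intC_fejer s0 d20; have i1 := intC_fejer s0 d0.
rewrite /trap (fhatB s (intCZ 2 i2) i1) (fhatZ 2 s i2) !fhat_fejer//.
have two : (2 : R[i]) = 2%:C by rewrite rmorph_nat.
rewrite two -rmorphM -rmorphB -[RHS]/(1%:C); congr (_%:C).
rewrite /win !tri_in ?normrM ?normfV ?(gtr0_norm d0) ?(gtr0_norm d20).
- by field; rewrite gt_eqF.
- by rewrite ler_pdivrMr// mul1r.
- by rewrite ler_pdivrMr// mul1r; lra.
Qed.

Definition trap0 (x : R) : R := (4 * fejer0 (2 * x) - fejer0 x) / mass.

Lemma trapE s0 d t : trap s0 d t = expi (s0 * t) * (d * trap0 (d * t))%:C.
Proof.
have two : (2 : R[i]) = 2%:C by rewrite rmorph_nat.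
rewrite /trap /fejer /trap0 two -mulrA mulrCA -mulrBr; congr (_ * _).
rewrite -rmorphM -rmorphB; congr (_%:C).
by rewrite -[2 * d * t]mulrA; ring.
Qed.

Lemma intR_trap0 : intR trap0.
Proof.
rewrite (_ : trap0 = (fun x => mass^-1 * (4 * fejer0 (2 * x) + - fejer0 x))); last first.
  by apply/funext => x; rewrite mulrC.
apply: intRZ; apply: intRD; last by apply: intRN; exact: intR_fejer0.
apply: intRZ.
have := intR_affine (h := fejer0) 0 (ltr0n R 2) (@intR_fejer0 R).
by under eq_fun do rewrite addr0.
Qed.

(** The L^1 modulus of continuity of the profile. Since [trap s0 d] is a modulated dilate of [trap0]
    ([trapE]), translating it by t costs the modulus at d t, which is small for small d. *)
Definition trap_modulus (t : R) : R := \int[mu]_x `|trap0 (x + t) - trap0 x|.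

Lemma measurable_trap_modulus : measurable_fun setT trap_modulus.
Proof.
have mt := intR_measurable intR_trap0.
apply: (@measurable_Rintegral1 R (fun z => `|trap0 (z.2 + z.1) - trap0 z.2|)) => //.
apply: measurableT_comp => //; apply: measurable_funB.
  apply: (measurableT_comp mt).
  by apply: measurable_funD; [exact: measurable_snd|exact: measurable_fst].
by apply: (measurableT_comp mt); exact: measurable_snd.
Qed.

Lemma trap_modulus_le t : 0 <= trap_modulus t <= 2 * \int[mu]_x `|trap0 x|.
Proof.
apply/andP; split; first by apply: Rintegral_ge0.
have it := intR_trap0; have ita := intR_abs it.
have E : \int[mu]_x `|trap0 (x + t)| = \int[mu]_x `|trap0 x|.
  exact: (Rintegral_shift (h := fun x => `|trap0 x|) t ita).
have its := intR_shift (h := fun x => `|trap0 x|) t ita.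
rewrite mulr_natl mulr2n -{1}E -RintegralD//.
apply: Rintegral_le; [|exact: intRD|].
  by apply: intR_abs; apply: intRD; [exact: intR_shift|exact: intRN].
by move=> x; exact: ler_normB.
Qed.

(** What passes a narrow kernel at s0 behaves like e^(-i s0 r): a translation is almost a
    multiplication by a phase. The translation is moved to the kernel, where after removing the
    phase only the profile is shifted; the factor 2 is [norm1_expi]. *)
Lemma act_trap_twist M (psi : R -> R[i]) (s0 d t r : R) : 0 < d -> bdmeas M psi ->
  norm1 (act (trap s0 d) psi (t + r) - expi (s0 * - t) * act (trap s0 d) psi r)
  <= 2 * M * trap_modulus (- (d * t)).
Proof.
move=> d0 bp; have M0 := bdmeas_ge0 bp.
have iV := intC_trap s0 d0.
have iVt := intC_shift (- t) iV.
have E1 : act (trap s0 d) psi (t + r) = act (fun s => trap s0 d (s + - t)) psi r.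
  have iu : intC (fun s => trap s0 d s * psi (s + (t + r))) by exact: (intC_act _ iV bp).
  rewrite {1}/act -(Cintegral_shift (- t) iu).
  by congr Cintegral; apply/funext => s; congr (_ * psi _); ring.
rewrite E1 -(actZl (expi (s0 * - t)) r iV bp).
rewrite -(actBl r iVt (intCZ (expi (s0 * - t)) iV) bp).
have iD := intCB iVt (intCZ (expi (s0 * - t)) iV).
apply: (le_trans (norm1_act r iD bp)).
rewrite [2 * M]mulrC -mulrA; apply: ler_wpM2l => //.
have it := intR_trap0.
have im : intR (fun x => `|trap0 (x + - (d * t)) - trap0 x|).
  by apply: intR_abs; apply: intRD; [exact: intR_shift|exact: intRN].
have im2 := intR_affine (h := fun x => `|trap0 (x + - (d * t)) - trap0 x|) 0 d0 im.
have -> : trap_modulus (- (d * t)) =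
    \int[mu]_s (d * `|trap0 (d * s + 0 + - (d * t)) - trap0 (d * s + 0)|).
  rewrite RintegralZl//.
  rewrite (Rintegral_affine (h := fun x => `|trap0 (x + - (d * t)) - trap0 x|) 0 d0 im).
  by rewrite mulrA mulfV ?gt_eqF// mul1r.
rewrite -RintegralZl//; last exact: intRZ.
apply: Rintegral_le; [exact: intC_norm1 iD|by apply: intRZ; exact: intRZ|].
move=> s.
have -> : trap s0 d (s + - t) - expi (s0 * - t) * trap s0 d s =
    (d * (trap0 (d * s + 0 + - (d * t)) - trap0 (d * s + 0)))%:C *
      (expi (s0 * (s - t))).
  have e1 : d * (s - t) = d * s - d * t by ring.
  have e2 : s0 * (s - t) = s0 * s + s0 * - t by ring.
  by rewrite !trapE !addr0 e1 e2 expiD; ring.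
rewrite norm1_realM normrM (gtr0_norm d0) mulrC.
by apply: ler_wpM2r; [rewrite mulr_ge0// ltW|exact: norm1_expi].
Qed.

(* Ditkin's condition at a single point. *)
Lemma act_trap_small M f (s0 : R) : 0 <= M -> intC f -> fhat f s0 = 0 ->
  forall e : R, 0 < e -> exists2 d : R, 0 < d &
    forall psi r, bdmeas M psi -> norm1 (act f (act (trap s0 d) psi) r) <= e.
Proof.
move=> M0 fi f0 e e0.
pose d (n : nat) : R := n.+1%:R^-1.
have d0 n : 0 < d n by rewrite invr_gt0.
(* The bound of [act_trap_twist] weighted by f. It involves neither psi nor r, so the d found by
   dominated convergence is uniform in both. *)
pose E n t := norm1 (f t) * (2 * M * trap_modulus (- (d n * t))).
pose B := 2 * M * (2 * \int[mu]_x `|trap0 x|).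
have M2 : 0 <= 2 * M by rewrite mulr_ge0.
have mE n : measurable_fun setT (E n).
  apply: measurable_funM; first by apply: measurable_norm1; exact: intC_measC.
  apply: measurable_funM; first exact: measurable_cst.
  apply: (measurableT_comp measurable_trap_modulus).
  by apply: measurableT_comp => //; exact: measurable_funM.
have leE n t : `|E n t| <= B * norm1 (f t).
  have /andP[h1 h2] := trap_modulus_le (- (d n * t)).
  have En : 0 <= E n t by rewrite /E !mulr_ge0 ?norm1_ge0.
  rewrite ger0_norm// /E mulrC; apply: ler_wpM2r; first exact: norm1_ge0.
  exact: ler_wpM2l.
have iB : intR (fun t => B * norm1 (f t)) by apply: intRZ; exact: intC_norm1.
have cE : (fun n => \int[mu]_t E n t) @ \oo --> 0.
  apply: (@cvg0_Rintegral R E (fun t => B * norm1 (f t))) => //.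
  apply: aeW => t.
  suff : (fun n => norm1 (f t) * (2 * M * trap_modulus (- (d n * t)))) @ \oo -->
      norm1 (f t) * (2 * M * 0) by rewrite !mulr0.
  apply: cvgM; first exact: cvg_cst.
  apply: cvgM; first exact: cvg_cst.
  apply/cvg0P; first by move=> n; have /andP[] := trap_modulus_le (- (d n * t)).
  move=> e1 e10; have [c c0 Hc] := intR_shift_continuous intR_trap0 e10.
  pose N := Num.bound (`|t| / c); exists N => n Nn; apply: Hc.
  have h1 : `|t| / c < N%:R by apply: archi_boundP; rewrite divr_ge0// ltW.
  rewrite normrN normrM (gtr0_norm (d0 n)) /d mulrC ltr_pdivrMr//.
  rewrite ltr_pdivrMr// mulrC in h1; apply: (lt_le_trans h1).
  by apply: ler_wpM2l; [exact: ltW|rewrite ler_nat; exact: ltnW].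
have E0 n : 0 <= \int[mu]_t E n t.
  apply: Rintegral_ge0 => t _.
  by have /andP[h1 _] := trap_modulus_le (- (d n * t)); rewrite !mulr_ge0 ?norm1_ge0.
have [N HN] := (cvg0P E0).1 cE e e0.
exists (d N) => // psi r bp.
apply: le_trans (HN N (leqnn N)).
have iV := intC_trap s0 (d0 N).
have bV : nice (actS (trap s0 (d N)) (fun=> psi)).
  by apply: (@nice_act0 _ _ _ M) => // _.
have [[M' bV1] _] := bV.
have bphi : bdmeas M' (act (trap s0 (d N)) psi) := bV1 0%N.
(* The subtracted term integrates to [fhat f s0] times a constant, that is to 0. *)
have -> : act f (act (trap s0 (d N)) psi) r =
    Cintegral (fun t => f t * (act (trap s0 (d N)) psi (t + r) -
      expi (s0 * - t) * act (trap s0 (d N)) psi r)).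
  rewrite -[LHS]subr0 -(mul0r (act (trap s0 (d N)) psi r)) -f0 mulrC /fhat.
  rewrite -CintegralZ; last exact: intC_expiM.
  rewrite {1}/act -CintegralB; first last.
  - by apply: intCZ; exact: intC_expiM.
  - exact: (intC_act _ fi bphi).
  by congr Cintegral; apply/funext => t; ring.
apply: norm1_Cintegral_le.
- apply: (intCMbd (M := M' + 2 * norm1 (act (trap s0 (d N)) psi r)) fi).
    apply: measCB; first exact: (bdmeas_shift r bphi).1.
    apply: measCM; last exact: measC_cst.
    by apply: measC_expi; apply: measurable_funM => //; exact: measurableT_comp.
  move=> t; apply: (le_trans (norm1B _ _)); apply: lerD; first exact: bphi.2.
  apply: (le_trans (norm1M _ _)); apply: ler_wpM2r; first exact: norm1_ge0.
  exact: norm1_expi.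
- exact: (intR_le (mE N) (leE N) iB).
- move=> t; apply: (le_trans (norm1M _ _)); apply: ler_wpM2l; first exact: norm1_ge0.
  exact: act_trap_twist.
Qed.

End trapezoid.

(** * Isolated bad frequencies *)

Section isolated_points.
Context {R : realType}.
Notation mu := (@lebesgue_measure R).
Implicit Types (f g h : R -> R[i]) (Psi : nat -> R -> R[i]).

(** Windows commute with the action of f, and that action preserves null sequences. *)
Lemma good_actS f Psi M s : intC f -> (forall n, bdmeas M (Psi n)) ->
  good Psi s -> good (actS f Psi) s.
Proof.
move=> fi bP [d d0 Hd]; exists d => // c eta e0 ce.
have iF := intC_fejer c e0.
apply: (@eq_null _ _ (actS f (actS (fejer c eta) Psi))).
  by move=> n r; exact: (act_comm r iF fi (bP n)).
have [[M' bP'] _] := nice_act0 iF bP.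
exact: (null_act fi bP' (Hd c eta e0 ce)).
Qed.

Lemma good_supp f Psi M s (d : R) : intC f -> (forall n, bdmeas M (Psi n)) ->
  0 < d -> (forall x, `|x - s| < d -> fhat f x = 0) -> good (actS f Psi) s.
Proof.
move=> fi bP d0 f0; exists d => // c eta e0 ce; apply: null0 => n r.
have iF := intC_fejer c e0.
rewrite /actS (act_comm r iF fi (bP n)).
apply: (act_window0 r e0 fi (bP n)) => x xc; apply: f0.
have := ler_distD c x s; lra.
Qed.

Lemma goodB Psi Phi M M' s : (forall n, bdmeas M (Psi n)) ->
  (forall n, bdmeas M' (Phi n)) -> good Psi s -> good Phi s ->
  good (fun n r => Psi n r - Phi n r) s.
Proof.
move=> bP bP' [d1 d10 H1] [d2 d20 H2].
exists (Num.min d1 d2); first by rewrite lt_min d10.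
move=> c eta e0; rewrite lt_min => /andP[h1 h2].
apply: (eq_null _ (nullB (H1 c eta e0 h1) (H2 c eta e0 h2))) => n r.
exact: (actB r (intC_fejer c e0) (bP n) (bP' n)).
Qed.

(** Fix a window near s0 and remove from the smoothed sequence its trapezoidal part at s0. All
    frequencies are good for the remainder, which is therefore null by [all_good_null]; the removed
    part is as small as desired by [act_trap_small], since [fhat f s0] is 0. *)
Lemma good_isolated f Psi M s0 (d0 : R) : intC f ->
  (forall n, bdmeas M (Psi n)) -> fhat f s0 = 0 -> 0 < d0 ->
  (forall s, 0 < `|s - s0| -> `|s - s0| < d0 -> good (actS f Psi) s) ->
  good (actS f Psi) s0.
Proof.
move=> fi bP f0 d00 gU; exists d0 => // c eta e0 ce.
have M0 := bdmeas_ge0 (bP 0%N).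
have iF := intC_fejer c e0.
pose Phi := actS f Psi.
have nPhi : nice Phi by exact: (nice_act0 fi bP).
have nFPhi : nice (actS (fejer c eta) Phi) by exact: nice_act.
have [[M1 bPhi] _] := nPhi; have [[M2 bFPhi] _] := nFPhi.
have key (d : R) : 0 < d -> null (fun n r => actS (fejer c eta) Phi n r -
    actS (trap s0 d) (actS (fejer c eta) Phi) n r).
  move=> dd0; have iV := intC_trap s0 dd0.
  have nV := nice_act iV nFPhi; have [[M3 bV] _] := nV.
  apply: all_good_null; first exact: niceB.
  move=> s; have [->|ss0] := eqVneq s s0.
    (* At s0 itself the remainder is killed exactly by windows inside ]s0 - d, s0 + d[, where the
       trapezoid equals 1. *)
    exists d => // c' eta' e0' ce'; apply: null0 => n r.
    have iF' := intC_fejer c' e0'.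
    rewrite /actS (actB r iF' (bFPhi n) (bV n)).
    have hV x : `|x - c'| < eta' -> fhat (trap s0 d) x = 1.
      by move=> xc; apply: fhat_trap => //; have := ler_distD c' x s0; lra.
    have E := act_comm r iF' iV (bFPhi n).
    rewrite (act_window1 r e0' iV (bFPhi n) hV) in E.
    by apply/eqP; rewrite subr_eq0 eq_sym; apply/eqP; exact: E.
  have ss00 : 0 < `|s - s0| by rewrite normr_gt0 subr_eq0.
  have gF : good (actS (fejer c eta) Phi) s.
    have [sd|ds] := ltP `|s - s0| d0.
      by apply: (good_actS iF bPhi); exact: gU.
    (* Frequencies at distance at least d0 from s0 lie outside the support of the window
       [fejer c eta], by at least this margin. *)
    have d1 : 0 < d0 - (`|c - s0| + eta) by lra.
    apply: (good_supp iF bPhi d1) => x xs.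
    rewrite fhat_fejer// win_out//.
    have := ler_distD x s s0; have := ler_distD c x s0; rewrite [`|s - x|]distrC.
    lra.
  exact: (goodB bFPhi bV gF (good_actS iV bFPhi gF)).
move=> r; apply/cvg0P; first by move=> n; exact: norm1_ge0.
move=> e ee0; have e2 : 0 < e / 2 by lra.
pose m := norm1_mass (fejer c eta).
have m0 : 0 <= m by exact: norm1_mass_ge0.
have e3 : 0 < e / 2 / (m + 1) by rewrite divr_gt0//; lra.
have [d dd0 Hd] := act_trap_small M0 fi f0 e3.
have iV := intC_trap s0 dd0.
pose Th := (fun n r => actS (fejer c eta) Phi n r -
    actS (trap s0 d) (actS (fejer c eta) Phi) n r).
have p0 n : 0 <= norm1 (Th n r) by exact: norm1_ge0.
have [N HN] := (cvg0P p0).1 (key d dd0 r) _ e2; exists N => n Nn.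
have H1 := HN n Nn.
(* The two kernels are exchanged so that the trapezoid meets f directly; the window then costs at
   most its mass m, whence the divisor m + 1 in [e3]. *)
have H2 : norm1 (actS (trap s0 d) (actS (fejer c eta) Phi) n r) <= e / 2.
  rewrite /actS (act_comm r iV iF (bPhi n)).
  have bb : bdmeas (e / 2 / (m + 1)) (act (trap s0 d) (act f (Psi n))).
    split.
      have [[M4 bV] _] := nice_act iV nPhi; exact: (bV n).1.
    by move=> t; rewrite (act_comm t iV fi (bP n)); exact: Hd.
  apply: (le_trans (norm1_act r iF bb)); rewrite -/m.
  by rewrite mulrAC ler_pdivrMr; lra.
apply: (le_trans (norm1_sub (actS (fejer c eta) Phi n r)
  (actS (trap s0 d) (actS (fejer c eta) Phi) n r))).
by rewrite [leRHS]splitr; exact: lerD H2 H1.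
Qed.

End isolated_points.

Section Nrm.
Context {R : realType}.

Lemma NrmK (X : normedZmodType R[i]) (x : X) : (Nrm x)%:C = `|x|.
Proof.
rewrite /Nrm; apply/RRe_real; exact: normr_real.
Qed.

Lemma Nrm_ge0 (X : normedZmodType R[i]) (x : X) : 0 <= Nrm x.
Proof. by have := normr_ge0 x; rewrite -NrmK lecE /= => /andP[]. Qed.

Lemma NrmD (X : normedZmodType R[i]) (x y : X) : Nrm (x + y) <= Nrm x + Nrm y.
Proof.
have := ler_normD x y; rewrite -!NrmK -rmorphD lecE /=.
by move=> /andP[].
Qed.

Lemma NrmN (X : normedZmodType R[i]) (x : X) : Nrm (- x) = Nrm x.
Proof. by rewrite /Nrm normrN. Qed.

Lemma NrmB (X : normedZmodType R[i]) (x y : X) : Nrm (x - y) <= Nrm x + Nrm y.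
Proof. by rewrite -(NrmN y); exact: NrmD. Qed.

Lemma Nrm0 (X : normedZmodType R[i]) : Nrm (0 : X) = 0.
Proof. by rewrite /Nrm normr0. Qed.

Lemma Nrm_eq0 (X : normedZmodType R[i]) (x : X) : Nrm x = 0 -> x = 0.
Proof. by move=> x0; apply/eqP; rewrite -normr_eq0 -NrmK x0. Qed.

Lemma NrmZ (X : normedModType R[i]) (a : R[i]) (x : X) :
  Nrm (a *: x) = Nrm a * Nrm x.
Proof.
apply: complexI; rewrite NrmK normrZ -(NrmK a) -(NrmK x).
by rewrite -rmorphM.
Qed.

Lemma Nrm_real (x : R) : Nrm (x%:C : R[i]) = `|x|.
Proof. by rewrite NrmE /= expr0n /= addr0 sqrtr_sqr. Qed.

Lemma Nrm_expi (x : R) : Nrm (expi x) = 1.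
Proof. by rewrite NrmE /= cos2Dsin2 sqrtr1. Qed.

Lemma cvg_NrmP (X : normedModType R[i]) (T : Type) (F : set_system T)
    (FF : Filter F) (f : T -> X) (l : X) :
  f @ F --> l <-> forall e : R, 0 < e -> \forall t \near F, Nrm (l - f t) < e.
Proof.
split=> [/cvgrPdist_lt H e e0|H].
  have /H : 0 < e%:C by rewrite ltcE /= eqxx.
  by apply: filterS => t; rewrite -NrmK ltcE /= => /andP[].
apply/cvgrPdist_lt => e; rewrite ltcE /= => /andP[/eqP e1 e2].
have := H _ e2; apply: filterS => t tl.
by rewrite -NrmK ltcE /= e1 eqxx.
Qed.

Lemma cvg_complex (T : Type) (F : set_system T) (FF : Filter F)
    (f : T -> R[i]^o) (l : R[i]^o) :
  complex.Re (f t) @[t --> F] --> complex.Re l ->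
  complex.Im (f t) @[t --> F] --> complex.Im l -> f @ F --> l.
Proof.
move=> /cvgrPdist_lt H1 /cvgrPdist_lt H2; apply/cvg_NrmP => e e0.
have e2 : 0 < e / 2 by lra.
apply: filterS (filterI (H1 _ e2) (H2 _ e2)) => t [h1 h2].
apply: (@le_lt_trans _ _ (norm1 (l - f t))).
  exact: (Nrm_le_norm1 (l - f t)).
by rewrite /norm1 cReD cImD cReN cImN; lra.
Qed.

End Nrm.

(** * The dual group of R *)

Section dual.
Context {R : realType}.
Notation mu := (@lebesgue_measure R).

Definition expi_curry (s : R) : {compact-open, R -> R[i]^o} := fun t => expi (s * t).

Lemma continuous_expi_mul : continuous (fun z : R * R => expi (z.1 * z.2) : R[i]^o).
Proof.
have cm : continuous (fun z : R * R => z.1 * z.2).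
  by move=> z; apply: cvgM; [exact: cvg_fst|exact: cvg_snd].
move=> z; apply: cvg_complex => /=.
  by apply: (continuous_comp (cm z)); exact: continuous_cos.
by apply: (continuous_comp (cm z)); exact: continuous_sin.
Qed.

Lemma continuous_expi_curry : continuous expi_curry.
Proof. exact: (continuous_curry_fun continuous_expi_mul). Qed.

Lemma continuous_expi1 (s : R) : continuous (expi_curry s : R -> R[i]^o).
Proof. exact: ((continuous_curry continuous_expi_mul).2 s). Qed.

Lemma is_character_expi (s : R) : is_character (expi_curry s : R -> R[i]^o).
Proof.
split; first exact: continuous_expi1.
  by move=> t; exact: (Nrm_expi (s * t)).
by move=> x y; rewrite /expi_curry mulrDr expiD.
Qed.

Definition chr (s : R) : @dual R := exist _ (expi_curry s) (mem_set (is_character_expi s)).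

Lemma character_chr s t : character (chr s) t = expi (s * t).
Proof. by []. Qed.

Lemma continuous_chr : continuous chr.
Proof.
apply: (@continuous_comp_initial _ _ _ set_val chr).
exact: continuous_expi_curry.
Qed.

Lemma chrP (gamma : dual) s : (forall t, character gamma t = expi (s * t)) ->
  gamma = chr s.
Proof.
case: gamma => g gc H; apply/val_inj => /=; apply/funext => t.
exact: H.
Qed.

Lemma expiDpi (x : R) : expi (x + pi) = - expi x.
Proof. by rewrite /expi cosDpi sinDpi. Qed.

(** At the time pi / (s - s') the two phases differ by pi, so the characters are as far apart as
    possible. This gives both injectivity of [chr] and continuity of its inverse. *)
Lemma expi_opposite (s s' : R) : s != s' ->
  expi (s * (pi / (s - s'))) = - expi (s' * (pi / (s - s'))).
Proof.
move=> ss'; rewrite -expiDpi; congr expi.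
by field; rewrite subr_eq0.
Qed.

Lemma expi_neq0 (x : R) : expi x != 0.
Proof.
apply/eqP => h; have := Nrm_expi x; rewrite h => /eqP.
by rewrite Nrm_real normr0 eq_sym oner_eq0.
Qed.

Lemma chr_inj : injective chr.
Proof.
move=> s s' h; apply/eqP; apply/negPn/negP => ss'.
have := expi_opposite ss'; rewrite -!character_chr h => /eqP.
by rewrite -addr_eq0 -mulr2n mulrn_eq0/= (negbTE (expi_neq0 _)).
Qed.

(** If |s - s0| >= d, the two characters are opposite at a time in [-pi/d, pi/d], hence at distance
    2 there. A compact-open neighbourhood enforcing distance less than 1 on this compact interval
    excludes such s. *)
Lemma nbhs_chr (s0 d : R) : 0 < d ->
  nbhs (chr s0) [set gamma : dual | forall s, gamma = chr s -> `|s - s0| < d].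
Proof.
move=> d0.
pose T : R := pi / d.
pose F := nbhs (expi_curry s0 : {compact-open, R -> R[i]^o}).
have FF : Filter F by exact: nbhs_filter.
have cF : {compact-open, F --> expi_curry s0} by [].
have cU : {family compact, F --> expi_curry s0}.
  by apply/compact_open_fam_compactP => //; exact: (@continuous_expi1 s0).
have uF : {uniform `[- T, T], F --> expi_curry s0}.
  by move/fam_cvgP : cU; apply; exact: segment_compact.
pose S : set (R -> R[i]^o) := [set g | forall t, (`[- T, T]%classic : set R) t ->
    Nrm (expi_curry s0 t - g t) < 1].
have FS : F S.
  apply: uF.
  apply/uniform_nbhs; exists [set xy : R[i]^o * R[i]^o | Nrm (xy.1 - xy.2) < 1].
  split; last by move=> g.
  rewrite -entourage_ballE; exists 1 => //.
    by rewrite /= ltcE /= eqxx ltr01.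
  by move=> [x y] /=; rewrite /ball /= -NrmK ltcE /= => /andP[_].
have cv : continuous (set_val : dual -> {compact-open, R -> R[i]^o}).
  exact: initial_continuous.
have H : nbhs (chr s0) (set_val @^-1` S) by exact: (cv (chr s0) S FS).
apply: (filterS _ H) => gamma Sg s gs; rewrite ltNge; apply/negP => ds.
have ss0 : s != s0.
  by apply: contraTneq ds => ->; rewrite subrr normr0 -ltNge.
have s0' : 0 < `|s - s0| by exact: lt_le_trans ds.
have sT : (`[- T, T]%classic : set R) (pi / (s - s0)).
  rewrite /= in_itv /= -ler_norml normrM normfV (gtr0_norm (pi_gt0 R)).
  by rewrite ler_pM2l ?pi_gt0 // lef_pV2 // posrE.
have := Sg _ sT.
have -> : set_val gamma = expi_curry s by rewrite gs.
have -> : (expi_curry s (pi / (s - s0))) = - (expi_curry s0 (pi / (s - s0))).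
  exact: expi_opposite.
rewrite opprK -mulr2n -scaler_nat NrmZ.
have -> : Nrm (2 : R[i]) = 2 by rewrite -(rmorph_nat (real_complex R)) Nrm_real normr_nat.
have -> : Nrm (expi_curry s0 (pi / (s - s0))) = 1 by exact: Nrm_expi.
by rewrite mulr1 ltNge ler1n.
Qed.

Lemma fourier_chr f s : fourier f (chr s) = fhat f s.
Proof. by []. Qed.

Lemma chr_supp f s : (forall d : R, 0 < d -> exists2 x, `|x - s| < d & fhat f x != 0) ->
  supp (fourier f) (chr s).
Proof.
move=> H U /continuous_chr; rewrite nbhs_filterE => /nbhs_ballP [d d0 Hd].
have [x xs fx] := H d d0; exists (chr x); split => //=.
by apply: Hd; rewrite /ball /= distrC.
Qed.

(** The image of B under [chr] is perfect: closed because F is closed and [nbhs_chr] brings openness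
    of the complement of B to the dual, and free of isolated points because [chr] is continuous and
    injective. *)
Lemma residual_set0 (B : set R) (F : set dual) : residual F ->
  (forall s, B s -> F (chr s)) -> (forall gamma, F gamma -> exists s, gamma = chr s) ->
  (forall s, ~ B s -> exists2 d : R, 0 < d & forall s', `|s' - s| < d -> ~ B s') ->
  (forall s, B s -> forall d : R, 0 < d ->
     exists s', [/\ B s', 0 < `|s' - s| & `|s' - s| < d]) ->
  B = set0.
Proof.
move=> [cF rF] BF Fchr cB nB.
pose P : set dual := [set gamma | exists2 s, B s & gamma = chr s].
have PF : P `<=` F by move=> _ [s Bs ->]; exact: BF.
have cP : closed P.
  move=> gamma cg; have /cF /Fchr [s0 gs0] : closure F gamma.
    by apply: closureS cg.
  exists s0 => //; apply: contrapT => /cB [d d0 Hd].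
  have := cg; rewrite gs0 => /(_ _ (nbhs_chr s0 d0)) [g [[s Bs gs] Hg]].
  by apply: (Hd s) => //; exact: Hg.
have : P = set0.
  apply: rF => //; split => //; apply/seteqP; split.
    by move=> gamma /subset_limit_point; exact: cP.
  move=> _ [s Bs ->] U /continuous_chr; rewrite nbhs_filterE => /nbhs_ballP [d d0 Hd].
  have [s' [Bs' s's s'd]] := nB s Bs d d0.
  exists (chr s'); split.
  - apply/eqP => /chr_inj ss'; move: s's; rewrite ss' subrr normr0 ltxx//.
  - by exists s'.
  - by apply: Hd; rewrite /ball /= distrC.
by move=> P0; apply/seteqP; split => // s Bs; have : P (chr s) by [exists s|]; rewrite P0.
Qed.

End dual.

(** * Functionals and resolvents *)

Section hahn_banach.
Context {R : realType} {X : normedModType R[i]}.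
Implicit Types (G : set (X * R)) (x y : X).

(** Partial real functionals are handled as graphs, so that an upper bound for Zorn's lemma is a
    plain union. Single-valuedness follows from domination: see [dominated_graph_fun]. *)
Definition dominated_graph G :=
  (forall p q (c : R), G p -> G q -> G (p.1 + c%:C *: q.1, p.2 + c * q.2)) /\
  (forall p, G p -> p.2 <= Nrm p.1).

Lemma dominated_graph0 G p : dominated_graph G -> G p -> G (0, 0).
Proof.
move=> [lG _] Gp; have := lG p p (-1) Gp Gp.
by rewrite rmorphN rmorph1 scaleN1r subrr mulN1r subrr.
Qed.

Lemma dominated_graphZ G p (c : R) : dominated_graph G -> G p ->
  G (c%:C *: p.1, c * p.2).
Proof.
move=> dG Gp; have G0 := dominated_graph0 dG Gp.
by have := dG.1 _ _ c G0 Gp; rewrite !add0r.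
Qed.

Lemma dominated_graph_fun G x (a b : R) : dominated_graph G ->
  G (x, a) -> G (x, b) -> a = b.
Proof.
move=> dG; have le (a' b' : R) : G (x, a') -> G (x, b') -> a' <= b'.
  move=> Ga Gb; have /dG.2 := dG.1 _ _ (-1) Ga Gb.
  by rewrite /= rmorphN rmorph1 scaleN1r subrr Nrm0 mulN1r subr_le0.
by move=> Ga Gb; apply/eqP; rewrite eq_le !le.
Qed.

Lemma dominated_extension G p0 x : dominated_graph G -> G p0 ->
  exists2 G', dominated_graph G' & G `<=` G' /\ exists a, G' (x, a).
Proof.
move=> dG Gp0.
have G0 := dominated_graph0 dG Gp0.
pose E : set R := [set p.2 - Nrm (p.1 - x) | p in G].
have ub q : G q -> ubound E (Nrm (q.1 + x) - q.2).
  move=> Gq _ [p Gp <-]; rewrite lerBlDr addrAC lerBrDr.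
  have := dG.2 _ (dG.1 _ _ 1 Gp Gq); rewrite /= rmorph1 scale1r mul1r.
  move=> /le_trans; apply; rewrite [p.1 + _]addrC.
  have -> : q.1 + p.1 = (q.1 + x) + (p.1 - x) by rewrite addrACA subrr addr0.
  exact: NrmD.
have hE : has_sup E.
  split; first by exists (p0.2 - Nrm (p0.1 - x)), p0.
  by exists (Nrm (p0.1 + x) - p0.2); exact: ub.
(* The value assigned to x. Any number between the bounds [cl] and [cr] would do; the triangle
   inequality makes these compatible. *)
pose c := sup E.
have cl p : G p -> p.2 - Nrm (p.1 - x) <= c.
  by move=> Gp; apply: sup_upper_bound => //; exists p.
have cr p : G p -> c <= Nrm (p.1 + x) - p.2.
  by move=> Gp; apply: ge_sup; [case: hE|exact: ub].
exists [set q | exists p t, [/\ G p, q.1 = p.1 + t%:C *: x & q.2 = p.2 + t * c]].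
  split.
    move=> _ _ d [p [t [Gp -> ->]]] [q [s [Gq -> ->]]].
    exists (p.1 + d%:C *: q.1, p.2 + d * q.2), (t + d * s); split => /=.
    - exact: dG.1.
    - by rewrite rmorphD rmorphM scalerDr scalerDl scalerA addrACA.
    - by rewrite mulrDr mulrDl mulrA addrACA.
  move=> _ [p [t [Gp -> ->]]].
  (* Dividing by t, or by -t when t < 0, reduces domination at p + t x to [cr], respectively [cl],
     at the rescaled point. *)
  have [t0|t0|->] := ltgtP t 0; last first.
  - by rewrite rmorph0 scale0r mul0r !addr0; exact: dG.2.
  - have := cr _ (dominated_graphZ t^-1 dG Gp); rewrite -(ler_pM2l t0) /= => H.
    have := H; rewrite mulrBr mulrA divff ?gt_eqF// mul1r lerBrDr addrC.
    move=> /le_trans; apply.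
    rewrite -[X in X * _](gtr0_norm t0) -Nrm_real -NrmZ scalerDr scalerA.
    by rewrite -rmorphM divff ?gt_eqF// rmorph1 scale1r.
  - have s0 : 0 < - t by rewrite oppr_gt0.
    have := cl _ (dominated_graphZ (- t)^-1 dG Gp); rewrite -(ler_pM2l s0) /= => H.
    have := H; rewrite mulrBr mulrA divff ?gt_eqF// mul1r lerBlDr mulNr addrC -lerBlDr opprK.
    move=> /le_trans; apply.
    rewrite -[X in X * _](gtr0_norm s0) -Nrm_real -NrmZ scalerBr scalerA.
    by rewrite -rmorphM divff ?gt_eqF// rmorph1 scale1r rmorphN scaleNr opprK.
split; first by move=> p Gp; exists p, 0; rewrite rmorph0 scale0r mul0r !addr0.
by exists c, (0, 0), 1; rewrite rmorph1 scale1r mul1r !add0r.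
Qed.

Lemma real_hahn_banach y0 : exists g : X -> R,
  [/\ (forall x y, g (x + y) = g x + g y),
      (forall (c : R) x, g (c%:C *: x) = c * g x),
      (forall x, g x <= Nrm x) & g y0 = Nrm y0].
Proof.
(* The empty graph must qualify, since it is the union of the empty chain; hence the value at y0 is
   imposed on nonempty graphs. *)
pose P G := dominated_graph G /\ (G !=set0 -> G (y0, Nrm y0)).
have PU (F : set (set (X * R))) : F `<=` P -> total_on F subset ->
    P (\bigcup_(Y in F) Y).
  move=> FP tF; split; first split.
  - move=> p q c [Y FY Yp] [Z FZ Zq].
    have [YZ|ZY] := tF _ _ FY FZ.
      by exists Z => //; apply: (FP _ FZ).1.1 => //; exact: YZ.
    by exists Y => //; apply: (FP _ FY).1.1 => //; exact: ZY.
  - by move=> p [Y FY Yp]; exact: (FP _ FY).1.2.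
  - by move=> [p [Y FY Yp]]; exists Y => //; apply: (FP _ FY).2; exists p.
have [G [PG maxG]] := Zorn_bigcup PU.
pose L : set (X * R) := [set p | exists t : R, p = (t%:C *: y0, t * Nrm y0)].
have Ly : L (y0, Nrm y0) by exists 1; rewrite rmorph1 scale1r mul1r.
have PL : P L.
  split=> //; split.
    move=> _ _ c [t ->] [s ->]; exists (t + c * s) => /=.
    by rewrite scalerA -rmorphM -scalerDl -rmorphD mulrDl mulrA.
  move=> _ [t ->] /=; rewrite NrmZ Nrm_real ler_wpM2r ?Nrm_ge0 //.
  exact: ler_norm.
have Gy : G (y0, Nrm y0).
  have [G0|/set0P/PG.2//] := eqVneq G set0.
  by exfalso; apply: (maxG L) => //; rewrite G0; split => // /(_ _ Ly).
have totG x : exists a, G (x, a).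
  have [G' dG' [GG' [a G'a]]] := dominated_extension x PG.1 Gy.
  exists a; apply: contrapT => nG; apply: (maxG G').
    by split => // /(_ _ G'a).
  by split => // _; exact: GG'.
have /choice [g Gg] := totG.
have fG := dominated_graph_fun PG.1.
exists g; split.
- move=> x y; apply: fG (Gg _) _.
  by have := PG.1.1 _ _ 1 (Gg x) (Gg y); rewrite /= rmorph1 scale1r mul1r.
- move=> c x; apply: fG (Gg _) _.
  exact: (dominated_graphZ c PG.1 (Gg x)).
- by move=> x; exact: (PG.1.2 _ (Gg x)).
- exact: fG (Gg _) Gy.
Qed.

(* The real functional [g] is the real part of x |-> g(x) - i g(ix). *)
Lemma hahn_banach y0 : exists l : X -> R[i],
  [/\ (forall x y, l (x + y) = l x + l y),
      (forall (c : R[i]) x, l (c *: x) = c * l x),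
      (forall x, norm1 (l x) <= 2 * Nrm x) & complex.Re (l y0) = Nrm y0].
Proof.
have [g [gD gZ gle gy]] := real_hahn_banach y0.
have gN x : g (- x) = - g x.
  by have := gZ (-1) x; rewrite rmorphN rmorph1 scaleN1r mulN1r.
have gabs x : `|g x| <= Nrm x.
  by rewrite ler_norml gle andbT lerNl -gN -(NrmN x) gle.
have Ni x : Nrm ('i%C *: x) = Nrm x.
  by rewrite NrmZ NrmE /= expr0n expr1n add0r sqrtr1 mul1r.
exists (fun x => g x +i* (- g ('i *: x))); split => //.
- move=> x y; rewrite scalerDr !gD.
  by apply/eqP; rewrite eq_complex /= eqxx opprD eqxx.
- move=> [a b] x.
  have -> : (a +i* b) *: x = a%:C *: x + b%:C *: ('i%C *: x).
    rewrite scalerA -scalerDl; congr (_ *: _).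
    by apply/eqP; rewrite eq_complex /= !(mulr0, mul0r, mulr1, subr0, addr0, add0r) !eqxx.
  have -> : 'i%C *: (a%:C *: x + b%:C *: ('i%C *: x)) = a%:C *: ('i%C *: x) - b%:C *: x.
    rewrite scalerDr !scalerA -[X in _ = _ + X]scaleNr; congr (_ *: _ + _ *: _).
      by rewrite mulrC.
    by apply/eqP; rewrite eq_complex /= !(mulr0, mul0r, mulr1, mul1r, subr0, sub0r, addr0, add0r) oppr0 !eqxx.
  rewrite !gD gN !gZ.
  by apply/eqP; rewrite eq_complex /=; apply/andP; split; apply/eqP; ring.
- move=> x; rewrite /norm1 /= normrN mulr_natl mulr2n lerD //.
  by rewrite -(Ni x).
Qed.

End hahn_banach.

Section operators.
Context {R : realType} {X : completeNormedModType R[i]}.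
Implicit Types (x y z : X) (L : {linear X -> X}).

Lemma opnorm_le L (M : R) x : (opnorm L <= M%:E)%E -> Nrm (L x) <= M * Nrm x.
Proof.
move=> LM; have [x0|x0] := eqVneq (Nrm x) 0.
  by rewrite (Nrm_eq0 x0) linear0 Nrm0 mulr0.
have x1 : 0 < Nrm x by rewrite lt_neqAle eq_sym x0 Nrm_ge0.
have : ((Nrm (L ((Nrm x)^-1%:C *: x)))%:E <= opnorm L)%E.
  apply: ereal_sup_ubound; exists ((Nrm x)^-1%:C *: x) => //=.
  by rewrite NrmZ Nrm_real ger0_norm ?invr_ge0 ?Nrm_ge0// mulVf.
move=> /le_trans /(_ LM); rewrite lee_fin linearZ NrmZ Nrm_real.
rewrite ger0_norm ?invr_ge0 ?Nrm_ge0// mulrC.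
by rewrite ler_pdivrMr.
Qed.

Lemma opnorm_lty L : (opnorm L < +oo)%E ->
  exists2 M : R, 0 < M & forall x, Nrm (L x) <= M * Nrm x.
Proof.
move=> Lfin; have L0 : (0 <= opnorm L)%E.
  apply: ereal_sup_ubound; exists 0 => /=; first by rewrite Nrm0.
  by rewrite linear0 Nrm0.
have fL : opnorm L \is a fin_num by rewrite ge0_fin_numE.
exists (fine (opnorm L) + 1); first by rewrite ltr_wpDl// fine_ge0.
move=> x; apply: opnorm_le; rewrite EFinD fineK//.
by rewrite leeDl// lee_fin.
Qed.

Lemma half_contraction_fixpoint (F : X -> X) :
  (forall x y, Nrm (F x - F y) <= 2^-1 * Nrm (x - y)) -> exists y, F y = y.
Proof.
(* Since |F y| <= |y| / 2 + |F 0|, the iterates stay in the ball of radius 2 |F 0|. *)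
move=> FF; pose y n := iter n F 0; pose C := 2 * Nrm (F 0).
have C0 : 0 <= C by rewrite mulr_ge0 ?Nrm_ge0.
have y0 m : Nrm (y m) <= C.
  elim: m => [|m IH]; first by rewrite Nrm0.
  have -> : y m.+1 = (F (y m) - F 0) + F 0 by rewrite subrK.
  have := NrmD (F (y m) - F 0) (F 0); have := FF (y m) 0.
  by rewrite subr0 /C in IH *; lra.
have ym n m : Nrm (y (n + m)%N - y n) <= 2^-1 ^+ n * C.
  elim: n => [|n IH]; first by rewrite subr0 expr0 mul1r.
  apply: (le_trans (FF _ _)); rewrite exprS -mulrA ler_pM2l//.
have small (e : R) : 0 < e -> exists n, 2^-1 ^+ n * C < e.
  move=> e0; have c : (2^-1 ^+ n * C : R) @[n --> \oo] --> 0.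
    rewrite -(mul0r C); apply: cvgM; last exact: cvg_cst.
    by apply: cvg_expr; rewrite ger0_norm//; lra.
  have /cvgrPdist_lt/(_ _ e0)[n _ /(_ n (leqnn _)) H] := c.
  exists n; apply: le_lt_trans H; rewrite sub0r normrN; exact: ler_norm.
have cy : cauchy (y n @[n --> \oo]).
  apply: cauchy_exP => e; rewrite ltcE /= => /andP[/eqP e1 e2].
  have [n Hn] := small _ e2; exists (y n); exists n => // k /= nk.
  rewrite -ball_normE /= -NrmK ltcE /= e1 eqxx /= -NrmN opprB.
  by apply: le_lt_trans Hn; rewrite -(subnKC nk).
have /cvg_ex [l yl] : cvg (y n @[n --> \oo]) by exact: cauchy_cvg.
exists l; apply/eqP; rewrite -subr_eq0; apply/eqP; apply: Nrm_eq0.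
apply/eqP; rewrite eq_le Nrm_ge0 andbT; apply/ler_addgt0Pr => e e0; rewrite add0r.
have e2 : 0 < e / 2 by lra.
have [n _ Hn] := (cvg_NrmP _ _ _).1 yl _ e2.
have h1 := Hn n (leqnn _); have h2 := Hn n.+1 (leqnSn _).
have -> : F l - l = (F l - F (y n)) - (l - y n.+1).
  by rewrite opprB addrA subrK.
have := NrmB (F l - F (y n)) (l - y n.+1); have := FF l (y n).
rewrite /= in h1 h2; lra.
Qed.

(* The solution of (lambda - A) y = x for lambda near lambda0 is the fixed
   point of y |-> Q (x - (lambda - lambda0) y), Q = (lambda0 - A)^-1. *)
Lemma resolvent_near (A : set (X * X)) (lambda0 : R[i]) :
  resolvent_set A lambda0 ->
  exists2 d : R, 0 < d & exists2 C : R, 0 < C &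
    forall lambda : R[i], Nrm (lambda - lambda0) < d -> forall x,
      exists2 y, A (y, lambda *: y - x) & Nrm y <= C * Nrm x.
Proof.
move=> [Q [Qfin _ Qr]]; have [M M0 QM] := opnorm_lty Qfin.
(* With |lambda - lambda0| < 1 / (2 M) the map is a contraction of factor 1/2, and |y| <= M |x| +
   |y| / 2 gives the constant 2 M. *)
exists (2 * M)^-1; first by rewrite invr_gt0 mulr_gt0.
exists (2 * M); first by rewrite mulr_gt0.
move=> lambda lM x; pose F y := Q (x - (lambda - lambda0) *: y).
have half y : M * Nrm ((lambda - lambda0) *: y) <= 2^-1 * Nrm y.
  rewrite NrmZ mulrA ler_wpM2r ?Nrm_ge0//.
  have -> : 2^-1 = M * (2 * M)^-1 by rewrite invfM mulrCA divff ?gt_eqF// mulr1.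
  by rewrite ler_pM2l// ltW.
have [y Fy] : exists y, F y = y.
  apply: half_contraction_fixpoint => y z; rewrite -linearB.
  apply: (le_trans (QM _)); rewrite opprB addrC addrA subrK -scalerBr.
  by rewrite -NrmN -scalerN opprB.
exists y.
  have [z Az Qz] := Qr (x - (lambda - lambda0) *: y).
  rewrite -/(F y) Fy in Az Qz.
  suff -> : lambda *: y - x = z by [].
  have -> : z = lambda0 *: y - (x - (lambda - lambda0) *: y).
    by rewrite -Qz opprB addrC subrK.
  by rewrite opprB scalerBl addrA [lambda0 *: y + _]addrC subrK.
have := QM (x - (lambda - lambda0) *: y); rewrite -/(F y) Fy.
have := NrmB x ((lambda - lambda0) *: y); rewrite -(ler_pM2l M0) mulrDr.
have := half y; lra.
Qed.

End operators.

Section real_derivative.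
Context {R : realType}.

Lemma is_derive_quotient (f : R -> R) (t l : R) :
  (forall e : R, 0 < e -> exists2 d : R, 0 < d & forall s, 0 < `|s - t| < d ->
     `|(s - t)^-1 * (f s - f t) - l| <= e) ->
  is_derive t (1 : R) f l.
Proof.
move=> H.
have c : h^-1 *: ((f \o shift t) (h *: (1 : R)) - f t) @[h --> (0 : R)^'] --> l.
  apply/cvgrPdist_le => e e0; have [d d0 Hd] := H e e0.
  exists d => //= h; rewrite /= sub0r normrN => hd h0.
  have := Hd (h + t); rewrite addrK normr_gt0 h0 hd => /(_ isT).
  by rewrite distrC; have -> : h *: (1 : R) = h by exact: mulr1.
split; first by apply/cvg_ex; exists l.
exact: (cvg_lim _ c).
Qed.

Lemma is_cderive_quotient (f : R -> R[i]) (t : R) (l : R[i]) :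
  (forall e : R, 0 < e -> exists2 d : R, 0 < d & forall s, 0 < `|s - t| < d ->
     norm1 ((s - t)^-1%:C * (f s - f t) - l) <= e) ->
  is_cderive f t l.
Proof.
move=> H; split; apply: is_derive_quotient => e e0; have [d d0 Hd] := H e e0;
  exists d => // s sd; apply: le_trans (Hd s sd); rewrite /norm1.
  by rewrite cReD cReN cReM cReD cReN /= mul0r subr0 lerDl.
by rewrite !(cImD, cImN) cImM cImD cImN /= mul0r addr0 lerDr.
Qed.

Lemma ccontinuous_at_dist (f : R -> R[i]) (t : R) :
  (forall e : R, 0 < e -> exists2 d : R, 0 < d & forall s, `|s - t| < d ->
     norm1 (f s - f t) <= e) ->
  ccontinuous_at f t.
Proof.
move=> H; split; apply/cvgrPdist_le => e e0; have [d d0 Hd] := H e e0;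
  exists d => // s /=; rewrite distrC => sd; rewrite distrC; apply: le_trans (Hd s sd);
  rewrite /norm1.
  by rewrite cReD cReN lerDl.
by rewrite cImD cImN lerDr.
Qed.

End real_derivative.

(** * Orbits of the semigroup *)

Section orbits.
Context {R : realType} {X : completeNormedModType R[i]}.
Variables (T : R -> {linear X -> X}) (u : R -> R).
Hypothesis hT : is_C0_semigroup T.
Hypothesis cu : continuous u.
Hypothesis hTu : forall t : R, 0 <= t -> (opnorm (T t) <= (u t)%:E)%E.

Lemma semigroup_le t x : 0 <= t -> Nrm (T t x) <= u t * Nrm x.
Proof. by move=> t0; apply: opnorm_le; exact: hTu. Qed.

Lemma semigroup_bound_ge0 t : 0 <= t -> 0 <= u t.
Proof.
move=> t0; rewrite -lee_fin; apply: le_trans (hTu t0).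
by apply: ereal_sup_ubound; exists 0 => /=; rewrite ?linear0 ?Nrm0.
Qed.

Lemma semigroup_bound (b : R) : exists2 K : R, 0 < K &
  forall t x, 0 <= t <= b -> Nrm (T t x) <= K * Nrm x.
Proof.
have [b0|b0] := leP 0 b; last first.
  by exists 1 => // t x /andP[t0 tb]; have := le_lt_trans (le_trans t0 tb) b0; rewrite ltxx.
have [|c _ Hc] := @EVT_max R u 0 b b0.
  by apply: continuous_subspaceT => t; exact: cu.
exists (`|u c| + 1); first by rewrite ltr_wpDl.
move=> t x /andP[t0 tb]; apply: (le_trans (semigroup_le x t0)).
apply: ler_wpM2r; first exact: Nrm_ge0.
apply: (@le_trans _ _ `|u c|); last by rewrite lerDl.
by apply: le_trans (ler_norm _); apply: Hc; rewrite in_itv /= t0 tb.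
Qed.

(** For s < t the difference is T(s) applied to x - T(t - s) x, so right continuity at 0 and the
    bound on [0, b] give continuity on both sides, uniformly in the base point. *)
Lemma orbit_uniformly_continuous (b e : R) x : 0 < e ->
  exists2 d : R, 0 < d & forall s t, 0 <= s <= b -> 0 <= t <= b ->
    `|s - t| < d -> Nrm (T s x - T t x) <= e.
Proof.
move=> e0; have [K K0 HK] := semigroup_bound b.
have eK : 0 < e / K by rewrite divr_gt0.
have [d /= d0 Hd] := (cvg_NrmP _ _ _).1 (@semigroup_cvg0 _ _ _ hT x) _ eK.
have H s t : 0 <= s <= b -> s < t -> t < s + d -> Nrm (T s x - T t x) <= e.
  move=> sb st td; have s0 : 0 <= s by case/andP : sb.
  have -> : T t x = T s (T (t - s) x).
    by rewrite -semigroupD ?subrKC// subr_ge0 ltW.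
  rewrite -linearB; apply: (le_trans (HK _ _ sb)).
  rewrite -ler_pdivlMl// mulrC; apply: ltW; apply: Hd; last by rewrite subr_gt0.
  by rewrite /= sub0r normrN gtr0_norm ?subr_gt0// ltrBlDl.
exists d => // s t sb tb; have [st|ts|->] := ltgtP s t; last by move=> _; rewrite subrr Nrm0 ltW.
  by rewrite ltr0_norm ?subr_lt0// opprB ltrBlDl; exact: H.
rewrite gtr0_norm ?subr_gt0// ltrBlDl -NrmN opprB; exact: H.
Qed.

(** The generator gives right derivatives, uniformly in the base point. A left quotient at t is a
    right quotient at s < t, and continuity of the orbit of z replaces T(s) z by T(t) z. *)
Lemma orbit_derivative (b e : R) y z : generator T (y, z) -> 0 < e ->
  exists2 d : R, 0 < d & forall s t, 0 <= s <= b -> 0 <= t <= b ->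
    0 < `|s - t| < d ->
    Nrm ((s - t)^-1%:C *: (T s y - T t y) - T t z) <= e.
Proof.
move=> yz e0; have [K K0 HK] := semigroup_bound b.
have e2 : 0 < e / 2 by rewrite divr_gt0.
have eK : 0 < e / 2 / K by rewrite divr_gt0.
have [d1 /= d10 Hd1] := (cvg_NrmP _ _ _).1 yz _ eK.
have [d2 d20 Hd2] := orbit_uniformly_continuous b z e2.
have H s t : 0 <= s <= b -> s < t -> t < s + d1 ->
    Nrm ((t - s)^-1%:C *: (T t y - T s y) - T s z) <= e / 2.
  move=> sb st td; have s0 : 0 <= s by case/andP : sb.
  have -> : T t y = T s (T (t - s) y).
    by rewrite -semigroupD ?subrKC// subr_ge0 ltW.
  rewrite -linearB -linearZ -linearB; apply: (le_trans (HK _ _ sb)).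
  rewrite -ler_pdivlMl// mulrC -NrmN opprB; apply: ltW; apply: Hd1; last by rewrite subr_gt0.
  by rewrite /= sub0r normrN gtr0_norm ?subr_gt0// ltrBlDl.
exists (Num.min d1 d2); first by rewrite lt_min d10.
move=> s t sb tb /andP[st]; rewrite lt_min => /andP[st1 st2].
have [st'|ts|st'] := ltgtP s t; last by move: st; rewrite st' subrr normr0 ltxx.
  have -> : (s - t)^-1%:C *: (T s y - T t y) - T t z =
      ((t - s)^-1%:C *: (T t y - T s y) - T s z) + (T s z - T t z).
    rewrite addrA subrK -(opprB t s) -(opprB (T t y)) invrN rmorphN.
    by rewrite scaleNr scalerN opprK.
  apply: (le_trans (NrmD _ _)); rewrite (splitr e); apply: lerD; last exact: Hd2.
  by apply: H => //; move: st1; rewrite ltr0_norm ?subr_lt0// opprB ltrBlDl.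
apply: (@le_trans _ _ (e / 2)); last by rewrite ler_pdivrMr// ler_pMr// ler1n.
by apply: H => //; move: st1; rewrite gtr0_norm ?subr_gt0// ltrBlDl.
Qed.

Variable l : X -> R[i].
Hypothesis lD : forall x y, l (x + y) = l x + l y.
Hypothesis lZ : forall (c : R[i]) x, l (c *: x) = c * l x.
Hypothesis lle : forall x, norm1 (l x) <= 2 * Nrm x.

Lemma functionalB x y : l (x - y) = l x - l y.
Proof. by rewrite lD -scaleN1r lZ mulN1r. Qed.

Lemma orbit_ccontinuous (tau s : R) x : 0 < tau + s ->
  ccontinuous_at (fun r => l (T (tau + r) x)) s.
Proof.
move=> ts; apply: ccontinuous_at_dist => e e0.
have e2 : 0 < e / 2 by rewrite divr_gt0.
(* For |r - s| < tau + s the time tau + r stays between 0 and 2 (tau + s). *)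
have [d d0 Hd] := orbit_uniformly_continuous (2 * (tau + s)) x e2.
exists (Num.min d (tau + s)); first by rewrite lt_min d0.
move=> r; rewrite lt_min => /andP[rd]; rewrite ltr_norml => /andP[r1 r2].
rewrite -functionalB; apply: (le_trans (lle _)).
rewrite -ler_pdivlMl// mulrC; apply: Hd.
- by apply/andP; split; lra.
- by apply/andP; split; lra.
- by rewrite opprD addrACA subrr add0r.
Qed.

Lemma orbit_cderive (tau s : R) y z : generator T (y, z) -> 0 < tau + s ->
  is_cderive (fun r => l (T (tau + r) y)) s (l (T (tau + s) z)).
Proof.
move=> yz ts; apply: is_cderive_quotient => e e0.
have e2 : 0 < e / 2 by rewrite divr_gt0.
have [d d0 Hd] := orbit_derivative (2 * (tau + s)) yz e2.
exists (Num.min d (tau + s)); first by rewrite lt_min d0.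
move=> r /andP[r0]; rewrite lt_min => /andP[rd]; rewrite ltr_norml => /andP[r1 r2].
rewrite -functionalB -lZ -functionalB; apply: (le_trans (lle _)).
have -> : r - s = (tau + r) - (tau + s) by ring.
rewrite -ler_pdivlMl// mulrC; apply: Hd.
- by apply/andP; split; lra.
- by apply/andP; split; lra.
- by rewrite opprD addrACA subrr add0r r0.
Qed.

(* With theta(r) = l(T(tau + r) y2) and
   (lambda - A)^2 y2 = x, lambda = - i sigma, the function e^(i sigma r) theta(r)
   has second derivative e^(i sigma r) l(T(tau + r) x). *)
Lemma tri_orbit (sigma tau a C D : R) x y1 y2 : 0 < a -> a < tau ->
  generator T (y1, (0 -i* sigma) *: y1 - x) ->
  generator T (y2, (0 -i* sigma) *: y2 - y1) -> Nrm y2 <= C ->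
  u (tau + a) <= D -> u tau <= D -> u (tau - a) <= D ->
  norm1 (Cintegral (fun s => (tri (s / a))%:C *
    (expi (sigma * s) * l (T (tau + s) x)))) <= a^-1 * (16 * C * D).
Proof.
move=> a0 atau g1 g2 y2C uD1 uD2 uD3; have tau0 : 0 < tau by exact: lt_trans atau.
pose th (y : X) (s : R) := l (T (tau + s) y).
have lin s (y z : X) : l (T (tau + s) ((0 -i* sigma) *: y - z)) =
    (0 -i* sigma) * th y s - th z s.
  by rewrite linearB linearZ functionalB lZ.
have [] := @tri_second_differenceC R a tau (fun s => expi (sigma * s) * th y2 s)
  (fun s => - (expi (sigma * s) * th y1 s)) (fun s => expi (sigma * s) * th x s) a0 atau.
- move=> s /andP[s1 s2]; have ts : 0 < tau + s by lra.
  have := is_cderiveM (is_cderive_expi sigma s) (orbit_cderive g2 ts).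
  rewrite lin; congr is_cderive.
  by apply: complexP; rewrite ?(cReM, cImM, cReD, cImD, cReN, cImN) /=; ring.
- move=> s /andP[s1 s2]; have ts : 0 < tau + s by lra.
  have := is_cderiveM (is_cderive_cst (-1) s)
    (is_cderiveM (is_cderive_expi sigma s) (orbit_cderive g1 ts)).
  rewrite lin (_ : (fun s => -1 * _) = (fun s => - (expi (sigma * s) * th y1 s))); last first.
    by apply/funext => r; rewrite mulN1r.
  congr is_cderive.
  by apply: complexP; rewrite ?(cReM, cImM, cReD, cImD, cReN, cImN) /=; ring.
- move=> s /andP[s1 s2]; have ts : 0 < tau + s by lra.
  by apply: ccontinuousM; [exact: ccontinuous_expi|exact: orbit_ccontinuous].
move=> _ ->; rewrite norm1_realM ger0_norm; last by rewrite invr_ge0 ltW.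
rewrite ler_pM2l ?invr_gt0//.
(* The 4 is one 2 from [norm1_expi] and one from [lle]; the second difference counts four such
   values, whence 16. *)
have G s : 0 <= tau + s -> u (tau + s) <= D -> norm1 (expi (sigma * s) * th y2 s) <= 4 * C * D.
  move=> ts usD; apply: (le_trans (norm1M _ _)).
  have -> : 4 * C * D = 2 * (2 * (D * C)) by ring.
  apply: ler_pM; rewrite ?norm1_ge0 ?norm1_expi//.
  apply: (le_trans (lle _)); rewrite ler_pM2l//.
  apply: (le_trans (semigroup_le y2 ts)); apply: ler_pM => //; last exact: Nrm_ge0.
  exact: semigroup_bound_ge0 ts.
apply: (le_trans (norm1D _ _)).
have h3 := G (- a); have h1 := G a; have h2 := G 0.
have : norm1 (expi (sigma * a) * th y2 a - 2 * (expi (sigma * 0) * th y2 0)) <=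
  4 * C * D + 2 * (4 * C * D).
  apply: (le_trans (norm1B _ _)); apply: lerD; first by apply: h1 => //; lra.
  rewrite -(rmorph_nat (real_complex R)) norm1_realM normr_nat ler_pM2l//.
  by apply: h2; rewrite addr0 // ltW.
have := h3 _ _; rewrite subr_ge0 (ltW atau) => /(_ isT uD3).
lra.
Qed.

End orbits.

(** * Goodness from estimates at single frequencies *)

Section smearing.
Context {R : realType}.
Notation mu := (@lebesgue_measure R).
Notation mass := (@fejer_mass R).
Implicit Types (f g h : R -> R[i]) (psi Psi : nat -> R -> R[i]).

(** The kernel is an average of the characters of its window, so a bound uniform over those
    frequencies passes to the pairing, up to the normalisation. *)
Lemma norm1_fejer_pairing c eta g (B : R) : 0 < eta -> intC g ->
  (forall sigma, `|sigma - c| < eta ->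
     norm1 (Cintegral (fun s => g s * expi (sigma * s))) <= B) ->
  norm1 (Cintegral (fun s => g s * fejer c eta s)) <=
    (2 * mass)^-1 * (\int[mu]_s win c eta s * B).
Proof.
move=> e0 ig gB; have m0 := (@fejer_mass_gt0 R).
have m2 : 0 < (2 * mass)^-1 by rewrite invr_gt0 mulr_gt0.
pose K (z : R * R) : R[i] := (win c eta z.1)%:C * g z.2 * expi (z.1 * z.2).
have iK : intC2 K.
  apply: (@intC2_prod R (fun s => (win c eta s)%:C) g
    (fun z => expi (z.1 * z.2)) 2) => //.
  - by apply: intC_real; exact: intR_win.
  - apply: measC_expi; apply: measurable_funM; first exact: measurable_fst.
    exact: measurable_snd.
  - by move=> z; exact: norm1_expi.
have KE : (fun s => g s * fejer c eta s) =
    (fun s => ((2 * mass)^-1)%:C * Cintegral (fun t => K (t, s))).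
  apply/funext => s; have [i e] := fejer_win c s e0.
  have -> : (fun t => K (t, s)) = (fun t => g s * ((win c eta t)%:C * expi (t * s))).
    by apply/funext => t; rewrite /K /=; ring.
  rewrite CintegralZ// e; set F := fejer _ _ _.
  by rewrite [RHS]mulrCA; congr (_ * _); rewrite mulrA mass2K mul1r.
have iKs : intC2 (fun z => K (z.2, z.1)).
  have := @intC2_prod R g (fun s => (win c eta s)%:C)
    (fun z => expi (z.2 * z.1)) 2 ig.
  rewrite (_ : (fun z => g z.1 * _ * _) = (fun z => K (z.2, z.1))); last first.
    by apply/funext => z; rewrite /K /=; ring.
  apply.
  - by apply: intC_real; exact: intR_win.
  - apply: measC_expi; apply: measurable_funM; first exact: measurable_snd.
    exact: measurable_fst.
  - by move=> z; exact: norm1_expi.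
rewrite KE CintegralZ; last exact: (intC_Cintegral iKs).
rewrite norm1_realM ger0_norm; last exact: ltW.
rewrite ler_pM2l//.
have := Cintegral_Fubini iK; rewrite /= => <-.
rewrite -RintegralZr//; last exact: intR_win.
have KE1 t : Cintegral (fun y => K (t, y)) =
    (win c eta t)%:C * Cintegral (fun s => g s * expi (t * s)).
  rewrite -CintegralZ; last first.
    apply: (@intCMbd _ _ _ 2) => //; last by move=> s; exact: norm1_expi.
    by apply: measC_expi; exact: measurable_funM.
  by congr Cintegral; apply/funext => s; rewrite /K /= mulrA.
apply: norm1_Cintegral_le; first exact: (intC_Cintegral iK).
  under eq_fun do rewrite mulrC.
  by apply: intRZ; exact: intR_win.
move=> t; rewrite KE1 norm1_realM ger0_norm; last exact: tri_ge0.
have [tc|tc] := ltP `|t - c| eta.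
  by rewrite ler_wpM2l ?tri_ge0//; exact: gB.
by rewrite win_out// !mul0r.
Qed.

Lemma intR_tri_scale (a : R) : 0 < a -> intR (fun s => tri (s / a)).
Proof.
move=> a0; have a1 : 0 < a^-1 by rewrite invr_gt0.
have := intR_affine (h := tri) 0 a1 (@intR_tri R).
by under eq_fun do rewrite addr0 mulrC.
Qed.

Lemma measurable_tri_scale (a : R) : measurable_fun setT (fun s : R => tri (s / a)).
Proof.
apply: (measurableT_comp (f := tri)); first exact: measurable_tri.
by apply: measurable_funM => //; exact: measurable_cst.
Qed.

Lemma cvg_tri_scale (s : R) : tri (s / k.+1%:R) @[k --> \oo] --> (1 : R).
Proof.
have t0 : tri (0 : R) = 1 by rewrite tri_in ?normr0 ?subr0.
have c : (s / k.+1%:R : R) @[k --> \oo] --> (0 : R).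
  by rewrite -(mulr0 s); apply: cvgM; [exact: cvg_cst|exact: cvg_harmonic].
by rewrite -[X in _ --> X]t0; apply: (cvg_comp _ _ c); exact: continuous_tri.
Qed.

Lemma tail_tri f : intC f ->
  \int[mu]_s (norm1 (f s) * (1 - tri (s / k.+1%:R))) @[k --> \oo] --> 0.
Proof.
move=> fi; apply: (@cvg0_Rintegral R _ (fun s => norm1 (f s))).
- move=> k; apply: measurable_funM.
    by apply: measurable_norm1; exact: intC_measC.
  by apply: measurable_funB; [exact: measurable_cst|exact: measurable_tri_scale].
- move=> k s; have := tri_ge0 (s / k.+1%:R); have := tri_le1 (s / k.+1%:R) => h1 h2.
  rewrite normrM ger0_norm ?norm1_ge0// ger0_norm ?subr_ge0//.
  by rewrite ler_piMr ?norm1_ge0//; lra.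
- exact: intC_norm1.
- apply: aeW => s; rewrite -(mulr0 (norm1 (f s))) -(subrr 1).
  by apply: cvgM; [exact: cvg_cst|apply: cvgB; [exact: cvg_cst|exact: cvg_tri_scale]].
Qed.

Lemma tri_bounded (U : R -> R) (a r : R) : continuous U -> 0 < a ->
  exists2 B : R, 0 <= B & forall s, tri (s / a) * `|U (s + r)| <= B * tri (s / a).
Proof.
move=> cU a0; have aa : - a <= a by lra.
have [|c _ Hc] := @EVT_max R (fun s => `|U (s + r)|) (- a) a aa.
  apply: continuous_subspaceT => s.
  apply: continuous_comp; last exact: norm_continuous.
  apply: continuous_comp; last exact: cU.
  by apply: cvgD; [exact: cvg_id|exact: cvg_cst].
exists `|U (c + r)| => // s; rewrite mulrC.
have [sa|sa] := leP a `|s|.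
  by rewrite tri_out ?mulr0// normrM normfV (gtr0_norm a0) ler_pdivlMr// mul1r.
rewrite ler_wpM2r ?tri_ge0//; apply: Hc; rewrite in_itv /=.
by rewrite -ler_norml ltW.
Qed.

(** Here [psi] is the sequence to which the O(1/a) estimates apply, dominated by U only, and [Psi]
    is a bounded version of it. The kernel F is split by tri(s/a): the tail is small because F is
    integrable and [Psi] bounded, and the central part is O(1/a) by the estimates averaged over the
    window. *)
Lemma good_smear psi Psi (U : R -> R) (M C s0 d : R) :
  continuous U -> (forall n, measC (psi n)) ->
  (forall n s, norm1 (psi n s) <= U s) ->
  (forall n, bdmeas M (Psi n)) ->
  (forall s, \forall n \near \oo, Psi n s = psi n s) -> 0 < d ->
  (forall a r : R, 0 < a -> \forall n \near \oo, forall sigma, `|sigma - s0| < d ->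
     norm1 (Cintegral (fun s => (tri (s / a))%:C *
       (expi (sigma * s) * psi n (s + r)))) <= a^-1 * C) ->
  good Psi s0.
Proof.
move=> cU mpsi psiU bP Ppsi d0 H; exists d => // c eta e0 ce r.
have m0 := (@fejer_mass_gt0 R); set F := fejer c eta.
have iF : intC F by exact: intC_fejer.
have M0 := bdmeas_ge0 (bP 0%N).
pose W : R := (2 * mass)^-1 * (\int[mu]_s win c eta s * C).
have c1 : M * \int[mu]_s (norm1 (F s) * (1 - tri (s / k.+1%:R))) + W * k.+1%:R^-1
    @[k --> \oo] --> 0.
  rewrite [X in _ --> X](_ : _ = M * 0 + W * 0); last by rewrite !mulr0 addr0.
  apply: cvgD.
    by apply: cvgM; [exact: cvg_cst|exact: tail_tri].
  by apply: cvgM; [exact: cvg_cst|exact: cvg_harmonic].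
apply/cvg0P; first by move=> n; exact: norm1_ge0.
move=> e e_gt0; have e2 : 0 < e / 2 by lra.
have /cvgrPdist_le /(_ _ e2) [k _ /(_ k (leqnn _)) Hk] := c1.
set a : R := k.+1%:R in Hk; have a0 : 0 < a by [].
rewrite /= sub0r normrN in Hk; have {}Hk := le_trans (ler_norm _) Hk.
have [B B0 HB] := tri_bounded r cU a0.
have tC : measC (fun s : R => (tri (s / a))%:C : R[i]).
  by apply: measC_real; exact: measurable_tri_scale.
have mg (n : nat) : measC (fun s : R => (tri (s / a))%:C * psi n (s + r)).
  apply: measCM => //; apply: (measC_comp (mpsi n)); exact: measurable_shift.
have gB n (s : R) : norm1 ((tri (s / a))%:C * psi n (s + r)) <= B * tri (s / a).
  rewrite norm1_realM ger0_norm ?tri_ge0//; apply: le_trans (HB s).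
  by rewrite ler_wpM2l ?tri_ge0//; apply: (le_trans (psiU n _)); exact: ler_norm.
have gB1 n (s : R) : norm1 ((tri (s / a))%:C * psi n (s + r)) <= B.
  by apply: (le_trans (gB n s)); rewrite ler_piMr// tri_le1.
have ig (n : nat) : intC (fun s : R => (tri (s / a))%:C * psi n (s + r)).
  by apply: (intC_le (mg n) (gB n)); apply: intRZ; exact: intR_tri_scale.
(* The cost of passing from [Psi] to [psi] on the central part. At each s it is eventually 0, and
   the triangle confines it to a compact set, where U is bounded. *)
pose h (n : nat) (s : R) := (tri (s / a))%:C * (Psi n (s + r) - psi n (s + r)).
have mh (n : nat) : measC (h n).
  apply: measCM => //; apply: measCB.
    apply: (measC_comp (bP n).1); exact: measurable_shift.
  apply: (measC_comp (mpsi n)); exact: measurable_shift.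
have hB (n : nat) (s : R) : norm1 (h n s) <= M + B.
  rewrite /h mulrBr; apply: (le_trans (norm1B _ _)); apply: lerD => //.
  rewrite norm1_realM ger0_norm ?tri_ge0//; apply: le_trans ((bP n).2 (s + r)).
  by rewrite ler_piMl ?norm1_ge0 ?tri_le1.
have ih (n : nat) : intC (fun s : R => F s * h n s) by exact: (intCMbd iF (mh n) (hB n)).
have c2 : norm1 (Cintegral (fun s : R => F s * h n s)) @[n --> \oo] --> 0.
  apply: (@cvg0_Cintegral R _ (fun s : R => (M + B) * norm1 (F s))).
  - by move=> n; exact: intC_measC.
  - move=> n t; apply: (le_trans (norm1M _ _)).
    by rewrite mulrC ler_wpM2r ?norm1_ge0.
  - by apply: intRZ; exact: intC_norm1.
  - apply: aeW => t; apply: cvg_near_cst; apply: filterS (Ppsi (t + r)) => n e'.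
    by rewrite /h e' subrr !mulr0 norm1_0.
have p0 (n : nat) : 0 <= norm1 (Cintegral (fun s : R => F s * h n s)) by exact: norm1_ge0.
have [N1 HN1] := (cvg0P p0).1 c2 _ e2.
have [N2 _ HN2] := H a r a0.
exists (maxn N1 N2) => n; rewrite geq_max => /andP[n1 n2].
have i3 : intC (fun s : R => F s * ((1 - tri (s / a))%:C * Psi n (s + r))).
  apply: (@intCMbd _ _ _ M) => //.
    apply: measCM; last by apply: (measC_comp (bP n).1); exact: measurable_shift.
    apply: measC_real; apply: measurable_funB; first exact: measurable_cst.
    exact: measurable_tri_scale.
  move=> s; have := tri_ge0 (s / a); have := tri_le1 (s / a) => h1 h2.
  rewrite norm1_realM ger0_norm ?subr_ge0//; apply: le_trans ((bP n).2 (s + r)).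
  by rewrite ler_piMl ?norm1_ge0//; lra.
have i4 : intC (fun s : R => (tri (s / a))%:C * psi n (s + r) * F s).
  under eq_fun do rewrite mulrC.
  exact: (intCMbd iF (mg n) (gB1 n)).
have -> : actS F Psi n r =
    Cintegral (fun s : R => F s * ((1 - tri (s / a))%:C * Psi n (s + r))) +
    Cintegral (fun s : R => F s * h n s) +
    Cintegral (fun s : R => (tri (s / a))%:C * psi n (s + r) * F s).
  rewrite -(CintegralD i3 (ih n)) -(CintegralD (intCD i3 (ih n)) i4).
  rewrite /actS /act; congr Cintegral; apply/funext => s.
  by rewrite /h rmorphB rmorph1; ring.
have b3 : norm1 (Cintegral (fun s : R => F s * ((1 - tri (s / a))%:C * Psi n (s + r)))) <=
    M * \int[mu]_s (norm1 (F s) * (1 - tri (s / a))).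
  have it : intR (fun s : R => norm1 (F s) * (1 - tri (s / a))).
    apply: (intR_le _ _ (intC_norm1 iF)).
      apply: measurable_funM.
        by apply: measurable_norm1; exact: intC_measC.
      by apply: measurable_funB; [exact: measurable_cst|exact: measurable_tri_scale].
    move=> s; have := tri_ge0 (s / a); have := tri_le1 (s / a) => h1 h2.
    rewrite normrM ger0_norm ?norm1_ge0// ger0_norm ?subr_ge0//.
    by rewrite ler_piMr ?norm1_ge0//; lra.
  rewrite -RintegralZl//; apply: norm1_Cintegral_le => //; first exact: intRZ.
  move=> s; apply: (le_trans (norm1M _ _)).
  rewrite norm1_realM ger0_norm ?subr_ge0 ?tri_le1// mulrCA mulrC -mulrA.
  rewrite mulrC -mulrA [X in X <= _]mulrC.
  have := (bP n).2 (s + r).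
  move=> hh; rewrite [leLHS](_ : _ = norm1 (Psi n (s + r)) * (norm1 (F s) * (1 - tri (s / a)))); last by ring.
  by apply: ler_wpM2r => //; rewrite mulr_ge0 ?norm1_ge0// subr_ge0 tri_le1.
have b4 : norm1 (Cintegral (fun s : R => (tri (s / a))%:C * psi n (s + r) * F s)) <= W * a^-1.
  have -> : W * a^-1 = (2 * mass)^-1 * (\int[mu]_s win c eta s * (a^-1 * C)).
    by rewrite /W; ring.
  apply: norm1_fejer_pairing => // sigma sc.
  under eq_fun do rewrite -mulrA [psi _ _ * _]mulrC.
  apply: (HN2 n n2); have := ler_distD c sigma s0; lra.
have := HN1 n n1.
have := norm1D (Cintegral (fun s : R => F s * ((1 - tri (s / a))%:C * Psi n (s + r))) +
    Cintegral (fun s : R => F s * h n s)) (Cintegral (fun s : R => (tri (s / a))%:C * psi n (s + r) * F s)).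
have := norm1D (Cintegral (fun s : R => F s * ((1 - tri (s / a))%:C * Psi n (s + r))))
    (Cintegral (fun s : R => F s * h n s)).
move: b3 b4 Hk; set A1 := Cintegral _; set A2 := Cintegral _; set A3 := Cintegral _.
set I := Rintegral _ _ _; move: (norm1 (A1 + A2 + A3)) (norm1 (A1 + A2)).
move: (norm1 A1) (norm1 A2) (norm1 A3) (M * I) (W * a^-1).
by move=> x1 x2 x3 y1 y2 z1 z2 *; lra.
Qed.

End smearing.

(** * Functionals and the Bochner integral *)

Section bochner_functional.
Context {R : realType} {X : completeNormedModType R[i]}.
Notation mu := (@lebesgue_measure R).

(** Directly from the definition as a supremum over simple functions, hence without measurability,
    which is not at hand for the error Nrm (F t - step_eval (s n) t). *)
Lemma ge0_le_integralT (f1 f2 : R -> \bar R) : (forall t, 0 <= f1 t)%E ->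
  (forall t, f1 t <= f2 t)%E -> (\int[mu]_t f1 t <= \int[mu]_t f2 t)%E.
Proof.
move=> f10 f12; have f20 t : (0 <= f2 t)%E by exact: le_trans (f12 t).
rewrite !ge0_integralTE//; apply: ereal_sup_le => _ [h hf <-]; exists h => // t.
exact: le_trans (f12 t).
Qed.

Lemma intR_indic (A : set R) : measurable A -> (mu A < +oo)%E ->
  intR (\1_A : R -> R).
Proof. move=> mA Afin; apply/integrableP; split; first by apply/measurable_EFinP.
under eq_integral do rewrite /= ger0_norm ?indicE ?ler0n//.
have := integral_indic mu measurableT mA; rewrite setIT.
by under eq_integral do rewrite indicE; move=> ->. Qed.

Lemma Rintegral_indicT (A : set R) : measurable A ->
  \int[mu]_t (\1_A t : R) = fine (mu A).
Proof. by move=> mA; rewrite /Rintegral integral_indic// setIT. Qed.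

Variable l : X -> R[i].
Hypothesis lD : forall x y, l (x + y) = l x + l y.
Hypothesis lZ : forall (c : R[i]) x, l (c *: x) = c * l x.

Lemma functional0 : l 0 = 0.
Proof. by rewrite -(scale0r 0) lZ mul0r. Qed.

Lemma functional_step (D : set R) (s : seq (set R * X)) : is_step D s ->
  intC (fun t => l (step_eval s t)) /\
  Cintegral (fun t => l (step_eval s t)) = l (step_integral s).
Proof.
elim: s => [|p s IH] Hs.
  have E : (fun t => l (step_eval [::] t)) = (fun=> 0).
    by apply/funext => t; rewrite /step_eval big_nil functional0.
  rewrite E Cintegral0 /step_integral big_nil functional0; split => //.
  by split => /=; exact: intR0.
have [|i e] := IH; first by move=> q qs; apply: Hs; rewrite inE qs orbT.
have [mp _ pfin] := Hs p (mem_head _ _).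
have E : (fun t => l (step_eval (p :: s) t)) =
    (fun t => l p.2 * (\1_(p.1) t)%:C + l (step_eval s t)).
  by apply/funext => t; rewrite /step_eval big_cons lD lZ mulrC.
have i1 : intC (fun t => (\1_(p.1) t)%:C : R[i]).
  by apply: intC_real; exact: intR_indic.
rewrite E; split; first by apply: intCD => //; exact: intCZ.
rewrite CintegralD//; last exact: intCZ.
rewrite CintegralZ// e Cintegral_real Rintegral_indicT//.
by rewrite /step_integral big_cons lD lZ mulrC.
Qed.

Lemma step_eval_out (D : set R) (s : seq (set R * X)) t : is_step D s ->
  ~ D t -> step_eval s t = 0.
Proof.
move=> Hs Dt; rewrite /step_eval big_seq big1// => p /Hs [_ pD _].
have -> : \1_(p.1) t = 0 :> R by rewrite indicE memNset// => /pD.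
by rewrite scale0r.
Qed.

Variable K : R.
Hypothesis K0 : 0 < K.
Hypothesis lK : forall x, norm1 (l x) <= K * Nrm x.

(** The identity is exact for step functions. Replacing I and g by their step approximations costs
    at most K times the two errors in the definition of the Bochner integral. *)
Lemma bochner_functional (D : set R) (F : R -> X) (I : X) (g : R -> R[i]) :
  is_bochner_integral D F I -> intC g -> (forall t, D t -> g t = l (F t)) ->
  (forall t, ~ D t -> g t = 0) -> l I = Cintegral g.
Proof.
move=> [s [Hs _ sF sI]] ig gD gN.
have lB x y : l (x - y) = l x - l y by rewrite lD -scaleN1r lZ mulN1r.
suff small (e : R) : 0 < e -> norm1 (l I - Cintegral g) <= K * e + K * e.
  apply/eqP; rewrite -subr_eq0; apply/eqP; apply: norm1_eq0.
  apply/eqP; rewrite eq_le norm1_ge0 andbT; apply/ler_addgt0Pr => e e0.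
  have e2 : 0 < e / (2 * K) by rewrite divr_gt0// mulr_gt0.
  have := small _ e2; have -> : K * (e / (2 * K)) = e / 2.
    by rewrite invfM mulrCA [2^-1 / K]mulrC mulVKf ?gt_eqF.
  by rewrite add0r -splitr.
move=> e0.
have [n1 _ Hn1] := (cvg_NrmP _ _ _).1 sI _ e0.
have [n2 _ Hn2] : \forall n \near \oo,
    (\int[mu]_(t in D) (Nrm (F t - step_eval (s n) t))%:E < e%:E)%E.
  apply: (sF [set x | (x < e%:E)%E]); apply: open_nbhs_nbhs; split; first exact: open_ereal_lt_ereal.
  by rewrite /= lte_fin.
pose n := maxn n1 n2.
have h1 : Nrm (I - step_integral (s n)) < e by apply: Hn1; rewrite /= leq_maxl.
have h2 := Hn2 n (leq_maxr _ _).
have [i se] := functional_step (Hs n).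
have -> : l I - Cintegral g = l (I - step_integral (s n)) -
    Cintegral (fun t => g t - l (step_eval (s n) t)).
  by rewrite lB CintegralB// se opprB addrA subrK.
apply: (le_trans (norm1B _ _)); apply: lerD.
  by apply: (le_trans (lK _)); rewrite ler_pM2l// ltW.
have ih : intC (fun t => g t - l (step_eval (s n) t)) by exact: intCB.
apply: (le_trans (norm1_Cintegral ih)); rewrite -ler_pdivrMl//.
rewrite -RintegralZl//; last exact: intC_norm1.
rewrite -lee_fin -intR_integral_EFin; last by apply: intRZ; exact: intC_norm1.
apply: ltW; apply: le_lt_trans h2; rewrite [leRHS]integral_mkcond.
apply: ge0_le_integralT => t.
  by rewrite lee_fin mulr_ge0 ?norm1_ge0// invr_ge0 ltW.
rewrite patchE; case: ifPn => [/set_mem Dt|/negP Dt].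
  by rewrite gD// -lB lee_fin ler_pdivrMl.
have {}Dt : ~ D t by move=> Dt'; apply: Dt; rewrite inE.
by rewrite gN// (step_eval_out (Hs n) Dt) functional0 subrr norm1_0 mulr0.
Qed.

End bochner_functional.

(** * Rescaled orbits and the conclusion *)

Section orbit_sequence.
Context {R : realType} {X : completeNormedModType R[i]}.
Notation mu := (@lebesgue_measure R).
Variables (T : R -> {linear X -> X}) (u : R -> R).
Hypothesis hT : is_C0_semigroup T.
Hypothesis cu : continuous u.
Hypothesis hTu : forall t : R, 0 <= t -> (opnorm (T t) <= (u t)%:E)%E.
Hypothesis u1 : forall t, 1 <= u t.
Hypothesis uD : forall s t, u (s + t) <= u s * u t.
Hypothesis u_ratio : forall s, u (t + s) / u t @[t --> +oo] --> (1 : R).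

Let u_gt0 t : 0 < u t.
Proof. exact: lt_le_trans (u1 t). Qed.

Variables (tau : nat -> R) (x : nat -> X) (l : nat -> X -> R[i]).
Hypothesis tau_gt0 : forall n, 0 < tau n.
Hypothesis tau_oo : tau n @[n --> \oo] --> +oo.
Hypothesis x1 : forall n, Nrm (x n) <= 1.
Hypothesis lD : forall n y z, l n (y + z) = l n y + l n z.
Hypothesis lZ : forall n (c : R[i]) y, l n (c *: y) = c * l n y.
Hypothesis lle : forall n y, norm1 (l n y) <= 2 * Nrm y.

(** The values of T at negative times are meaningless and are cut off. With a strict inequality the
    orbit lives on an open set, where continuity yields measurability. *)
Definition orbit_fun n (t : R) : R[i] := if 0 < t then l n (T t (x n)) else 0.

Definition rescaled n (s : R) : R[i] :=
  ((u (tau n))^-1)%:C * orbit_fun n (tau n + s).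

(** The level 4 is 2 * 2: the functionals contribute 2, and u(tau_n + s) / u(tau_n), which tends to
    1, is eventually at most 2. So at each s the truncation is eventually inactive. *)
Definition truncated n (s : R) : R[i] :=
  if norm1 (rescaled n s) <= 4 then rescaled n s else 0.

Lemma measC_orbit_fun n : measC (orbit_fun n).
Proof.
have H (p : R[i] -> R) : p 0 = 0 ->
    (forall t : R, 0 < t -> {for t, continuous (fun s => p (l n (T s (x n))))}) ->
    measurable_fun setT (fun t : R => p (orbit_fun n t)).
  move=> p0 pc.
  have -> : (fun t : R => p (orbit_fun n t)) =
      (fun t : R => if 0 < t then p (l n (T t (x n))) else 0).
    by apply/funext => t; rewrite /orbit_fun; case: ifP.
  apply: measurable_fun_if => //.
  - by apply: measurable_fun_ltr => //; exact: measurable_cst.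
  - rewrite setTI; apply: open_continuous_measurable_fun.
      rewrite (_ : _ @^-1` _ = `]0, +oo[%classic); first exact: interval_open.
      by apply/seteqP; split => t /=; rewrite in_itv/= andbT.
    by move=> t; rewrite inE /= => t0; exact: pc.
have c (t : R) : 0 < t -> ccontinuous_at (fun s => l n (T s (x n))) t.
  move=> t0; have t00 : 0 < 0 + t by rewrite add0r.
  have := @orbit_ccontinuous R X T u hT cu hTu (l n) (lD n) (lZ n) (lle n) 0 t (x n) t00.
  by under eq_fun do rewrite add0r.
by split; apply: H => // t t0; have [] := c t t0.
Qed.

Lemma measC_rescaled n : measC (rescaled n).
Proof.
apply: measCM; first exact: measC_cst.
apply: (measC_comp (measC_orbit_fun n)).
by apply: measurable_funD => //; exact: measurable_cst.
Qed.

Lemma norm1_rescaled_ratio n s : norm1 (rescaled n s) <= 2 * (u (tau n + s) / u (tau n)).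
Proof.
have ut := u_gt0 (tau n).
rewrite norm1_realM ger0_norm; last by rewrite invr_ge0 ltW.
have -> : 2 * (u (tau n + s) / u (tau n)) = (u (tau n))^-1 * (2 * (u (tau n + s) * 1)) by ring.
rewrite ler_pM2l ?invr_gt0// /orbit_fun; case: ifP => ts; last first.
  by rewrite norm1_0 mulr1 mulr_ge0// ltW.
apply: (le_trans (lle _ _)); rewrite ler_pM2l//.
apply: (le_trans (semigroup_le hTu _ (ltW ts))).
by rewrite ler_pM2l.
Qed.

Lemma norm1_rescaled n s : norm1 (rescaled n s) <= 2 * u s.
Proof.
apply: (le_trans (norm1_rescaled_ratio n s)); rewrite ler_pM2l//.
by rewrite ler_pdivrMr// mulrC.
Qed.

Lemma bdmeas_truncated n : bdmeas 4 (truncated n).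
Proof.
split; last by move=> t; rewrite /truncated; case: ifP => // _; rewrite norm1_0.
apply: measC_if; last exact: measC_rescaled.
apply: measurable_fun_ler; last exact: measurable_cst.
by apply: measurable_norm1; exact: measC_rescaled.
Qed.

Lemma u_ratio_seq s (e : R) : 1 < e -> \forall n \near \oo, u (tau n + s) <= e * u (tau n).
Proof.
move=> e1; have c : u (tau n + s) / u (tau n) @[n --> \oo] --> (1 : R).
  exact: (cvg_comp _ _ tau_oo (u_ratio s)).
have e0 : 0 < e - 1 by lra.
have /cvgrPdist_le /(_ _ e0) := c; apply: filterS => n.
rewrite ler_norml => /andP[h _]; rewrite -ler_pdivrMr//; lra.
Qed.

Lemma truncatedE s : \forall n \near \oo, truncated n s = rescaled n s.
Proof.
have e1 : 1 < 2 :> R by lra.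
apply: filterS (u_ratio_seq s e1) => n h.
rewrite /truncated ifT//; apply: (le_trans (norm1_rescaled_ratio n s)).
have -> : 4 = 2 * 2 :> R by ring.
by rewrite ler_pM2l// ler_pdivrMr.
Qed.

(** For sigma near s0 the equation (lambda - A)^2 y = x with lambda = -i sigma is solvable with a
    bound independent of sigma and n, so [tri_orbit] gives the O(1/a) estimate that [good_smear]
    asks for. *)
Lemma good_truncated s0 : resolvent_set (generator T) (0 -i* s0) -> good truncated s0.
Proof.
move=> rs; have [d d0 [C C0 HC]] := resolvent_near rs.
apply: (@good_smear R rescaled truncated (fun s => 2 * u s) 4 (32 * C ^+ 2) s0 d) => //.
- by move=> s; apply: cvgM; [exact: cvg_cst|exact: cu].
- exact: measC_rescaled.
- exact: norm1_rescaled.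
- exact: bdmeas_truncated.
- exact: truncatedE.
move=> a r a0; have e1 : 1 < 2 :> R by lra.
(* Keeps the whole interval [tau_n + r - a, tau_n + r + a] at positive times, where the orbit is
   differentiable. *)
have far : \forall n \near \oo, a < tau n + r.
  have /cvgryPgt /(_ (a - r)) := tau_oo; apply: filterS => n; lra.
apply: filterS (filterI (filterI (u_ratio_seq (r + a) e1) (u_ratio_seq r e1))
  (filterI (u_ratio_seq (r - a) e1) far)) => n [[h1 h2] [h3 h4]] sigma sd.
have ls : Nrm ((0 -i* sigma) - (0 -i* s0)) < d.
  rewrite NrmE /= subr0 expr0n add0r sqrtr_sqr opprK.
  by rewrite addrC distrC.
(* The normalisation is put into the vector: two resolvents give C^2 / u(tau_n), the three values of
   u are at most 2 u(tau_n), and the product with 16 is 32 C^2. *)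
pose x' := (u (tau n))^-1%:C *: x n.
have [y1 g1 y1C] := HC _ ls x'.
have [y2 g2 y2C] := HC _ ls y1.
have ut := u_gt0 (tau n).
have y2C' : Nrm y2 <= C ^+ 2 * (u (tau n))^-1.
  apply: (le_trans y2C); rewrite expr2 -mulrA ler_pM2l//.
  apply: (le_trans y1C); rewrite ler_pM2l// NrmZ Nrm_real ger0_norm; last first.
    by rewrite invr_ge0 ltW.
  by rewrite ler_piMr// invr_ge0 ltW.
rewrite addrA in h1; rewrite addrA in h3.
have := @tri_orbit R X T u hT cu hTu (l n) (lD n) (lZ n) (lle n)
  sigma (tau n + r) a _ _ x' y1 y2 a0 h4 g1 g2 y2C' h1 h2 h3.
have -> : 16 * (C ^+ 2 / u (tau n)) * (2 * u (tau n)) = 32 * C ^+ 2.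
  have -> : 16 * (C ^+ 2 / u (tau n)) * (2 * u (tau n)) =
    32 * C ^+ 2 * (u (tau n) / u (tau n)) by ring.
  by rewrite divff ?mulr1// gt_eqF.
set I1 := Cintegral _; set I2 := Cintegral _.
suff -> : I1 = I2 by [].
congr Cintegral; apply/funext => s.
have [sa|sa] := leP a `|s|.
  rewrite tri_out ?mul0r// normrM normfV (gtr0_norm a0) ler_pdivlMr// mul1r//.
congr (_ * (_ * _)); rewrite /rescaled /orbit_fun addrA addrAC.
move: sa; rewrite ltr_norml => /andP[s1 s2].
by rewrite ifT; [rewrite linearZ lZ|lra].
Qed.

Variable f : R -> R[i].
Hypothesis fi : intC f.
Hypothesis fu : intR (fun s => norm1 (f s) * u s).
Hypothesis fneg : forall t, t < 0 -> f t = 0.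

Lemma intC_f_rescaled n : intC (fun s => f s * rescaled n s).
Proof.
apply: (@intC_le _ _ (fun s => 2 * (norm1 (f s) * u s))); last exact: intRZ.
  by apply: measCM; [exact: intC_measC|exact: measC_rescaled].
move=> s; apply: (le_trans (norm1M _ _)).
by rewrite mulrCA ler_wpM2l ?norm1_ge0// norm1_rescaled.
Qed.

(** The truncation is removed by dominated convergence; the majorant 2 |f| u is integrable because f
    lies in the weighted space. *)
Lemma rescaled_pairing_cvg0 : null (actS f truncated) ->
  norm1 (Cintegral (fun s => f s * rescaled n s)) @[n --> \oo] --> 0.
Proof.
move=> nl.
have i2 n : intC (fun s => f s * truncated n s).
  exact: (intCMbd fi (bdmeas_truncated n).1 (bdmeas_truncated n).2).
have i3 n : intC (fun s => f s * (rescaled n s - truncated n s)).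
  by under eq_fun do rewrite mulrBr; apply: intCB; [exact: intC_f_rescaled|exact: i2].
have c3 : norm1 (Cintegral (fun s => f s * (rescaled n s - truncated n s)))
    @[n --> \oo] --> 0.
  apply: (@cvg0_Cintegral R _ (fun s => 2 * (norm1 (f s) * u s))).
  - by move=> n; exact: intC_measC.
  - move=> n s; apply: (le_trans (norm1M _ _)); rewrite mulrCA.
    rewrite ler_wpM2l ?norm1_ge0//; apply: le_trans (norm1_rescaled n s).
    rewrite /truncated; case: ifP => _; last by rewrite subr0.
    by rewrite subrr norm1_0 norm1_ge0.
  - exact: intRZ.
  - apply: aeW => s; apply: cvg_near_cst; apply: filterS (truncatedE s) => n ->.
    by rewrite subrr mulr0 norm1_0.
have c2 := nl 0.
have c : norm1 (actS f truncated n 0) +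
    norm1 (Cintegral (fun s => f s * (rescaled n s - truncated n s)))
    @[n --> \oo] --> 0.
  by rewrite -[X in _ --> X](addr0 0); apply: cvgD.
apply: (squeeze_cvgr _ (cvg_cst 0) c); apply: nearW => n.
rewrite norm1_ge0/=; apply: le_trans (norm1D _ _).
rewrite /actS /act; under [X in Cintegral X + _]eq_fun do rewrite addr0.
rewrite -(CintegralD (i2 n) (i3 n)).
have -> : (fun t => f t * truncated n t + f t * (rescaled n t - truncated n t)) =
    (fun t => f t * rescaled n t).
  by apply/funext => t; rewrite -mulrDr addrCA subrr addr0.
exact: lexx.
Qed.

(** The functional y |-> l_n(T(tau_n) y) is bounded by 2 u(tau_n), so it can be taken inside the
    integral, where the semigroup law produces T(tau_n + s) x_n. *)
Lemma rescaled_pairing n I : is_bochner_integral `[0, +oo[ (fun s => f s *: T s (x n)) I ->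
  l n (T (tau n) I) = (u (tau n))%:C * Cintegral (fun s => f s * rescaled n s).
Proof.
move=> bI; have ut := u_gt0 (tau n).
have K0 : 0 < 2 * u (tau n) by rewrite mulr_gt0.
rewrite -CintegralZ; last exact: intC_f_rescaled.
apply: (@bochner_functional R X (fun y => l n (T (tau n) y)) _ _ (2 * u (tau n)) K0
  _ `[0, +oo[%classic _ _ _ bI).
- by move=> y z; rewrite linearD lD.
- by move=> c y; rewrite linearZ lZ.
- move=> y; apply: (le_trans (lle _ _)); rewrite -mulrA ler_pM2l//.
  exact: (semigroup_le hTu _ (ltW (tau_gt0 n))).
- by apply: intCZ; exact: intC_f_rescaled.
- move=> t; rewrite /= in_itv/= andbT => t0.
  rewrite linearZ lZ -semigroupD//; last exact: ltW.
  rewrite /rescaled /orbit_fun ifT; last by have := tau_gt0 n; lra.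
  rewrite mulrCA; congr (_ * _); rewrite mulrA -rmorphM divff ?gt_eqF//.
  by rewrite rmorph1 mul1r.
- move=> t; rewrite /= in_itv/= andbT => /negP; rewrite -ltNge => t0.
  by rewrite fneg// mul0r mulr0.
Qed.

End orbit_sequence.

Section weighted.
Context {R : realType}.
Notation mu := (@lebesgue_measure R).

Lemma increment_ratio (g : R -> R) h : (forall t, 1 <= g t) ->
  C0 (fun t => Delta h g t / g t) -> g (t + h) / g t @[t --> +oo] --> (1 : R).
Proof.
move=> g1 [_ c _].
have -> : (fun t => g (t + h) / g t) = (fun t => Delta h g t / g t + 1).
  apply/funext => t; have gt : g t != 0 by rewrite gt_eqF// (lt_le_trans _ (g1 t)).
  by rewrite /Delta mulrBl divff// subrK.
by rewrite -[X in _ --> X]add0r; apply: cvgD => //; exact: cvg_cst.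
Qed.

Lemma intR_weight (f : R -> R[i]) (w v : R -> R) : continuous w -> continuous v ->
  (forall t, 1 <= w t) -> (forall t, 1 <= v t) ->
  L1u_Rplus v w f -> intC f /\ intR (fun s => norm1 (f s) * (v s * w s)).
Proof.
move=> cw cv w1 v1 [[m1 m2 _] _ [_ _ vf]].
have w0 t : 0 <= w t by exact: le_trans (w1 t).
have v0 t : 0 <= v t by exact: le_trans (v1 t).
have mf : measC f by split.
have mw : measurable_fun setT w by exact: continuous_measurable_fun.
have mv : measurable_fun setT v by exact: continuous_measurable_fun.
have NE t : Nrm ((v t)%:C * f t) = v t * Nrm (f t).
  by have := NrmZ (X := R[i]^o) (v t)%:C (f t); rewrite Nrm_real ger0_norm.
have mN : measurable_fun setT (fun t => Nrm (f t)).
  under eq_fun do rewrite NrmE.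
  have ms : measurable_fun setT (Num.sqrt : R -> R).
    by apply: continuous_measurable_fun; exact: sqrt_continuous.
  apply: (measurableT_comp ms).
  by apply: measurable_funD; exact: measurable_funX.
have i1 : intR (fun t => v t * Nrm (f t) * w t).
  apply/integrableP; split.
    by apply/measurable_EFinP; apply: measurable_funM => //; exact: measurable_funM.
  move: vf; apply: le_lt_trans; rewrite le_eqVlt; apply/orP; left; apply/eqP.
  apply: eq_integral => t _ /=; rewrite NE ger0_norm//.
  by rewrite !mulr_ge0// Nrm_ge0.
have i2 : intR (fun s => norm1 (f s) * (v s * w s)).
  apply: (intR_le _ _ (intRZ 2 i1)).
    by apply: measurable_funM; [exact: measurable_norm1|exact: measurable_funM].
  move=> t; rewrite ger0_norm; last by rewrite mulr_ge0 ?norm1_ge0// mulr_ge0.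
  have -> : 2 * (v t * Nrm (f t) * w t) = 2 * Nrm (f t) * (v t * w t) by ring.
  by rewrite ler_wpM2r ?norm1_le_Nrm// mulr_ge0.
split => //; apply: (intC_le mf _ i2) => t.
by rewrite ler_peMr ?norm1_ge0// mulr_ege1.
Qed.

End weighted.

(** * Residuality, the contradiction and the operator norm *)

Section vanishing.
Context {R : realType} {X : completeNormedModType R[i]}.
Variables (T : R -> {linear X -> X}) (u : R -> R) (f : R -> R[i]).
Hypothesis hT : is_C0_semigroup T.
Hypothesis cu : continuous u.
Hypothesis hTu : forall t : R, 0 <= t -> (opnorm (T t) <= (u t)%:E)%E.
Hypothesis u1 : forall t, 1 <= u t.
Hypothesis uD : forall s t, u (s + t) <= u s * u t.
Hypothesis u_ratio : forall s, u (t + s) / u t @[t --> +oo] --> (1 : R).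
Hypothesis fi : intC f.
Hypothesis fu : intR (fun s => norm1 (f s) * u s).
Hypothesis fneg : forall t, t < 0 -> f t = 0.
Notation spec := (ispectrum_real (generator T)).
Hypothesis hf0 : forall gamma : dual, alpha_preimage spec gamma -> fourier f gamma = 0.
Hypothesis hres : residual (supp (fourier f) `&` alpha_preimage spec).

(** The number [0 -i* s] is the lambda with i lambda = s. *)
Lemma resolvent_off_spectrum (s : R) : ~ spec s ->
  resolvent_set (generator T) (0 -i* s).
Proof.
move=> ns; apply: contrapT => nr; apply: ns; exists (0 -i* s) => //.
by apply: complexP; rewrite ?cReM ?cImM /=; ring.
Qed.

Lemma alpha_preimage_chr (s : R) : spec s -> alpha_preimage spec (chr s).
Proof. by move=> Ds; exists s. Qed.

Lemma null_of_good_off_spectrum Psi (M : R) : (forall n, bdmeas M (Psi n)) ->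
  (forall s, resolvent_set (generator T) (0 -i* s) -> good Psi s) ->
  null (actS f Psi).
Proof.
move=> bP gP; have nP : nice (actS f Psi) by exact: (nice_act0 fi bP).
pose B : set R := [set s | ~ good (actS f Psi) s].
have BD s : B s -> spec s.
  move=> Bs; apply: contrapT => nD; apply: Bs.
  exact: (good_actS fi bP (gP s (resolvent_off_spectrum nD))).
suff B0 : B = set0.
  apply: all_good_null => // s; apply: contrapT => ng.
  by have : B s by []; rewrite B0.
apply: (residual_set0 hres).
- move=> s Bs; split; last by apply: alpha_preimage_chr; exact: BD.
  apply: chr_supp => d d0; apply: contrapT => H; apply: Bs.
  apply: (good_supp fi bP d0) => y yd; apply: contrapT => /eqP fy.
  by apply: H; exists y.
- by move=> gamma [_ [s _ gs]]; exists s; apply: chrP.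
- move=> s /contrapT gs; have [d d0 Hd] := good_open gs.
  by exists d => // s' s'd; rewrite /B /= => h; apply: h; exact: Hd.
- move=> s Bs d d0; have Ds := BD s Bs; apply: contrapT => H; apply: Bs.
  apply: (good_isolated fi bP _ d0).
    by rewrite -fourier_chr; apply: hf0; exact: alpha_preimage_chr.
  move=> s' s'0 s'd; apply: contrapT => ng; apply: H.
  by exists s'.
Qed.

(** The operator norm requires uniformity in y, so a counterexample comes with vectors and norming
    functionals that both change with n. *)
Lemma orbit_fhat_op_small (e : R) : 0 < e -> exists M : R, forall t y,
  M < t -> Nrm y <= 1 -> Nrm (T t (fhat_op T f y)) <= e * u t.
Proof.
move=> e0; apply: contrapT => nM.
have /choice [p Hp] n : exists p : R * X, [/\ n.+1%:R < p.1, Nrm p.2 <= 1 &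
    e * u p.1 < Nrm (T p.1 (fhat_op T f p.2))].
  apply: contrapT => np; apply: nM; exists n.+1%:R => t y nt y1.
  by rewrite leNgt; apply/negP => lt; apply: np; exists (t, y).
pose tau n := (p n).1; pose x n := (p n).2.
have tau_gt0 n : 0 < tau n by have [h _ _] := Hp n; apply: lt_trans h.
have x1 n : Nrm (x n) <= 1 by have [_ h _] := Hp n.
have tau_oo : tau n @[n --> \oo] --> +oo.
  apply/cvgryPge => A; near=> n; have [h _ _] := Hp n; apply: le_trans (ltW h).
  near: n; exists (Num.bound `|A|) => // n /= nA.
  apply: (le_trans (ler_norm A)); apply: (le_trans (ltW (archi_boundP (normr_ge0 A)))).
  by rewrite ler_nat (leq_trans nA).
pose I n := fhat_op T f (x n).
(* If no Bochner integral existed, [bochner_integral] would take its default value 0, and the lower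
   bound on the orbit of [I n] would fail. *)
have bI n : is_bochner_integral `[0, +oo[ (fun s => f s *: T s (x n)) (I n).
  apply: contrapT => nb; have [_ _] := Hp n; rewrite ltNge => /negP; apply.
  rewrite /fhat_op /bochner_integral xgetPN ?linear0 ?Nrm0//.
    by rewrite mulr_ge0// ltW// (lt_le_trans _ (u1 _)).
  by move=> J JI; apply: nb; apply: xgetPex; exists J.
(* The functional norms the vector that is supposed to be large, so the scalar pairing inherits the
   lower bound e u(tau_n). *)
have /choice [l Hl] n := hahn_banach (T (tau n) (I n)).
have lD n : forall y z, l n (y + z) = l n y + l n z by have [] := Hl n.
have lZ n : forall (c : R[i]) y, l n (c *: y) = c * l n y by have [] := Hl n.
have lle n : forall y, norm1 (l n y) <= 2 * Nrm y by have [] := Hl n.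
have bP := bdmeas_truncated hT cu hTu tau x lD lZ lle.
have nl := null_of_good_off_spectrum bP (good_truncated hT cu hTu u1 uD u_ratio
  tau_oo x1 lD lZ lle).
have c := rescaled_pairing_cvg0 hT cu hTu u1 uD u_ratio tau_oo x1 lD lZ lle fi fu nl.
have /cvgrPdist_lt /(_ _ e0) [n _ /(_ n (leqnn _))] := c.
rewrite /= sub0r normrN ger0_norm ?norm1_ge0//; apply/negP; rewrite -leNgt.
have ut : 0 < u (tau n) by exact: lt_le_trans (u1 _).
have [_ _ _ lI] := Hl n.
have [_ _ /ltW] := Hp n; rewrite -/(tau n) -/(x n) -/(I n) -lI.
rewrite (rescaled_pairing hT cu hTu u1 uD tau_gt0 x1 lD lZ lle fi fu fneg (bI n)).
rewrite cReM /= mul0r subr0 mulrC ler_pM2l// => /le_trans; apply.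
set I0 := Cintegral _.
exact: le_trans (ler_norm _) (le_trans (Re_le_Nrm I0) (Nrm_le_norm1 I0)).
Unshelve. all: by end_near. Qed.

Lemma opnorm_fhat_op_cvg0 :
  (opnorm (fun x => T t (fhat_op T f x)) * ((u t)^-1)%:E)%E @[t --> +oo] --> 0%E.
Proof.
have u0 t : 0 < u t by exact: lt_le_trans (u1 _).
pose q (t : R) := (opnorm (fun x => T t (fhat_op T f x)) * ((u t)^-1)%:E)%E.
have q0 t : 0 <= t -> (0 <= q t)%E.
  move=> t0; apply: mule_ge0; last by rewrite lee_fin invr_ge0 ltW.
  apply: (@le_trans _ _ (Nrm (T t (fhat_op T f 0)))%:E).
    by rewrite lee_fin Nrm_ge0.
  by apply: ereal_sup_ubound; exists 0 => //=; rewrite Nrm0.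
have qe (e : R) : 0 < e -> \forall t \near +oo, (0 <= q t <= e%:E)%E.
  move=> e0; have [M HM] := orbit_fhat_op_small e0.
  near=> t; rewrite q0 /=; last by near: t; exact: nbhs_pinfty_ge.
  have -> : e%:E = ((e * u t)%:E * ((u t)^-1)%:E)%E.
    by rewrite -EFinM mulfK// gt_eqF.
  apply: lee_wpmul2r; first by rewrite lee_fin invr_ge0 ltW.
  have Mt : M < t by near: t; apply: nbhs_pinfty_gt; exact: num_real.
  by apply: ge_ereal_sup => _ [y y1 <-]; rewrite lee_fin; exact: HM.
(* Convergence in the extended reals requires eventual finiteness, which the bound with e = 1
   provides. *)
apply/fine_cvgP; split.
  apply: filterS (qe 1 ltr01) => t /andP[h1 h2].
  by rewrite -/(q t) ge0_fin_numE// (le_lt_trans h2)// ltry.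
apply/cvgrPdist_le => e e0; apply: filterS (qe e e0) => t /andP[h1 h2].
rewrite /= -/(q t) sub0r normrN ger0_norm ?fine_ge0//.
by rewrite -lee_fin fineK// ge0_fin_numE// (le_lt_trans h2)// ltry.
Unshelve. all: by end_near. Qed.

End vanishing.

Theorem theorem11p1 (R : realType) (X : completeNormedModType R[i])
  (T : R -> {linear X -> X}) (A : set (X * X))
  (hT : is_C0_semigroup T) (hA : A = generator T)
  (w v : R -> R) (N : nat)
  (hw : is_weight w) (hwN : polynomial_growth w N) (hv : is_v_function v)
  (hTu : forall t : R, 0 <= t -> (opnorm (T t) <= (v t * w t)%:E)%E)
  (f : R -> R[i]) (hf : L1u_Rplus v w f)
  (hf0 : forall gamma : dual,
     alpha_preimage (ispectrum_real A) gamma -> fourier f gamma = 0)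
  (hres : residual
     (supp (fourier f) `&` alpha_preimage (ispectrum_real A))) :
  (opnorm (fun x => T t (fhat_op T f x)) * ((v t * w t)^-1)%:E)%E
    @[t --> +oo] --> 0%E.
Proof.
subst A; have w1 := weight_ge1 hw; have v1 := v_ge1 hv.
have [fi fu] := intR_weight (weight_cont hw) (v_cont hv) w1 v1 hf.
apply: (@opnorm_fhat_op_cvg0 _ _ T (fun t => v t * w t) f) => //.
- by move=> t; apply: cvgM; [exact: (v_cont hv)|exact: (weight_cont hw)].
- by move=> t; rewrite mulr_ege1.
- move=> s t; rewrite mulrACA; apply: ler_pM.
  + exact: le_trans (v1 _).
  + exact: le_trans (w1 _).
  + exact: v_submul.
  + exact: weight_submul.
- move=> s.
  have -> : (fun t => v (t + s) * w (t + s) / (v t * w t)) =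
      (fun t => v (t + s) / v t * (w (t + s) / w t)).
    by apply/funext => t; rewrite invfM mulrACA.
  rewrite -[X in _ --> X]mulr1; apply: cvgM; apply: increment_ratio => //.
    exact: (v_increment_C0 hv).
  exact: (weight_increment_C0 hw).
- by case: hf.
Qed.
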